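(* Consider the planar piecewise linear systems with real parameters $(\gamma_L,\gamma_R,b,x_L,x_R)$ $$\begin{cases}\dot x=2\gamma_L x-y-b,\\ \dot y=(1+\gamma_L^2)(x-x_L),\end{cases}\ \text{if } x\le 0,\qquad \begin{cases}\dot x=2\gamma_R x-y+b,\\ \dot y=(1+\gamma_R^2)(x-x_R),\end{cases}\ \text{if } x>0.$$ Let $\eta,\xi$ be non-zero real numbers. The local cyclicity of the periodic orbit at infinity, of center type, defined by $\gamma_L=-\gamma_R=-\eta$, $x_L=-x_R=-\xi$ and $b=0$, when perturbed in this class of systems, is at least $2$.
   Context: On $\Sigma=\{x=0\}$ the systems are understood with the Filippov convention; orbits far from the origin cross $\Sigma$ and turn around the origin, so there is a ''periodic orbit at infinity''. It is of center type if all orbits sufficiently far from the origin are periodic. The local cyclicity of the periodic orbit at infinity of a given center system, within the class, is the maximum number of limit cycles of big amplitude that can bifurcate from it, i.e. the maximum $k$ such that in every neighborhood of the given parameter values and for every $M>0$ there are parameters $(\gamma_L,\gamma_R,b,x_L,x_R)$ in that neighborhood whose system has $k$ limit cycles (isolated crossing periodic orbits) intersecting the positive $y$-axis at ordinates larger than $M$. *)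

(* Defs.v *)
(* Stdlib reals with Coquelicot. *)
From Stdlib Require Import Reals.
From Coquelicot Require Import Coquelicot.
Open Scope R_scope.

Record params : Type := Params
  { gammaL : R; gammaR : R; bpar : R; xL : R; xR : R }.

Definition point : Type := (R * R)%type.

Definition fieldL (P : params) (p : point) : point :=
  (2 * gammaL P * fst p - snd p - bpar P,
   (1 + gammaL P ^ 2) * (fst p - xL P)).

Definition fieldR (P : params) (p : point) : point :=
  (2 * gammaR P * fst p - snd p + bpar P,
   (1 + gammaR P ^ 2) * (fst p - xR P)).

(* Filippov's set-valued field: on the line x = 0 it is the segment joining
   the two one-sided values. *)
Definition filippov (P : params) (p v : point) : Prop :=
  (fst p < 0 /\ v = fieldL P p) \/
  (0 < fst p /\ v = fieldR P p) \/
  (fst p = 0 /\ exists s : R, 0 <= s <= 1 /\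
     v = ((1 - s) * fst (fieldL P p) + s * fst (fieldR P p),
          (1 - s) * snd (fieldL P p) + s * snd (fieldR P p))).

(* [F] is meant to be [at_left t] or [at_right t]. *)
Definition one_sided_derive (F : (R -> Prop) -> Prop) (z : R -> point)
    (t : R) (v : point) : Prop :=
  filterlim (fun s => (fst (z s) - fst (z t)) / (s - t)) F (locally (fst v)) /\
  filterlim (fun s => (snd (z s) - snd (z t)) / (s - t)) F (locally (snd v)).

(* Both one-sided velocities are required at every time, since an orbit has a
   corner wherever it passes from one half-plane to the other.  Off the line
   x = 0 this is the ordinary differential equation of the half-plane; where
   both fields point to the same side, it forces the orbit to cross. *)
Definition solution (P : params) (z : R -> point) : Prop :=
  forall t : R,
    (exists v, filippov P (z t) v /\ one_sided_derive (at_left t) z t v) /\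
    (exists v, filippov P (z t) v /\ one_sided_derive (at_right t) z t v).

Definition periodic (z : R -> point) : Prop :=
  (exists T : R, 0 < T /\ forall t, z (t + T) = z t) /\
  (exists t, z t <> z 0).

Definition same_set (G H : point -> Prop) : Prop := forall p, G p <-> H p.

Definition orbit (z : R -> point) : point -> Prop :=
  fun p => exists t, z t = p.

Definition periodic_orbit (P : params) (G : point -> Prop) : Prop :=
  exists z, solution P z /\ periodic z /\ same_set G (orbit z).

Definition crossing_point (P : params) (p : point) : Prop :=
  fst p = 0 /\ 0 < fst (fieldL P p) * fst (fieldR P p).

Definition crossing_periodic_orbit (P : params) (G : point -> Prop) : Prop :=
  periodic_orbit P G /\
  (exists p, G p /\ fst p = 0) /\
  (forall p, G p -> fst p = 0 -> crossing_point P p).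

Definition pdist (p q : point) : R :=
  dist_euc (fst p) (snd p) (fst q) (snd q).

Definition isolated (P : params) (G : point -> Prop) : Prop :=
  exists d : R, 0 < d /\
    forall H, periodic_orbit P H ->
      (forall p, H p -> exists q, G q /\ pdist p q < d) ->
      same_set H G.

Definition limit_cycle (P : params) (G : point -> Prop) : Prop :=
  crossing_periodic_orbit P G /\ isolated P G.

Definition center_at_infinity (P : params) : Prop :=
  exists r : R, forall p : point, r < pdist p (0, 0) ->
    (exists z, solution P z /\ z 0 = p) /\
    (forall z, solution P z -> z 0 = p -> periodic z).

Definition has_big_limit_cycles (P : params) (M : R) (k : nat) : Prop :=
  exists G : nat -> point -> Prop,
    (forall i, (i < k)%nat ->
       limit_cycle P (G i) /\ exists y, M < y /\ G i (0, y)) /\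
    (forall i j, (i < j < k)%nat -> ~ same_set (G i) (G j)).

Definition params_close (e : R) (P Q : params) : Prop :=
  Rabs (gammaL Q - gammaL P) < e /\
  Rabs (gammaR Q - gammaR P) < e /\
  Rabs (bpar Q - bpar P) < e /\
  Rabs (xL Q - xL P) < e /\
  Rabs (xR Q - xR P) < e.

Definition big_limit_cycles_bifurcate (P : params) (k : nat) : Prop :=
  forall e M : R, 0 < e -> 0 < M ->
    exists Q, params_close e P Q /\ has_big_limit_cycles Q M k.

(* The largest such [k], or [p_infty] if there is none; [k = 0] always
   qualifies. *)
Definition local_cyclicity_at_infinity (P : params) : Rbar :=
  Lub_Rbar (fun r => exists k : nat,
                r = INR k /\ big_limit_cycles_bifurcate P k).

(* Main.v *)
(** In a half-plane the flow is a linear focus of angular speed 1, so a half turn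
    between the points [(0, y)] and [(0, y1)] of x = 0 is parametrised by its
    duration [PI + th] with [th] small.  For the half turn
      [hm g th = a w] and [y1 + y = const + 2 hT g th / w], where [w = 2 / (y1 - y)],
    so that [th] can be eliminated: [y1 + y = const + 2 rho g (a w) / w] with
    [rho g = hT g o (hm g)^-1] smooth at 0.  A left and a right half turn glue to
    a closed orbit exactly when [w > 0] is a zero of
      [F w = rho eta (xi w) - rho g (a w) - c w],
    where [c] is an affine function of [b], and infinity corresponds to [w = 0].
    Here [F 0] vanishes for [g = eta], [F' 0 = eta xi - g a - c] is controlled by
    [b], and [F''] has a fixed sign near 0 as soon as [a^2 > xi^2], because
    [rho'' > 0] at 0 when [eta > 0] (and [< 0] when [eta < 0]).  Choosing [F' 0]
    small and then [F 0] much smaller, of suitable signs, gives exactly two zeros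
    near 0, hence two isolated cycles.  Periodic orbits of the unperturbed system
    come from its reversibility. *)

Require Import Defs.
From Stdlib Require Import Reals ZArith Lra Lia ClassicalEpsilon Ranalysis5.
From Coquelicot Require Import Coquelicot.
Open Scope R_scope.

(** * One-sided slopes of solutions *)

(** Why [xR] moves first: for [a = xi] and [g = eta] the function [F w] is just [- c w], so no
    nonlinear term is left to create zeros. Hence [a] is fixed slightly larger than [xi] in modulus;
    this determines the range [w0] of definite concavity. Only then does the required size [M] say
    how small the zeros must be, and [g] and [c] come last. The harder obstacle is isolation: it is
    claimed against all Filippov periodic orbits near a cycle, so every solution that stays far out
    has to be described. Such a solution follows the explicit half-plane flows, reaches the lower
    part of x = 0, and has an increasing return map there; if periodic, it therefore closes after
    one turn and yields a zero of [F]. Every estimate depends on the parameters only through one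
    bound [K], which makes it uniform during the perturbation. The angle [th] is small because a
    half turn that starts with q coordinate [s] has sin of its duration of order 1 / s. *)

Definition right_slope (f : R -> R) (t l : R) : Prop :=
  forall eps, 0 < eps -> exists d, 0 < d /\
    forall h, 0 < h < d -> Rabs ((f (t + h) - f t) / h - l) < eps.

Definition left_slope (f : R -> R) (t l : R) : Prop :=
  forall eps, 0 < eps -> exists d, 0 < d /\
    forall h, 0 < h < d -> Rabs ((f (t - h) - f t) / - h - l) < eps.

Lemma right_slope_filterlim f t l :
  right_slope f t l <->
  filterlim (fun s => (f s - f t) / (s - t)) (at_right t) (locally l).
Proof.
split.
- intros H. apply filterlim_locally. intros eps.
  destruct (H eps (cond_pos eps)) as [d [d0 Hd]].
  exists (mkposreal d d0).
  change (forall s : R, Rabs (s - t) < d -> t < s ->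
    Rabs ((f s - f t) / (s - t) - l) < eps).
  intros s Hb ts.
  rewrite Rabs_pos_eq in Hb by lra.
  specialize (Hd (s - t) ltac:(lra)).
  replace (t + (s - t)) with s in Hd by ring. exact Hd.
- intros H eps eps0.
  apply (proj1 (filterlim_locally _ _)) with (eps := mkposreal eps eps0) in H.
  destruct H as [d Hd]. exists d. split; [apply cond_pos|].
  intros h hd.
  assert (Hb : ball t d (t + h)).
  { change (Rabs (t + h - t) < d). rewrite Rabs_pos_eq; lra. }
  specialize (Hd (t + h) Hb ltac:(lra)).
  replace (t + h - t) with h in Hd by ring. exact Hd.
Qed.

Lemma left_slope_filterlim f t l :
  left_slope f t l <->
  filterlim (fun s => (f s - f t) / (s - t)) (at_left t) (locally l).
Proof.
split.
- intros H. apply filterlim_locally. intros eps.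
  destruct (H eps (cond_pos eps)) as [d [d0 Hd]].
  exists (mkposreal d d0).
  change (forall s : R, Rabs (s - t) < d -> s < t ->
    Rabs ((f s - f t) / (s - t) - l) < eps).
  intros s Hb ts.
  rewrite Rabs_left in Hb by lra.
  specialize (Hd (t - s) ltac:(lra)).
  replace (t - (t - s)) with s in Hd by ring.
  replace (- (t - s)) with (s - t) in Hd by ring. exact Hd.
- intros H eps eps0.
  apply (proj1 (filterlim_locally _ _)) with (eps := mkposreal eps eps0) in H.
  destruct H as [d Hd]. exists d. split; [apply cond_pos|].
  intros h hd.
  assert (Hb : ball t d (t - h)).
  { change (Rabs (t - h - t) < d). rewrite Rabs_left; lra. }
  specialize (Hd (t - h) Hb ltac:(lra)).
  replace (t - h - t) with (- h) in Hd by ring. exact Hd.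
Qed.

Lemma slopes_is_derive f t l :
  left_slope f t l -> right_slope f t l -> is_derive f t l.
Proof.
intros Hl Hr. apply is_derive_Reals. intros eps eps0.
destruct (Hl eps eps0) as [d1 [d10 H1]], (Hr eps eps0) as [d2 [d20 H2]].
assert (d0 : 0 < Rmin d1 d2) by (apply Rmin_glb_lt; lra).
exists (mkposreal _ d0). simpl. intros h h0 hd.
destruct (Rtotal_order h 0) as [hn | [-> | hp]]; [| lra |].
- rewrite Rabs_left in hd by lra.
  assert (Hm := Rmin_l d1 d2).
  specialize (H1 (- h) ltac:(lra)).
  replace (t - - h) with (t + h) in H1 by ring.
  rewrite Ropp_involutive in H1. exact H1.
- rewrite Rabs_pos_eq in hd by lra.
  assert (Hm := Rmin_r d1 d2).
  exact (H2 h ltac:(lra)).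
Qed.

Lemma is_derive_right_slope f t l : is_derive f t l -> right_slope f t l.
Proof.
intros H eps eps0. apply is_derive_Reals in H.
destruct (H eps eps0) as [d Hd]. exists d. split; [apply cond_pos|].
intros h hd. apply Hd; [lra | rewrite Rabs_pos_eq; lra].
Qed.

Lemma is_derive_left_slope f t l : is_derive f t l -> left_slope f t l.
Proof.
intros H eps eps0. apply is_derive_Reals in H.
destruct (H eps eps0) as [d Hd]. exists d. split; [apply cond_pos|].
intros h hd. apply (Hd (- h)); [lra | rewrite Rabs_left; lra].
Qed.

Lemma right_slope_ext f g t l d :
  0 < d -> (forall s, t <= s < t + d -> f s = g s) ->
  right_slope f t l -> right_slope g t l.
Proof.
intros d0 He H eps eps0. destruct (H eps eps0) as [d1 [d10 H1]].
exists (Rmin d d1). split; [apply Rmin_glb_lt; lra|].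
assert (Hm := Rmin_l d d1). assert (Hm' := Rmin_r d d1).
intros h hd. rewrite <- !He by lra. apply H1; lra.
Qed.

Lemma left_slope_ext f g t l d :
  0 < d -> (forall s, t - d < s <= t -> f s = g s) ->
  left_slope f t l -> left_slope g t l.
Proof.
intros d0 He H eps eps0. destruct (H eps eps0) as [d1 [d10 H1]].
exists (Rmin d d1). split; [apply Rmin_glb_lt; lra|].
assert (Hm := Rmin_l d d1). assert (Hm' := Rmin_r d d1).
intros h hd. rewrite <- !He by lra. apply H1; lra.
Qed.

Lemma right_slope_reverse f t l :
  right_slope f t l -> left_slope (fun s => f (- s)) (- t) (- l).
Proof.
intros H eps eps0. destruct (H eps eps0) as [d [d0 Hd]].
exists d. split; [exact d0|]. intros h hd. specialize (Hd h hd).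
replace (- (- t - h)) with (t + h) by ring. rewrite Ropp_involutive.
rewrite <- Rabs_Ropp.
replace (- _) with ((f (t + h) - f t) / h - l) by (field; lra). exact Hd.
Qed.

Lemma left_slope_reverse f t l :
  left_slope f t l -> right_slope (fun s => f (- s)) (- t) (- l).
Proof.
intros H eps eps0. destruct (H eps eps0) as [d [d0 Hd]].
exists d. split; [exact d0|]. intros h hd. specialize (Hd h hd).
replace (- (- t + h)) with (t - h) by ring. rewrite Ropp_involutive.
rewrite <- Rabs_Ropp.
replace (- _) with ((f (t - h) - f t) / - h - l) by (field; lra). exact Hd.
Qed.

Lemma right_slope_opp f t l :
  right_slope f t l -> right_slope (fun s => - f s) t (- l).
Proof.
intros H eps eps0. destruct (H eps eps0) as [d [d0 Hd]].
exists d. split; [exact d0|]. intros h hd. specialize (Hd h hd).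
rewrite <- Rabs_Ropp.
replace (- _) with ((f (t + h) - f t) / h - l) by (field; lra). exact Hd.
Qed.

Lemma left_slope_opp f t l :
  left_slope f t l -> left_slope (fun s => - f s) t (- l).
Proof.
intros H eps eps0. destruct (H eps eps0) as [d [d0 Hd]].
exists d. split; [exact d0|]. intros h hd. specialize (Hd h hd).
rewrite <- Rabs_Ropp.
replace (- _) with ((f (t - h) - f t) / - h - l) by (field; lra). exact Hd.
Qed.

Lemma right_slope_shift f t l k :
  right_slope f (t + k) l -> right_slope (fun s => f (s + k)) t l.
Proof.
intros H eps eps0. destruct (H eps eps0) as [d [d0 Hd]].
exists d. split; [exact d0|]. intros h hd. specialize (Hd h hd).
replace (t + h + k) with (t + k + h) by ring. exact Hd.
Qed.

Lemma left_slope_shift f t l k :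
  left_slope f (t + k) l -> left_slope (fun s => f (s + k)) t l.
Proof.
intros H eps eps0. destruct (H eps eps0) as [d [d0 Hd]].
exists d. split; [exact d0|]. intros h hd. specialize (Hd h hd).
replace (t - h + k) with (t + k - h) by ring. exact Hd.
Qed.

(* A one-sided difference quotient within 1 of its limit bounds the increment
   by [(|l| + 1) h]. *)
Lemma slopes_continuous f t l l' :
  left_slope f t l -> right_slope f t l' -> continuous f t.
Proof.
intros Hl Hr. apply continuity_pt_filterlim.
intros eps eps0. unfold D_x, no_cond, dist; simpl; unfold Rdist.
destruct (Hl 1 Rlt_0_1) as [d1 [d10 H1]], (Hr 1 Rlt_0_1) as [d2 [d20 H2]].
pose (C := Rmax (Rabs l) (Rabs l') + 1).
assert (C1 := Rmax_l (Rabs l) (Rabs l')). assert (C2 := Rmax_r (Rabs l) (Rabs l')).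
assert (Rabs_pos_l := Rabs_pos l).
assert (C0 : 0 < C) by (unfold C; lra).
exists (Rmin (Rmin d1 d2) (eps / C)). split.
{ repeat apply Rmin_glb_lt; try lra. apply Rdiv_lt_0_compat; lra. }
intros s [[_ ts] hs].
assert (M1 := Rmin_l (Rmin d1 d2) (eps / C)).
assert (M2 := Rmin_r (Rmin d1 d2) (eps / C)).
assert (M3 := Rmin_l d1 d2). assert (M4 := Rmin_r d1 d2).
assert (Hb : forall h k m, Rabs m + 1 <= C -> h <> 0 -> Rabs h < eps / C ->
             Rabs (k / h - m) < 1 -> Rabs k < eps).
{ intros h k m hm h0 hh hk.
  assert (A : Rabs (k / h) < C).
  { replace (k / h) with ((k / h - m) + m) by ring.
    eapply Rle_lt_trans; [apply Rabs_triang|]. lra. }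
  replace k with (k / h * h) by (field; exact h0).
  rewrite Rabs_mult. assert (0 < Rabs h) by (apply Rabs_pos_lt; exact h0).
  apply Rlt_le_trans with (C * Rabs h).
  - apply Rmult_lt_compat_r; assumption.
  - apply Rmult_le_reg_r with (/ C). { apply Rinv_0_lt_compat; exact C0. }
    replace (C * Rabs h * / C) with (Rabs h) by (field; lra).
    apply Rlt_le. exact hh. }
destruct (Rtotal_order s t) as [hn | [-> | hp]]; [| lra |].
- assert (E : Rabs (s - t) = t - s) by (rewrite Rabs_left; lra).
  specialize (H1 (t - s) ltac:(lra)).
  replace (t - (t - s)) with s in H1 by ring.
  apply (Hb (- (t - s)) _ l); [unfold C; lra | lra | | exact H1].
  rewrite Rabs_Ropp, Rabs_pos_eq; lra.
- assert (E : Rabs (s - t) = s - t) by (rewrite Rabs_pos_eq; lra).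
  specialize (H2 (s - t) ltac:(lra)).
  replace (t + (s - t)) with s in H2 by ring.
  apply (Hb (s - t) _ l'); [unfold C; lra | lra | | exact H2].
  rewrite Rabs_pos_eq; lra.
Qed.

Lemma one_sided_derive_right z t v :
  one_sided_derive (at_right t) z t v <->
  right_slope (fun s => fst (z s)) t (fst v) /\
  right_slope (fun s => snd (z s)) t (snd v).
Proof. unfold one_sided_derive. rewrite !right_slope_filterlim. tauto. Qed.

Lemma one_sided_derive_left z t v :
  one_sided_derive (at_left t) z t v <->
  left_slope (fun s => fst (z s)) t (fst v) /\
  left_slope (fun s => snd (z s)) t (snd v).
Proof. unfold one_sided_derive. rewrite !left_slope_filterlim. tauto. Qed.

Lemma solution_continuous P z t : solution P z ->
  continuous (fun s => fst (z s)) t /\ continuous (fun s => snd (z s)) t.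
Proof.
intros H. destruct (H t) as [[v [_ Hv]] [w [_ Hw]]].
apply one_sided_derive_left in Hv. apply one_sided_derive_right in Hw.
split; eapply slopes_continuous; (apply Hv || apply Hw).
Qed.

(** * Two symmetries of the class: rotation by PI and time reversal *)

Definition flip (p : point) : point := (- fst p, - snd p).

(** The parameters of the system seen after a rotation by PI. The half-planes are exchanged, so
    statements about x > 0 transfer to x < 0. *)
Definition rot (P : params) : params :=
  Params (gammaR P) (gammaL P) (bpar P) (- xR P) (- xL P).

Definition mirror (p : point) : point := (fst p, - snd p).

(** The parameters of the system seen after y -> -y and reversal of time. Each half-plane is kept,
    so forward statements give backward ones. *)
Definition rev (P : params) : params :=
  Params (- gammaL P) (- gammaR P) (- bpar P) (xL P) (xR P).

Lemma solution_shift P z k :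
  solution P z -> solution P (fun t => z (t + k)).
Proof.
intros H t. destruct (H (t + k)) as [[v [Fv Hv]] [w [Fw Hw]]].
apply one_sided_derive_left in Hv. apply one_sided_derive_right in Hw.
split; [exists v | exists w]; (split; [assumption|]).
- apply one_sided_derive_left. split.
  + apply (left_slope_shift (fun s => fst (z s))), Hv.
  + apply (left_slope_shift (fun s => snd (z s))), Hv.
- apply one_sided_derive_right. split.
  + apply (right_slope_shift (fun s => fst (z s))), Hw.
  + apply (right_slope_shift (fun s => snd (z s))), Hw.
Qed.

Lemma filippov_rot P p v : filippov P p v -> filippov (rot P) (flip p) (flip v).
Proof.
destruct p as [x y], v as [v1 v2].
unfold filippov, flip, fieldL, fieldR, rot; simpl.
intros [[H E] | [[H E] | [H [s [Hs E]]]]]; injection E as -> ->.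
- right; left. split; [lra | f_equal; ring].
- left. split; [lra | f_equal; ring].
- right; right. split; [lra|]. exists (1 - s). split; [lra|].
  subst x. f_equal; ring.
Qed.

Lemma solution_rot P z :
  solution P z -> solution (rot P) (fun t => flip (z t)).
Proof.
intros H t. destruct (H t) as [[v [Fv Hv]] [w [Fw Hw]]].
apply one_sided_derive_left in Hv. apply one_sided_derive_right in Hw.
split; [exists (flip v) | exists (flip w)]; (split; [apply filippov_rot; assumption|]).
- apply one_sided_derive_left. split.
  + apply (left_slope_opp (fun s => fst (z s))), Hv.
  + apply (left_slope_opp (fun s => snd (z s))), Hv.
- apply one_sided_derive_right. split.
  + apply (right_slope_opp (fun s => fst (z s))), Hw.
  + apply (right_slope_opp (fun s => snd (z s))), Hw.
Qed.

Lemma filippov_rev P p v :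
  filippov P p v -> filippov (rev P) (mirror p) (- fst v, snd v).
Proof.
destruct p as [x y], v as [v1 v2].
unfold filippov, mirror, fieldL, fieldR, rev; simpl.
intros [[H E] | [[H E] | [H [s [Hs E]]]]]; injection E as -> ->.
- left. split; [lra | f_equal; ring].
- right; left. split; [lra | f_equal; ring].
- right; right. split; [lra|]. exists s. split; [lra|]. f_equal; ring.
Qed.

Lemma solution_rev P z :
  solution P z -> solution (rev P) (fun t => mirror (z (- t))).
Proof.
intros H t. destruct (H (- t)) as [[v [Fv Hv]] [w [Fw Hw]]].
apply one_sided_derive_left in Hv. apply one_sided_derive_right in Hw.
(* Reversing time swaps the one-sided derivatives: the right velocity [w] serves on the left and [v]
   on the right. *)
split; [exists (- fst w, snd w) | exists (- fst v, snd v)];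
  (split; [apply filippov_rev; assumption|]); simpl.
- apply one_sided_derive_left. split; simpl; rewrite <- (Ropp_involutive t) at 1.
  + apply (right_slope_reverse (fun s => fst (z s))), Hw.
  + rewrite <- (Ropp_involutive (snd w)).
    apply (left_slope_opp (fun s => snd (z (- s)))).
    apply (right_slope_reverse (fun s => snd (z s))), Hw.
- apply one_sided_derive_right. split; simpl; rewrite <- (Ropp_involutive t) at 1.
  + apply (left_slope_reverse (fun s => fst (z s))), Hv.
  + rewrite <- (Ropp_involutive (snd v)).
    apply (right_slope_opp (fun s => snd (z (- s)))).
    apply (left_slope_reverse (fun s => snd (z s))), Hv.
Qed.

(** Off the line the Filippov set is a single vector, so the two one-sided velocities coincide and
    form a genuine derivative. *)
Lemma solution_right_derive P z t : solution P z -> 0 < fst (z t) ->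
  is_derive (fun s => fst (z s)) t (fst (fieldR P (z t))) /\
  is_derive (fun s => snd (z s)) t (snd (fieldR P (z t))).
Proof.
intros H x0. destruct (H t) as [[v [Fv Hv]] [w [Fw Hw]]].
apply one_sided_derive_left in Hv. apply one_sided_derive_right in Hw.
assert (Ev : v = fieldR P (z t)) by (destruct Fv as [[? ?]|[[? ?]|[? ?]]]; trivial; lra).
assert (Ew : w = fieldR P (z t)) by (destruct Fw as [[? ?]|[[? ?]|[? ?]]]; trivial; lra).
subst v w. split; apply slopes_is_derive; (apply Hv || apply Hw).
Qed.

(** * The half-plane flow *)

(* In the coordinates [u = x - a], [q = g x + g a + b - y] the half-plane field
   reads [u' = g u + q], [q' = g q - u]: a rotation of speed 1 with growth [g]. *)
Definition ucoord (a : R) (p : point) : R := fst p - a.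

Definition qcoord (g a b : R) (p : point) : R := g * fst p + g * a + b - snd p.

Definition uflow (g a b : R) (p : point) (t : R) : R :=
  exp (g * t) * (ucoord a p * cos t + qcoord g a b p * sin t).

Definition qflow (g a b : R) (p : point) (t : R) : R :=
  exp (g * t) * (qcoord g a b p * cos t - ucoord a p * sin t).

Definition flow (g a b : R) (p : point) (t : R) : point :=
  (uflow g a b p t + a,
   g * (uflow g a b p t + a) + g * a + b - qflow g a b p t).

Definition flowR (P : params) : point -> R -> point :=
  flow (gammaR P) (xR P) (bpar P).

Lemma is_derive_uflow g a b p t :
  is_derive (uflow g a b p) t (g * uflow g a b p t + qflow g a b p t).
Proof. unfold uflow, qflow. auto_derive; [trivial | ring]. Qed.

Lemma is_derive_qflow g a b p t :
  is_derive (qflow g a b p) t (g * qflow g a b p t - uflow g a b p t).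
Proof. unfold uflow, qflow. auto_derive; [trivial | ring]. Qed.

Lemma is_derive_flowR P p t :
  is_derive (fun s => fst (flowR P p s)) t (fst (fieldR P (flowR P p t))) /\
  is_derive (fun s => snd (flowR P p s)) t (snd (fieldR P (flowR P p t))).
Proof.
unfold flowR, flow, fieldR; simpl.
set (g := gammaR P); set (a := xR P); set (b := bpar P).
assert (Hu := is_derive_uflow g a b p t). assert (Hq := is_derive_qflow g a b p t).
set (du := g * _ + _) in Hu; set (dq := g * _ - _) in Hq.
split.
- replace (_ + b) with (du + 0) by (unfold du; ring).
  apply (is_derive_plus (V := R_NormedModule) _ (fun _ => a)); [exact Hu |].
  apply is_derive_Reals, derivable_pt_lim_const.
- evar_last.
  + apply (is_derive_minus (V := R_NormedModule)
      (fun s => g * (uflow g a b p s + a) + g * a + b)); [| exact Hq].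
    apply (is_derive_ext (fun s => g * uflow g a b p s + (g * a + g * a + b))).
    { intros s. simpl. ring. }
    apply (is_derive_plus (V := R_NormedModule) _ (fun _ => _)).
    * apply is_derive_scal. exact Hu.
    * apply is_derive_Reals, derivable_pt_lim_const.
  + unfold minus, plus, opp; simpl. unfold du, dq. ring.
Qed.

Lemma flow_0 g a b p : flow g a b p 0 = p.
Proof.
destruct p as [x y]. unfold flow, uflow, qflow, ucoord, qcoord; simpl.
rewrite Rmult_0_r, exp_0, cos_0, sin_0. f_equal; ring.
Qed.

Lemma qcoord_flow g a b p t : qcoord g a b (flow g a b p t) = qflow g a b p t.
Proof. unfold qcoord, flow; simpl. ring. Qed.

Lemma ucoord_flow g a b p t : ucoord a (flow g a b p t) = uflow g a b p t.
Proof. unfold ucoord, flow; simpl. ring. Qed.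

Lemma coords_eq g a b p p' :
  ucoord a p = ucoord a p' -> qcoord g a b p = qcoord g a b p' -> p = p'.
Proof.
destruct p as [x y], p' as [x' y']. unfold ucoord, qcoord; simpl.
intros H1 H2. assert (x = x') by lra. subst. f_equal. lra.
Qed.

Lemma flow_continuous P p t :
  continuous (fun s => fst (flowR P p s)) t /\
  continuous (fun s => snd (flowR P p s)) t.
Proof.
destruct (is_derive_flowR P p t) as [H1 H2].
split; apply (ex_derive_continuous (K := R_AbsRing) (V := R_NormedModule));
  eexists; [exact H1 | exact H2].
Qed.

Lemma derive_0_constant f T :
  (forall t, 0 < t < T -> is_derive f t 0) ->
  (forall t, 0 <= t <= T -> continuous f t) ->
  forall t, 0 <= t <= T -> f t = f 0.
Proof.
intros Hd Hc t Ht.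
destruct (MVT_gen f 0 t (fun _ => 0)) as [c [_ Hc']].
- rewrite Rmin_left, Rmax_right by lra. intros x Hx. apply Hd. lra.
- rewrite Rmin_left, Rmax_right by lra. intros x Hx.
  apply continuity_pt_filterlim, Hc. lra.
- lra.
Qed.

(* Rotating and rescaling back by the flow turns a solution into a constant. *)
Lemma solution_flow P z T : solution P z ->
  (forall t, 0 < t < T -> 0 < fst (z t)) ->
  forall t, 0 <= t <= T -> z t = flowR P (z 0) t.
Proof.
intros Hz Hx.
set (g := gammaR P); set (a := xR P); set (b := bpar P).
set (u := fun s => ucoord a (z s)). set (q := fun s => qcoord g a b (z s)).
assert (Du : forall t, 0 < t < T -> is_derive u t (g * u t + q t)).
{ intros t Ht. destruct (solution_right_derive P z t Hz (Hx t Ht)) as [H1 _].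
  replace (g * u t + q t) with (fst (fieldR P (z t)) - 0)
    by (unfold u, q, ucoord, qcoord, fieldR, g, a, b; simpl; ring).
  apply (is_derive_minus (V := R_NormedModule) _ (fun _ => a)); [exact H1|].
  apply is_derive_Reals, derivable_pt_lim_const. }
assert (Dq : forall t, 0 < t < T -> is_derive q t (g * q t - u t)).
{ intros t Ht. destruct (solution_right_derive P z t Hz (Hx t Ht)) as [H1 H2].
  replace (g * q t - u t)
    with (g * fst (fieldR P (z t)) + 0 - snd (fieldR P (z t)))
    by (unfold u, q, ucoord, qcoord, fieldR, g, a, b; simpl; ring).
  apply (is_derive_minus (V := R_NormedModule) (fun s => g * fst (z s) + g * a + b));
    [| exact H2].
  apply (is_derive_ext (fun s => g * fst (z s) + (g * a + b))).
  { intros s. simpl. ring. }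
  apply (is_derive_plus (V := R_NormedModule) _ (fun _ => _)).
  - apply is_derive_scal. exact H1.
  - apply is_derive_Reals, derivable_pt_lim_const. }
assert (Cu : forall t, continuous u t).
{ intros t. apply (continuous_minus (V := R_NormedModule)).
  - apply (solution_continuous P z t Hz).
  - apply continuous_const. }
assert (Cq : forall t, continuous q t).
{ intros t. apply (continuous_minus (V := R_NormedModule)).
  - apply (continuous_plus (V := R_NormedModule)); [| apply continuous_const].
    apply (continuous_plus (V := R_NormedModule)); [| apply continuous_const].
    apply (continuous_mult (fun _ => g)); [apply continuous_const |].
    apply (solution_continuous P z t Hz).
  - apply (solution_continuous P z t Hz). }
assert (Hexp : forall t, exp (g * t) * exp (- (g * t)) = 1).
{ intros t. rewrite <- exp_plus. rewrite Rplus_opp_r. apply exp_0. }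
assert (Cexp : forall (f : R -> R) t, ex_derive f t -> continuous f t)
  by (intros; apply (ex_derive_continuous (K := R_AbsRing) (V := R_NormedModule)); assumption).
assert (H1 := derive_0_constant
  (fun s => exp (- (g * s)) * (u s * cos s - q s * sin s)) T).
assert (H2 := derive_0_constant
  (fun s => exp (- (g * s)) * (q s * cos s + u s * sin s)) T).
simpl in H1, H2. rewrite Rmult_0_r, Ropp_0, exp_0, cos_0, sin_0 in H1, H2.
intros t Ht.
assert (E1 : exp (- (g * t)) * (u t * cos t - q t * sin t) = u 0).
{ rewrite H1; [ring | | | exact Ht].
  - intros s Hs. specialize (Du s Hs). specialize (Dq s Hs).
    auto_derive.
    + repeat split; eexists; eassumption.
    + replace (Derive (fun x : R => u x) s) with (g * u s + q s)
        by (symmetry; apply is_derive_unique; exact Du).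
      replace (Derive (fun x : R => q x) s) with (g * q s - u s)
        by (symmetry; apply is_derive_unique; exact Dq).
      ring.
  - intros s Hs. apply (continuous_mult (fun s => exp (- (g * s)))).
    + apply Cexp. auto_derive. trivial.
    + apply (continuous_minus (V := R_NormedModule));
        (apply (continuous_mult (K := R_AbsRing)); [auto |]);
        apply Cexp; auto_derive; trivial. }
assert (E2 : exp (- (g * t)) * (q t * cos t + u t * sin t) = q 0).
{ rewrite H2; [ring | | | exact Ht].
  - intros s Hs. specialize (Du s Hs). specialize (Dq s Hs).
    auto_derive.
    + repeat split; eexists; eassumption.
    + replace (Derive (fun x : R => u x) s) with (g * u s + q s)
        by (symmetry; apply is_derive_unique; exact Du).
      replace (Derive (fun x : R => q x) s) with (g * q s - u s)
        by (symmetry; apply is_derive_unique; exact Dq).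
      ring.
  - intros s Hs. apply (continuous_mult (fun s => exp (- (g * s)))).
    + apply Cexp. auto_derive. trivial.
    + apply (continuous_plus (V := R_NormedModule));
        (apply (continuous_mult (K := R_AbsRing)); [auto |]);
        apply Cexp; auto_derive; trivial. }
assert (CS : sin t * sin t + cos t * cos t = 1).
{ assert (H := sin2_cos2 t). unfold Rsqr in H. exact H. }
apply (coords_eq g a b).
- unfold flowR. fold g a b. rewrite ucoord_flow. unfold uflow.
  fold (u 0) (q 0) (u t). rewrite <- E1, <- E2.
  transitivity ((exp (g * t) * exp (- (g * t))) * (u t * (sin t * sin t + cos t * cos t))).
  + rewrite Hexp, CS. ring.
  + ring.
- unfold flowR. fold g a b. rewrite qcoord_flow. unfold qflow.
  fold (u 0) (q 0) (q t). rewrite <- E1, <- E2.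
  transitivity ((exp (g * t) * exp (- (g * t))) * (q t * (sin t * sin t + cos t * cos t))).
  + rewrite Hexp, CS. ring.
  + ring.
Qed.

Lemma continuous_pos_nbhd (f : R -> R) t : continuous f t -> 0 < f t ->
  exists d, 0 < d /\ forall s, Rabs (s - t) < d -> 0 < f s.
Proof.
intros Hc Hp.
destruct (proj1 (filterlim_locally _ _) Hc (mkposreal _ Hp)) as [d Hd].
exists d. split; [apply cond_pos|]. intros s Hs.
specialize (Hd s Hs). change (Rabs (f s - f t) < f t) in Hd.
apply Rabs_def2 in Hd. lra.
Qed.

(** Continuation: up to the supremum [m] of the times before which [z] stays in x > 0, it equals the
    flow; positivity of the flow at [m] would push the supremum further unless [m = T]. The start
    may lie on x = 0, so entry into x > 0 is a hypothesis with its own [d]. *)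
Lemma solution_follows_flow P z d T : solution P z -> 0 < d ->
  (forall t, 0 < t < d -> 0 < fst (z t)) ->
  (forall t, 0 < t < T -> 0 < fst (flowR P (z 0) t)) ->
  forall t, 0 <= t <= T -> z t = flowR P (z 0) t.
Proof.
intros Hz d0 Hd HT t Ht.
destruct (Req_dec t 0) as [-> | tn]; [symmetry; apply flow_0 |].
pose (E := fun m => 0 <= m <= T /\ forall s, 0 < s < m -> 0 < fst (z s)).
destruct (completeness E) as [m [Hub Hlub]].
- exists T. intros m Hm. apply Hm.
- exists 0. split; [lra |]. intros; lra.
- assert (Hm0 : 0 < m).
  { apply Rlt_le_trans with (Rmin d T).
    - apply Rmin_glb_lt; lra.
    - apply Hub. split.
      + split; [apply Rmin_glb; lra | apply Rmin_r].
      + intros s Hs. apply Hd. assert (H := Rmin_l d T). lra. }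
  assert (HmT : m <= T) by (apply Hlub; intros k Hk; apply Hk).
  assert (Hin : forall s, 0 < s < m -> 0 < fst (z s)).
  { intros s Hs. apply Rnot_le_lt. intros Hn.
    assert (m <= s); [| lra]. apply Hlub. intros k [Hk1 Hk2].
    apply Rnot_lt_le. intros Hk. specialize (Hk2 s ltac:(lra)). lra. }
  assert (Hfl := solution_flow P z m Hz Hin).
  destruct (Rle_lt_or_eq_dec m T HmT) as [Hlt | ->].
  + exfalso. assert (Hp : 0 < fst (z m)).
    { rewrite (Hfl m) by lra. apply HT. lra. }
    destruct (continuous_pos_nbhd _ m (proj1 (solution_continuous P z m Hz)) Hp)
      as [e [e0 He]].
    assert (m + Rmin (e / 2) (T - m) <= m).
    { apply Hub. assert (H := Rmin_l (e / 2) (T - m)).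
      assert (H' := Rmin_r (e / 2) (T - m)).
      assert (0 < Rmin (e / 2) (T - m)) by (apply Rmin_glb_lt; lra).
      split; [lra |]. intros s Hs.
      destruct (Rlt_or_le s m) as [sm | sm]; [apply Hin; lra |].
      apply He. rewrite Rabs_pos_eq; lra. }
    assert (0 < Rmin (e / 2) (T - m)) by (apply Rmin_glb_lt; lra). lra.
  + apply Hfl. lra.
Qed.

(* At [(0, y)] with [y < -|b|] every Filippov velocity points to the right. *)
Lemma solution_enters_right P z : solution P z ->
  fst (z 0) = 0 -> snd (z 0) < - Rabs (bpar P) ->
  exists d, 0 < d /\ forall t, 0 < t < d -> 0 < fst (z t).
Proof.
intros Hz Hx Hy. destruct (Hz 0) as [_ [v [Fv Hv]]].
apply one_sided_derive_right in Hv. destruct Hv as [Hv _].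
assert (Hp : 0 < fst v).
{ assert (B1 := Rle_abs (bpar P)). assert (B2 := Rle_abs (- bpar P)).
  rewrite Rabs_Ropp in B2.
  destruct Fv as [[? ?]|[[? ?]|[_ [s [Hs ->]]]]]; [lra | lra |].
  unfold fieldL, fieldR; simpl. rewrite Hx. nra. }
destruct (Hv (fst v) Hp) as [d [d0 Hd]]. exists d. split; [exact d0 |].
intros t Ht. specialize (Hd t Ht). simpl in Hd.
rewrite Rplus_0_l, Hx, Rminus_0_r in Hd. apply Rabs_def2 in Hd.
destruct Hd as [_ Hd].
replace (fst (z t)) with (fst (z t) / t * t) by (field; lra).
apply Rmult_lt_0_compat; lra.
Qed.

(** * Half turns *)

Lemma cos_ge_half x : Rabs x <= PI / 3 -> 1 / 2 <= cos x.
Proof.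
assert (P0 := PI_RGT_0). intros H. rewrite <- cos_PI3.
assert (E : cos x = cos (Rabs x)).
{ unfold Rabs. destruct (Rcase_abs x); [now rewrite cos_neg | reflexivity]. }
rewrite E. assert (Hx := Rabs_pos x). apply cos_decr_1; lra.
Qed.

Lemma cos_le_neg_half x : 2 * PI / 3 <= x <= 4 * PI / 3 -> cos x <= - (1 / 2).
Proof.
intros H. assert (A : 1 / 2 <= cos (x - PI)).
{ apply cos_ge_half. apply Rabs_le. lra. }
rewrite cos_minus, cos_PI, sin_PI in A. lra.
Qed.

Lemma sin_ge_half x : PI / 3 <= x <= 2 * PI / 3 -> 1 / 2 <= sin x.
Proof.
intros H. assert (P0 := PI_RGT_0). rewrite <- cos_shift. apply cos_ge_half. apply Rabs_le. lra.
Qed.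

Lemma sin_4PI3 : sin (4 * PI / 3) <= - (1 / 2).
Proof.
assert (P0 := PI_RGT_0). replace (4 * PI / 3) with (PI / 3 + PI) by field. rewrite neg_sin.
assert (H := sin_ge_half (PI / 3)). lra.
Qed.

Lemma exp_bound K x : 0 <= K -> Rabs x <= K -> 0 < exp x <= exp K.
Proof.
intros K0 H. split; [apply exp_pos |].
assert (A := Rle_abs x). destruct (Rle_lt_or_eq_dec x K) as [h | ->]; [lra | | lra].
apply Rlt_le, exp_increasing, h.
Qed.

Lemma exp_time_bound K g t : Rabs g <= K -> 0 <= t <= 6 ->
  0 < exp (g * t) <= exp (6 * K).
Proof.
intros Hg Ht. assert (G0 := Rabs_pos g). apply exp_bound; [lra |].
rewrite Rabs_mult, (Rabs_pos_eq t) by lra. nra.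
Qed.

(** Above this value the terms with coefficient [s] dominate those with coefficient [a], which stay
    below s / 2. The 6 bounds all durations, since 4 PI / 3 <= 6 by PI <= 4, and [exp (6 * K)]
    bounds the growth of the flow in that time. *)
Definition threshold (K : R) : R := 8 * (K + 1) ^ 2 * (exp (6 * K) + 2).

(* [exp (- g t)] times the abscissa along the flow started at the point of the
   line x = 0 with [qcoord] equal to [s]. *)
Definition abscissa (g a s t : R) : R := s * sin t + a * (exp (- g * t) - cos t).

(** Here [s] is [qcoord] at the start and [p] is minus [qcoord] at the end. The first equation is
    the vanishing of [abscissa]; the second is the same equation for the reversed motion, with [- g]
    for [g] and [p] for [s]. The window around PI singles out the first return to x = 0. *)
Definition half (g a s p tau : R) : Prop :=
  2 * PI / 3 < tau < 4 * PI / 3 /\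
  s * sin tau = a * (cos tau - exp (- g * tau)) /\
  p * sin tau = a * (cos tau - exp (g * tau)).

Lemma half_rev g a s p tau : half g a s p tau -> half (- g) a p s tau.
Proof.
unfold half. intros [H [H1 H2]]. rewrite Ropp_involutive. tauto.
Qed.

Lemma threshold_pos K : 0 <= K -> 16 <= threshold K.
Proof.
intros H. unfold threshold. assert (E := exp_pos (6 * K)).
assert (1 <= (K + 1) ^ 2) by nra. nra.
Qed.

Section Abscissa.
Variables K g a s : R.
Hypothesis hg : Rabs g <= K.
Hypothesis ha : Rabs a <= K.
Hypothesis hs : threshold K <= s.

Let C := exp (6 * K).

Let K0 : 0 <= K.
Proof. assert (H := Rabs_pos g). lra. Qed.

Let C0 : 0 < C.
Proof. apply exp_pos. Qed.

Let sbig : K * (K * C + C + 2) < s / 2.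
Proof.
assert (H := threshold_pos K K0). unfold threshold in *. fold C in hs, H. nra.
Qed.

Let expb t : 0 <= t <= 6 -> 0 < exp (- g * t) <= C.
Proof. intros. apply exp_time_bound; [now rewrite Rabs_Ropp | assumption]. Qed.

Let slope t := s * cos t + a * (sin t - g * exp (- g * t)).

Let abscissa_slope t : derivable_pt_lim (abscissa g a s) t (slope t).
Proof.
apply is_derive_Reals. unfold abscissa, slope. auto_derive; [trivial | ring].
Qed.

Let slope_rest t : 0 <= t <= 6 -> Rabs (a * (sin t - g * exp (- g * t))) < s / 2.
Proof.
intros Ht. specialize (expb t Ht). rewrite Rabs_mult.
assert (A : Rabs (sin t - g * exp (- g * t)) <= 1 + K * C).
{ unfold Rminus. eapply Rle_trans; [apply Rabs_triang |]. rewrite Rabs_Ropp, Rabs_mult.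
  rewrite (Rabs_pos_eq (exp _)) by lra.
  assert (Rabs (sin t) <= 1) by (apply Rabs_le; apply SIN_bound).
  assert (G := Rabs_pos g). nra. }
assert (A0 := Rabs_pos (sin t - g * exp (- g * t))). assert (A1 := Rabs_pos a). nra.
Qed.

Let value_rest t : 0 <= t <= 6 -> Rabs (a * (exp (- g * t) - cos t)) < s / 2.
Proof.
intros Ht. specialize (expb t Ht). rewrite Rabs_mult.
assert (A : Rabs (exp (- g * t) - cos t) <= C + 1).
{ assert (B := COS_bound t). apply Rabs_le. lra. }
assert (A0 := Rabs_pos (exp (- g * t) - cos t)). assert (A1 := Rabs_pos a). nra.
Qed.

Let PI6 : 0 < PI /\ 4 * PI / 3 <= 6.
Proof. assert (H := PI_RGT_0). assert (H' := PI_4). lra. Qed.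

Let s_pos : 0 < s.
Proof. assert (H := threshold_pos K K0). lra. Qed.

(** On [0, PI / 3] the derivative is positive, because s cos t >= s / 2 beats the remaining terms;
    on [PI / 3, 2 PI / 3] the value itself is positive, because s sin t >= s / 2 does. *)
Lemma abscissa_pos t : 0 < t <= 2 * PI / 3 -> 0 < abscissa g a s t.
Proof.
intros Ht. destruct (Rle_or_lt t (PI / 3)) as [H | H].
- destruct (MVT_cor2 (abscissa g a s) slope 0 t) as [c [E Hc]]; [lra | auto |].
  assert (Z : abscissa g a s 0 = 0).
  { unfold abscissa. rewrite sin_0, cos_0. replace (- g * 0) with 0 by ring. rewrite exp_0. ring. }
  rewrite Z in E. assert (B := slope_rest c ltac:(lra)). apply Rabs_def2 in B.
  assert (D : 1 / 2 <= cos c) by (apply cos_ge_half, Rabs_le; lra).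
  assert (0 < slope c) by (unfold slope; nra). nra.
- assert (B := value_rest t ltac:(lra)). apply Rabs_def2 in B.
  assert (D : 1 / 2 <= sin t) by (apply sin_ge_half; lra).
  unfold abscissa. nra.
Qed.

(** On this window cos t <= - 1 / 2, so s cos t <= - s / 2 decides the sign of the derivative.
    Existence and uniqueness of the return time follow. *)
Lemma abscissa_decreasing t t' : 2 * PI / 3 <= t -> t < t' -> t' <= 4 * PI / 3 ->
  abscissa g a s t' < abscissa g a s t.
Proof.
intros H1 H2 H3.
destruct (MVT_cor2 (abscissa g a s) slope t t') as [c [E Hc]]; [lra | auto |].
assert (B := slope_rest c ltac:(lra)). apply Rabs_def2 in B.
assert (D : cos c <= - (1 / 2)) by (apply cos_le_neg_half; lra).
assert (slope c < 0) by (unfold slope; nra). nra.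
Qed.

Lemma abscissa_end : abscissa g a s (4 * PI / 3) < 0.
Proof.
assert (B := value_rest (4 * PI / 3) ltac:(lra)). apply Rabs_def2 in B.
assert (D := sin_4PI3). unfold abscissa. nra.
Qed.

Lemma abscissa_zero : exists tau, 2 * PI / 3 < tau < 4 * PI / 3 /\
  abscissa g a s tau = 0.
Proof.
assert (Cc : continuity (fun t => - abscissa g a s t)).
{ apply continuity_opp. intros t. apply derivable_continuous_pt. eexists. apply abscissa_slope. }
assert (H1 := abscissa_pos (2 * PI / 3) ltac:(lra)). assert (H2 := abscissa_end).
destruct (IVT (fun t => - abscissa g a s t) (2 * PI / 3) (4 * PI / 3) Cc) as [x [Hx Ex]];
  [lra | lra | lra |].
exists x. assert (E : abscissa g a s x = 0) by lra. split; [| exact E].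
split; apply Rnot_le_lt; intros N.
- assert (x = 2 * PI / 3) by lra. subst x. lra.
- assert (x = 4 * PI / 3) by lra. subst x. lra.
Qed.

Lemma abscissa_pos_before tau t : 2 * PI / 3 < tau < 4 * PI / 3 ->
  abscissa g a s tau = 0 -> 0 < t < tau -> 0 < abscissa g a s t.
Proof.
intros H E Ht. destruct (Rle_or_lt t (2 * PI / 3)).
- apply abscissa_pos. lra.
- assert (D := abscissa_decreasing t tau). lra.
Qed.

Lemma abscissa_zero_unique tau tau' :
  2 * PI / 3 < tau < 4 * PI / 3 -> 2 * PI / 3 < tau' < 4 * PI / 3 ->
  abscissa g a s tau = 0 -> abscissa g a s tau' = 0 -> tau = tau'.
Proof.
intros H H' E E'. destruct (Rtotal_order tau tau') as [h | [h | h]]; [| exact h |].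
- assert (D := abscissa_decreasing tau tau'). lra.
- assert (D := abscissa_decreasing tau' tau). lra.
Qed.

End Abscissa.

Lemma half_abscissa g a s p tau : half g a s p tau -> abscissa g a s tau = 0.
Proof. intros [_ [H _]]. unfold abscissa. rewrite H. ring. Qed.

Lemma half_time g a s p tau : half g a s p tau -> 2 < tau < 6.
Proof. intros [H _]. assert (H1 := PI2_3_2). assert (H2 := PI_4). unfold PI2 in *. lra. Qed.

(** In the window the cosine is negative, so cos tau minus an exponential cannot vanish; with [a]
    nonzero the right-hand side of the equation is nonzero. This allows [s] and [p] to be solved for
    by dividing by sin tau. *)
Lemma half_sin_neq_0 g a s p tau : a <> 0 -> half g a s p tau -> sin tau <> 0.
Proof.
intros a0 [H [H1 _]] E. rewrite E, Rmult_0_r in H1.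
assert (D : cos tau <= - (1 / 2)) by (apply cos_le_neg_half; lra).
assert (X := exp_pos (- g * tau)).
symmetry in H1. apply Rmult_integral in H1. destruct H1; [contradiction | lra].
Qed.

Lemma half_exists K g a s : Rabs g <= K -> Rabs a <= K -> a <> 0 ->
  threshold K <= s -> exists p tau, half g a s p tau.
Proof.
intros hg ha a0 hs.
destruct (abscissa_zero K g a s hg ha hs) as [tau [Ht E]].
exists (a * (cos tau - exp (g * tau)) / sin tau), tau.
assert (S0 : s * sin tau = a * (cos tau - exp (- g * tau))) by (unfold abscissa in E; lra).
split; [exact Ht |]. split; [exact S0 |]. field.
intros N. rewrite N, Rmult_0_r in S0.
assert (D : cos tau <= - (1 / 2)) by (apply cos_le_neg_half; lra).
assert (X := exp_pos (- g * tau)).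
symmetry in S0. apply Rmult_integral in S0. destruct S0; [contradiction | lra].
Qed.

Lemma half_unique K g a s p p' tau tau' : Rabs g <= K -> Rabs a <= K -> a <> 0 ->
  threshold K <= s -> half g a s p tau -> half g a s p' tau' ->
  tau = tau' /\ p = p'.
Proof.
intros hg ha a0 hs H H'.
assert (E : tau = tau').
{ apply (abscissa_zero_unique K g a s hg ha hs).
  - apply H.
  - apply H'.
  - exact (half_abscissa _ _ _ _ _ H).
  - exact (half_abscissa _ _ _ _ _ H'). }
split; [exact E |]. subst tau'.
apply (Rmult_eq_reg_r (sin tau)); [| exact (half_sin_neq_0 _ _ _ _ _ a0 H)].
destruct H as [_ [_ H]], H' as [_ [_ H']]. congruence.
Qed.

Lemma half_ratio g a s p tau : a <> 0 -> half g a s p tau ->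
  p * (exp (- g * tau) - cos tau) = s * (exp (g * tau) - cos tau).
Proof.
intros a0 H. apply (Rmult_eq_reg_r (sin tau)); [| exact (half_sin_neq_0 _ _ _ _ _ a0 H)].
destruct H as [_ [H1 H2]].
transitivity (- (p * sin tau) * (cos tau - exp (- g * tau))); [ring |].
transitivity (- (s * sin tau) * (cos tau - exp (g * tau))); [| ring].
rewrite H1, H2. ring.
Qed.

(** By [half_ratio], p / s is the quotient of exp (g tau) - cos tau, at least 1 / 2, by exp (- g
    tau) - cos tau, at most exp (6 K) + 1. A far start therefore gives a far end. *)
Lemma half_lower K g a s p tau : Rabs g <= K -> a <> 0 -> 0 <= s ->
  half g a s p tau -> s / (2 * (exp (6 * K) + 1)) <= p.
Proof.
intros hg a0 s0 H. assert (R := half_ratio _ _ _ _ _ a0 H).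
assert (T := half_time _ _ _ _ _ H). destruct H as [H _].
assert (E1 := exp_time_bound K g tau hg ltac:(lra)).
assert (E2 := exp_time_bound K (- g) tau ltac:(now rewrite Rabs_Ropp) ltac:(lra)).
assert (D : cos tau <= - (1 / 2)) by (apply cos_le_neg_half; lra).
assert (B := COS_bound tau).
set (C := exp (6 * K)) in *.
set (A := exp (- g * tau) - cos tau) in *. set (A' := exp (g * tau) - cos tau) in *.
assert (A0 : 0 < A <= C + 1) by (unfold A; lra).
assert (A0' : 1 / 2 <= A') by (unfold A'; lra).
apply (Rmult_le_reg_r (2 * (C + 1))); [lra |].
replace (s / (2 * (C + 1)) * (2 * (C + 1))) with s by (field; lra).
assert (p0 : 0 <= p).
{ apply Rnot_lt_le. intros N. nra. }
nra.
Qed.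

Lemma half_sin_small K g a s p tau : Rabs g <= K -> Rabs a <= K -> a <> 0 ->
  0 < s -> half g a s p tau -> Rabs (sin tau) <= K * (exp (6 * K) + 1) / s.
Proof.
intros hg ha a0 s0 H. assert (T := half_time _ _ _ _ _ H). destruct H as [_ [H _]].
assert (E2 := exp_time_bound K (- g) tau ltac:(now rewrite Rabs_Ropp) ltac:(lra)).
assert (B := COS_bound tau).
apply (Rmult_le_reg_r s); [lra |].
replace (K * (exp (6 * K) + 1) / s * s) with (K * (exp (6 * K) + 1)) by (field; lra).
rewrite <- (Rabs_pos_eq s) at 1 by lra. rewrite <- Rabs_mult, Rmult_comm, H, Rabs_mult.
assert (A : Rabs (cos tau - exp (- g * tau)) <= exp (6 * K) + 1) by (apply Rabs_le; lra).
assert (A1 := Rabs_pos a). assert (A2 := Rabs_pos (cos tau - exp (- g * tau))). nra.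
Qed.

Lemma half_sin_sign g a s p tau : 0 < s -> a <> 0 -> half g a s p tau ->
  a * sin tau < 0.
Proof.
intros s0 a0 [H [H1 _]].
assert (D : cos tau <= - (1 / 2)) by (apply cos_le_neg_half; lra).
assert (X := exp_pos (- g * tau)).
assert (A : 0 < a * a) by nra.
assert (E : s * (a * sin tau) = a * a * (cos tau - exp (- g * tau))).
{ transitivity (a * (s * sin tau)); [ring |]. rewrite H1. ring. }
apply Rnot_le_lt. intros N. nra.
Qed.

(** The numerator of the derivative is -1 + exp (- g t) (g sin t + cos t), negative since cos t <= -
    1 / 2 and |g sin t| <= 1 / 4. Equal signs of the two sines keep the interval away from the pole
    at PI. *)
Lemma half_quotient_decreasing g t1 t2 :
  2 * PI / 3 < t1 -> t1 < t2 -> t2 < 4 * PI / 3 -> 0 < sin t1 * sin t2 ->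
  Rabs (g * sin t1) <= 1 / 4 -> Rabs (g * sin t2) <= 1 / 4 ->
  (cos t2 - exp (- g * t2)) / sin t2 < (cos t1 - exp (- g * t1)) / sin t1.
Proof.
intros H1 H12 H2 Hs B1 B2. assert (P0 := PI_RGT_0).
assert (Hsin : forall c, t1 <= c <= t2 -> sin t2 <= sin c <= sin t1).
{ intros c Hc. split; apply sin_decr_1; lra. }
assert (Hne : forall c, t1 <= c <= t2 -> sin c <> 0 /\ Rabs (g * sin c) <= 1 / 4).
{ intros c Hc. specialize (Hsin c Hc). split; [nra |].
  apply Rabs_le_between in B1. apply Rabs_le_between in B2. apply Rabs_le.
  destruct (Rle_or_lt 0 g); nra. }
destruct (MVT_cor2 (fun t => (cos t - exp (- g * t)) / sin t)
  (fun t => (-1 + exp (- g * t) * (g * sin t + cos t)) / (sin t) ^ 2) t1 t2)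
  as [c [E Hc]].
- exact H12.
- intros c Hc. destruct (Hne c Hc) as [S0 _]. apply is_derive_Reals.
  auto_derive; [exact S0 |].
  assert (CS := sin2_cos2 c). unfold Rsqr in CS.
  replace (-1) with (- (sin c * sin c + cos c * cos c)) by lra.
  field. exact S0.
- destruct (Hne c ltac:(lra)) as [S0 B]. apply Rabs_le_between in B.
  assert (D : cos c <= - (1 / 2)) by (apply cos_le_neg_half; lra).
  assert (X := exp_pos (- g * c)).
  assert (0 < / (sin c) ^ 2) by (apply Rinv_0_lt_compat; nra).
  unfold Rdiv at 3 in E.
  assert (-1 + exp (- g * c) * (g * sin c + cos c) < 0) by nra.
  assert (HN : forall u v w, u < 0 -> 0 < v -> 0 < w -> u * v * w < 0).
  { intros u v w Hu Hv Hw. assert (u * v < 0) by nra. nra. }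
  specialize (HN _ _ _ H0 H (proj2 (Rlt_0_minus _ _) H12)). lra.
Qed.

(** Both s / a and p / a are values of the quotient of [half_quotient_decreasing], for [g] and for
    [- g], at the same duration. Both decrease in the duration, so [s] and [p] vary in the same
    direction. *)
Lemma half_increasing K g a s1 p1 t1 s2 p2 t2 :
  Rabs g <= K -> Rabs a <= K -> a <> 0 -> threshold K <= s1 -> s1 < s2 ->
  half g a s1 p1 t1 -> half g a s2 p2 t2 -> p1 < p2.
Proof.
intros hg ha a0 h1 h12 H1 H2.
assert (K0 : 0 <= K) by (assert (H := Rabs_pos g); lra).
assert (T0 := threshold_pos K K0).
assert (S1 := half_sin_sign _ _ s1 _ _ ltac:(lra) a0 H1).
assert (S2 := half_sin_sign _ _ s2 _ _ ltac:(lra) a0 H2).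
assert (Hsm : forall s p t, threshold K <= s -> half g a s p t ->
              Rabs (g * sin t) <= 1 / 4).
{ intros s p t hs H. assert (B := half_sin_small K _ _ s _ _ hg ha a0 ltac:(lra) H).
  rewrite Rabs_mult.
  (* Here the quadratic growth of [threshold] in [K] is spent: it must leave a factor K + 1 to
     absorb |g|. *)
  assert (B' : K * (exp (6 * K) + 1) / s <= 1 / (4 * (K + 1))).
  { apply (Rmult_le_reg_r (s * (4 * (K + 1)))). { nra. }
    replace (K * (exp (6 * K) + 1) / s * (s * (4 * (K + 1))))
      with (4 * K * (K + 1) * (exp (6 * K) + 1)) by (field; lra).
    replace (1 / (4 * (K + 1)) * (s * (4 * (K + 1)))) with s by (field; lra).
    unfold threshold in hs. assert (X := exp_pos (6 * K)). nra. }
  assert (G0 := Rabs_pos g). assert (G1 := Rabs_pos (sin t)).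
  apply Rle_trans with (K * (1 / (4 * (K + 1)))); [nra |].
  apply (Rmult_le_reg_r (4 * (K + 1))); [lra |].
  replace (K * (1 / (4 * (K + 1))) * (4 * (K + 1))) with K by (field; lra). lra. }
assert (B1 := Hsm _ _ _ h1 H1). assert (B2 := Hsm s2 _ _ ltac:(lra) H2).
assert (SS : 0 < sin t1 * sin t2).
{ assert (0 < (a * sin t1) * (a * sin t2)) by nra.
  replace (a * sin t1 * (a * sin t2)) with (a * a * (sin t1 * sin t2)) in H by ring.
  assert (0 < a * a) by nra. nra. }
assert (N1 := half_sin_neq_0 _ _ _ _ _ a0 H1).
assert (N2 := half_sin_neq_0 _ _ _ _ _ a0 H2).
destruct H1 as [I1 [E1 F1]], H2 as [I2 [E2 F2]].
assert (Es1 : s1 = a * ((cos t1 - exp (- g * t1)) / sin t1)).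
{ apply (Rmult_eq_reg_r (sin t1)); [| exact N1]. rewrite E1. field. exact N1. }
assert (Es2 : s2 = a * ((cos t2 - exp (- g * t2)) / sin t2)).
{ apply (Rmult_eq_reg_r (sin t2)); [| exact N2]. rewrite E2. field. exact N2. }
assert (Ep1 : p1 = a * ((cos t1 - exp (- - g * t1)) / sin t1)).
{ apply (Rmult_eq_reg_r (sin t1)); [| exact N1]. rewrite F1, Ropp_involutive. field. exact N1. }
assert (Ep2 : p2 = a * ((cos t2 - exp (- - g * t2)) / sin t2)).
{ apply (Rmult_eq_reg_r (sin t2)); [| exact N2]. rewrite F2, Ropp_involutive. field. exact N2. }
assert (B1' : Rabs (- g * sin t1) <= 1 / 4)
  by (rewrite Ropp_mult_distr_l_reverse, Rabs_Ropp; exact B1).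
assert (B2' : Rabs (- g * sin t2) <= 1 / 4)
  by (rewrite Ropp_mult_distr_l_reverse, Rabs_Ropp; exact B2).
destruct (Rtotal_order t1 t2) as [h | [h | h]].
- assert (Q := half_quotient_decreasing g t1 t2 ltac:(lra) h ltac:(lra) SS B1 B2).
  assert (Q' := half_quotient_decreasing (- g) t1 t2 ltac:(lra) h ltac:(lra) SS B1' B2').
  assert (a < 0) by nra. nra.
- subst t2. exfalso. lra.
- rewrite Rmult_comm in SS.
  assert (Q := half_quotient_decreasing g t2 t1 ltac:(lra) h ltac:(lra) SS B2 B1).
  assert (Q' := half_quotient_decreasing (- g) t2 t1 ltac:(lra) h ltac:(lra) SS B2' B1').
  assert (0 < a) by nra. nra.
Qed.

Definition half_turn (P : params) (y y1 tau : R) : Prop :=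
  half (gammaR P) (xR P) (gammaR P * xR P + bpar P - y)
    (y1 - gammaR P * xR P - bpar P) tau.

Lemma half_turn_rev P y y1 tau :
  half_turn P y y1 tau -> half_turn (rev P) (- y1) (- y) tau.
Proof.
unfold half_turn. intros H. apply half_rev in H. simpl.
replace (- gammaR P * xR P + - bpar P - - y1) with (y1 - gammaR P * xR P - bpar P) by ring.
replace (- y - - gammaR P * xR P - - bpar P) with (gammaR P * xR P + bpar P - y) by ring.
exact H.
Qed.

Lemma fst_flowR P y t :
  fst (flowR P (0, y) t) =
  exp (gammaR P * t) * abscissa (gammaR P) (xR P) (gammaR P * xR P + bpar P - y) t.
Proof.
unfold flowR, flow, uflow, ucoord, qcoord, abscissa; simpl.
assert (E : exp (gammaR P * t) * exp (- gammaR P * t) = 1).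
{ rewrite <- exp_plus. replace (_ + _) with 0 by ring. apply exp_0. }
transitivity (exp (gammaR P * t) * ((0 - xR P) * cos t
  + (gammaR P * 0 + gammaR P * xR P + bpar P - y) * sin t)
  + xR P * (exp (gammaR P * t) * exp (- gammaR P * t))).
- rewrite E. ring.
- ring.
Qed.

(** After multiplication of the ordinate by sin tau, which is nonzero, the first equation of [half]
    eliminates [y] and the second one produces [y1]. *)
Lemma half_turn_end P y y1 tau : xR P <> 0 -> half_turn P y y1 tau ->
  flowR P (0, y) tau = (0, y1).
Proof.
intros a0 H. assert (N := half_sin_neq_0 _ _ _ _ _ a0 H).
assert (A := half_abscissa _ _ _ _ _ H).
apply injective_projections.
{ rewrite fst_flowR, A. simpl. ring. }
assert (Hf : fst (flowR P (0, y) tau) = 0) by (rewrite fst_flowR, A; ring).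
unfold half_turn in H. unfold flowR, flow in *. simpl in Hf |- *. rewrite Hf.
unfold qflow, ucoord, qcoord. simpl.
set (g := gammaR P) in *. set (a := xR P) in *. set (b := bpar P) in *.
destruct H as [_ [H1 H2]].
assert (E : exp (g * tau) * exp (- g * tau) = 1).
{ rewrite <- exp_plus. replace (_ + _) with 0 by ring. apply exp_0. }
assert (CS := sin2_cos2 tau). unfold Rsqr in CS.
apply (Rmult_eq_reg_r (sin tau)); [| exact N].
transitivity ((g * a + b) * sin tau - exp (g * tau) *
  (((g * a + b - y) * sin tau) * cos tau + a * (sin tau * sin tau))); [ring |].
rewrite H1.
transitivity ((g * a + b) * sin tau - exp (g * tau) * a * (sin tau * sin tau + cos tau * cos tau)
  + a * cos tau * (exp (g * tau) * exp (- g * tau))); [ring |].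
rewrite CS, E.
transitivity ((g * a + b) * sin tau + (y1 - g * a - b) * sin tau); [| ring].
rewrite H2. ring.
Qed.

(** * Cycles made of two half turns *)

Definition params_bounded (K : R) (P : params) : Prop :=
  (Rabs (gammaL P) <= K /\ Rabs (gammaR P) <= K /\ Rabs (bpar P) <= K /\
   Rabs (xL P) <= K /\ Rabs (xR P) <= K) /\ xL P <> 0 /\ xR P <> 0.

Lemma bounded_rot K P : params_bounded K P -> params_bounded K (rot P).
Proof.
unfold params_bounded, rot; simpl. rewrite !Rabs_Ropp. intros H.
repeat split; try apply H; apply Ropp_neq_0_compat; apply H.
Qed.

Lemma bounded_rev K P : params_bounded K P -> params_bounded K (rev P).
Proof. unfold params_bounded, rev; simpl. rewrite !Rabs_Ropp. tauto. Qed.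

Lemma bounded_pos K P : params_bounded K P -> 0 < K.
Proof.
intros H. apply Rlt_le_trans with (Rabs (xR P)); [| apply H].
apply Rabs_pos_lt. apply H.
Qed.

(** The passage from the ordinate to [s] shifts by at most K * K + K, so an ordinate below
    [- reach K] gives [s] above the threshold. It also exceeds |b|, which makes the axis points met
    crossing points. *)
Definition reach (K : R) : R := threshold K + K * K + 2 * K.

Lemma bounded_shift K P : params_bounded K P ->
  Rabs (gammaR P * xR P + bpar P) <= K * K + K.
Proof.
intros [[_ [H1 [H2 [_ H3]]]] _]. eapply Rle_trans; [apply Rabs_triang |].
rewrite Rabs_mult. assert (A := Rabs_pos (gammaR P)). assert (B := Rabs_pos (xR P)). nra.
Qed.

Lemma reach_threshold K P y : params_bounded K P -> y <= - reach K ->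
  threshold K <= gammaR P * xR P + bpar P - y.
Proof.
intros H Hy. assert (B := bounded_shift K P H). apply Rabs_le_between in B.
assert (K0 := bounded_pos K P H). unfold reach in Hy. lra.
Qed.

Lemma reach_big K : 0 < K -> K < reach K /\ 16 < reach K.
Proof. intros K0. assert (T := threshold_pos K ltac:(lra)). unfold reach. nra. Qed.

Lemma half_turn_exists K P y : params_bounded K P -> y <= - reach K ->
  exists y1 tau, half_turn P y y1 tau.
Proof.
intros H Hy.
destruct (half_exists K (gammaR P) (xR P) (gammaR P * xR P + bpar P - y)) as [p [tau Hp]];
  try apply H.
- apply reach_threshold; assumption.
- exists (p + gammaR P * xR P + bpar P), tau. unfold half_turn.
  replace (p + _ + _ - _ - _) with p by ring. exact Hp.
Qed.

Lemma half_turn_unique K P y y1 y1' tau tau' : params_bounded K P -> y <= - reach K ->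
  half_turn P y y1 tau -> half_turn P y y1' tau' -> tau = tau' /\ y1 = y1'.
Proof.
intros H Hy H1 H2.
destruct (half_unique K (gammaR P) (xR P) (gammaR P * xR P + bpar P - y)
  (y1 - gammaR P * xR P - bpar P) (y1' - gammaR P * xR P - bpar P) tau tau') as [E E'];
  try apply H; try assumption.
- apply reach_threshold; assumption.
- split; [exact E | lra].
Qed.

Lemma half_turn_increasing K P y y' y1 y1' tau tau' : params_bounded K P ->
  y <= - reach K -> y' < y ->
  half_turn P y y1 tau -> half_turn P y' y1' tau' -> y1 < y1'.
Proof.
intros H Hy Hlt H1 H2.
assert (A := half_increasing K (gammaR P) (xR P) (gammaR P * xR P + bpar P - y)
  (y1 - gammaR P * xR P - bpar P) tau (gammaR P * xR P + bpar P - y')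
  (y1' - gammaR P * xR P - bpar P) tau').
assert (threshold K <= gammaR P * xR P + bpar P - y) by (apply reach_threshold; assumption).
enough (y1 - gammaR P * xR P - bpar P < y1' - gammaR P * xR P - bpar P) by lra.
apply A; try apply H; try assumption; lra.
Qed.

Lemma half_turn_lower K P y y1 tau : params_bounded K P -> y <= - reach K ->
  half_turn P y y1 tau ->
  (- y - K * K - K) / (2 * (exp (6 * K) + 1)) - K * K - K <= y1.
Proof.
intros H Hy Ht. assert (T := reach_threshold K P y H Hy).
assert (K0 := bounded_pos K P H). assert (T0 := threshold_pos K ltac:(lra)).
assert (A := half_lower K _ _ _ _ _ (proj1 (proj2 (proj1 H))) (proj2 (proj2 H))
  ltac:(apply Rle_trans with (threshold K); [lra | exact T]) Ht).
assert (B := bounded_shift K P H). apply Rabs_le_between in B.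
enough ((- y - K * K - K) / (2 * (exp (6 * K) + 1)) <=
  (gammaR P * xR P + bpar P - y) / (2 * (exp (6 * K) + 1))) by lra.
apply Rmult_le_compat_r; [| lra].
assert (X := exp_pos (6 * K)). apply Rlt_le, Rinv_0_lt_compat. lra.
Qed.

Lemma half_turn_far K N : 0 < K -> exists r, reach K <= r /\
  forall P y y1 tau, params_bounded K P -> y <= - r -> half_turn P y y1 tau -> N <= y1.
Proof.
intros K0. set (C := 2 * (exp (6 * K) + 1)).
assert (C0 : 0 < C) by (unfold C; assert (X := exp_pos (6 * K)); lra).
exists (Rmax (reach K) ((N + K * K + K) * C + K * K + K)).
split; [apply Rmax_l |]. intros P y y1 tau H Hy Ht.
assert (M1 := Rmax_l (reach K) ((N + K * K + K) * C + K * K + K)).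
assert (M2 := Rmax_r (reach K) ((N + K * K + K) * C + K * K + K)).
assert (A := half_turn_lower K P y y1 tau H ltac:(lra) Ht). fold C in A.
enough (N + K * K + K <= (- y - K * K - K) / C) by lra.
apply (Rmult_le_reg_r C); [exact C0 |].
replace ((- y - K * K - K) / C * C) with (- y - K * K - K) by (field; lra). lra.
Qed.

Lemma half_turn_positive K P y y1 tau t : params_bounded K P -> y <= - reach K ->
  half_turn P y y1 tau -> 0 < t < tau -> 0 < fst (flowR P (0, y) t).
Proof.
intros H Hy Ht I. rewrite fst_flowR. apply Rmult_lt_0_compat; [apply exp_pos |].
apply (abscissa_pos_before K) with (tau := tau); try apply H.
- apply reach_threshold; assumption.
- apply Ht.
- exact (half_abscissa _ _ _ _ _ Ht).
- exact I.
Qed.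

(** Forward uniqueness over a half turn: all Filippov velocities at (0, y) point to the right, so
    the solution enters x > 0, and there it has to follow the flow. *)
Lemma solution_half_turn K P z t0 y y1 tau : params_bounded K P -> solution P z ->
  z t0 = (0, y) -> y <= - reach K -> half_turn P y y1 tau ->
  forall t, 0 <= t <= tau -> z (t0 + t) = flowR P (0, y) t.
Proof.
intros HP Hz E Hy Ht t It.
assert (Hz' := solution_shift P z t0 Hz).
assert (E' : z (0 + t0) = (0, y)) by (rewrite Rplus_0_l; exact E).
destruct (solution_enters_right P _ Hz') as [d [d0 Hd]]; cbv beta; rewrite ?E'; simpl.
- reflexivity.
- assert (R := reach_big K (bounded_pos K P HP)).
  assert (B : Rabs (bpar P) <= K) by apply HP. lra.
- assert (A := solution_follows_flow P _ d tau Hz' d0 Hd). cbv beta in A. rewrite E' in A.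
  rewrite Rplus_comm. apply A; [| exact It].
  intros s Hs. apply (half_turn_positive K P y y1 tau); assumption.
Qed.

Definition flowL (P : params) (p : point) (t : R) : point :=
  flip (flowR (rot P) (flip p) t).

Lemma flip_flip p : flip (flip p) = p.
Proof. destruct p. unfold flip; simpl. now rewrite !Ropp_involutive. Qed.

Lemma rot_rot P : rot (rot P) = P.
Proof. destruct P. unfold rot; simpl. now rewrite !Ropp_involutive. Qed.

Lemma flip_axis y : flip (0, y) = (0, - y).
Proof. unfold flip; simpl. now rewrite Ropp_0. Qed.

Lemma mirror_mirror p : mirror (mirror p) = p.
Proof. destruct p. unfold mirror; simpl. now rewrite Ropp_involutive. Qed.

(** The left half turn from [y1] to [y2] is encoded as a right half turn of the rotated system,
    which changes the signs of the ordinates. *)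
Definition full_turn (P : params) (y y1 y2 tau tau' : R) : Prop :=
  half_turn P y y1 tau /\ half_turn (rot P) (- y1) (- y2) tau'.

Definition far (K y y1 : R) : Prop := y <= - reach K /\ reach K <= y1.

Lemma solution_full_turn K P z t0 y y1 y2 tau tau' : params_bounded K P ->
  solution P z -> z t0 = (0, y) -> far K y y1 -> full_turn P y y1 y2 tau tau' ->
  (forall t, 0 <= t <= tau -> z (t0 + t) = flowR P (0, y) t) /\
  (forall t, 0 <= t <= tau' -> z (t0 + tau + t) = flowL P (0, y1) t) /\
  z (t0 + tau) = (0, y1) /\ z (t0 + (tau + tau')) = (0, y2).
Proof.
intros HP Hz E [Hy Hy1] [H1 H2].
assert (T1 := half_time _ _ _ _ _ H1). assert (T2 := half_time _ _ _ _ _ H2).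
assert (A := solution_half_turn K P z t0 y y1 tau HP Hz E Hy H1).
assert (E1 : z (t0 + tau) = (0, y1)).
{ rewrite A by lra. apply half_turn_end; [apply HP | exact H1]. }
assert (E1' : flip (z (t0 + tau)) = (0, - y1)) by (rewrite E1; apply flip_axis).
assert (B := solution_half_turn K (rot P) (fun t => flip (z t)) (t0 + tau) (- y1) (- y2) tau'
  (bounded_rot K P HP) (solution_rot P z Hz) E1' ltac:(lra) H2).
cbv beta in B.
split; [exact A |]. split.
{ intros t It. rewrite <- (flip_flip (z _)), B by exact It.
  unfold flowL. now rewrite flip_axis. }
split; [exact E1 |].
rewrite <- (flip_flip (z _)).
replace (t0 + (tau + tau')) with (t0 + tau + tau') by ring.
rewrite B by lra. rewrite (half_turn_end _ _ (- y2)); [| apply bounded_rot in HP; apply HP | exact H2].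
rewrite flip_axis. now rewrite Ropp_involutive.
Qed.

Lemma full_turn_signs K P y y1 y2 tau tau' : params_bounded K P -> far K y y1 ->
  full_turn P y y1 y2 tau tau' ->
  (forall t, 0 < t < tau -> 0 < fst (flowR P (0, y) t)) /\
  (forall t, 0 < t < tau' -> fst (flowL P (0, y1) t) < 0).
Proof.
intros HP [Hy Hy1] [H1 H2]. split.
- intros t Ht. apply (half_turn_positive K P y y1 tau); assumption.
- intros t Ht. unfold flowL. rewrite flip_axis.
  assert (A := half_turn_positive K (rot P) (- y1) (- y2) tau' t
    (bounded_rot K P HP) ltac:(lra) H2 Ht).
  change (- fst (flowR (rot P) (0, - y1) t) < 0). lra.
Qed.

(** Time reversal followed by the rotation acts as (x, y) -> (-x, y), which fixes x = 0 pointwise.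
    The backward turn is thus a forward full turn of [rot (rev P)] through the same ordinates in the
    opposite order. *)
Lemma full_turn_back K P z t0 y y1 y2 tau tau' : params_bounded K P -> solution P z ->
  z t0 = (0, y2) -> far K y2 y1 -> full_turn P y y1 y2 tau tau' ->
  z (t0 - (tau + tau')) = (0, y).
Proof.
intros HP Hz E [Hy Hy1] [H1 H2].
assert (T1 := half_time _ _ _ _ _ H1). assert (T2 := half_time _ _ _ _ _ H2).
apply half_turn_rev in H1. apply half_turn_rev in H2. rewrite !Ropp_involutive in H2.
assert (HP' := bounded_rev K P HP).
assert (Hz' := solution_rev P z Hz).
assert (Hf : full_turn (rot (rev P)) y2 y1 y tau' tau).
{ split; [exact H2 |]. rewrite rot_rot. exact H1. }
assert (E' : flip (mirror (z (- - t0))) = (0, y2)).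
{ rewrite Ropp_involutive, E. unfold flip, mirror; simpl. now rewrite Ropp_0, Ropp_involutive. }
destruct (solution_full_turn K _ _ (- t0) y2 y1 y tau' tau (bounded_rot K _ HP')
  (solution_rot _ _ Hz') E' (conj Hy Hy1) Hf) as [_ [_ [_ A]]].
cbv beta in A.
replace (- (- t0 + (tau' + tau))) with (t0 - (tau + tau')) in A by ring.
rewrite <- (mirror_mirror (z _)), <- (flip_flip (mirror (z _))), A.
unfold flip, mirror; simpl. now rewrite Ropp_0, Ropp_involutive.
Qed.

Definition cycle_curve (P : params) (y y1 tau tau' : R) (c : R -> point) : Prop :=
  (forall t, c (t + (tau + tau')) = c t) /\
  (forall t, 0 <= t <= tau -> c t = flowR P (0, y) t) /\
  (forall t, 0 <= t <= tau' -> c (tau + t) = flowL P (0, y1) t).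

Lemma periodic_nat (c : R -> point) T : (forall t, c (t + T) = c t) ->
  forall n t, c (t + INR n * T) = c t.
Proof.
intros H n. induction n as [| n IH]; intros t.
- simpl. f_equal. ring.
- rewrite S_INR. replace (t + (INR n + 1) * T) with (t + INR n * T + T) by ring.
  rewrite H. apply IH.
Qed.

Lemma archimedean_nat T x : 0 < T -> exists n, x <= INR n * T.
Proof.
intros T0. destruct (Rle_or_lt x 0) as [h | h].
- exists 0%nat. simpl. lra.
- destruct (archimed_cor1 (T / x)) as [n [Hn n0]].
  { apply Rdiv_lt_0_compat; lra. }
  exists n. assert (N : 0 < INR n) by (apply lt_0_INR; exact n0).
  apply Rlt_le. apply (Rmult_lt_reg_r (/ (INR n * x))).
  { apply Rinv_0_lt_compat. nra. }
  replace (x * / (INR n * x)) with (/ INR n) by (field; lra).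
  replace (INR n * T * / (INR n * x)) with (T / x) by (field; lra). exact Hn.
Qed.

Lemma solution_cycle K P z t0 y y1 tau tau' c : params_bounded K P -> solution P z ->
  z t0 = (0, y) -> far K y y1 -> full_turn P y y1 y tau tau' ->
  cycle_curve P y y1 tau tau' c ->
  forall t, z t = c (t - t0).
Proof.
intros HP Hz E Hfar Hf [Cp [C1 C2]].
set (T := tau + tau').
assert (T1 := half_time _ _ _ _ _ (proj1 Hf)). assert (T2 := half_time _ _ _ _ _ (proj2 Hf)).
assert (T0 : 0 < T) by (unfold T; lra).
assert (One : forall s, z s = (0, y) -> forall t, 0 <= t <= T -> z (s + t) = c t).
{ intros s Es t Ht.
  destruct (solution_full_turn K P z s y y1 y tau tau' HP Hz Es Hfar Hf) as [A [B _]].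
  destruct (Rle_or_lt t tau) as [h | h].
  - rewrite C1 by lra. apply A. lra.
  - replace (s + t) with (s + tau + (t - tau)) by ring.
    replace t with (tau + (t - tau)) at 2 by ring.
    unfold T in Ht. rewrite C2 by lra. apply B. lra. }
assert (Step : forall s, z s = (0, y) -> z (s + T) = (0, y)).
{ intros s Es. apply (solution_full_turn K P z s y y1 y tau tau' HP Hz Es Hfar Hf). }
assert (Back : forall s, z s = (0, y) -> z (s - T) = (0, y)).
{ intros s Es. exact (full_turn_back K P z s y y1 y tau tau' HP Hz Es Hfar Hf). }
assert (Fwd : forall n s, z s = (0, y) -> forall t, 0 <= t <= INR n * T -> z (s + t) = c t).
{ induction n as [| n IH]; intros s Es t Ht.
  - simpl in Ht. apply One; [exact Es | lra].
  - rewrite S_INR in Ht. destruct (Rle_or_lt t T) as [h | h].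
    + apply One; [exact Es | lra].
    + replace (s + t) with (s + T + (t - T)) by ring.
      replace (c t) with (c (t - T)) by (rewrite <- (Cp (t - T)); f_equal; unfold T; ring).
      apply IH; [apply Step, Es | lra]. }
assert (BackN : forall n, z (t0 - INR n * T) = (0, y)).
{ induction n as [| n IH].
  - simpl. replace (t0 - 0 * T) with t0 by ring. exact E.
  - rewrite S_INR. replace (t0 - (INR n + 1) * T) with (t0 - INR n * T - T) by ring.
    apply Back, IH. }
intros t.
(* Going back [n] whole periods to another passage through (0, y) places [t] in its future, where
   forward uniqueness applies. *)
destruct (archimedean_nat T (t0 - t) T0) as [n Hn].
destruct (archimedean_nat T (t - t0 + INR n * T) T0) as [m Hm].
replace t with (t0 - INR n * T + (t - t0 + INR n * T)) at 1 by ring.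
rewrite (Fwd m _ (BackN n)) by lra.
apply (periodic_nat c T Cp).
Qed.

Lemma periodic_extension (g : R -> point) T : 0 < T -> exists c : R -> point,
  (forall t, c (t + T) = c t) /\ (forall t, 0 <= t < T -> c t = g t).
Proof.
intros T0.
assert (Up : forall r, up (r + 1) = (up r + 1)%Z).
{ intros r. symmetry. destruct (archimed r). apply tech_up; rewrite plus_IZR; lra. }
(* Since [up r] is the floor of r plus 1, the factor of [T] is the fractional part of t / T. *)
exists (fun t => g ((t / T - IZR (up (t / T)) + 1) * T)). split.
- intros t. f_equal. replace ((t + T) / T) with (t / T + 1) by (field; lra).
  rewrite Up, plus_IZR. ring.
- intros t Ht. f_equal.
  assert (H0 : 0 <= t / T) by (apply Rmult_le_pos; [lra | apply Rlt_le, Rinv_0_lt_compat, T0]).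
  assert (H1 : t / T < 1).
  { apply (Rmult_lt_reg_r T); [exact T0 |]. unfold Rdiv. rewrite Rmult_assoc, Rinv_l; lra. }
  rewrite <- (tech_up (t / T) 1) by lra. field. lra.
Qed.

Lemma filippov_right P p : 0 <= fst p -> filippov P p (fieldR P p).
Proof.
intros H. destruct (Rle_lt_or_eq_dec _ _ H) as [h | h].
- right; left. split; [exact h | reflexivity].
- right; right. split; [lra |]. exists 1. split; [lra |].
  apply injective_projections; simpl; ring.
Qed.

Lemma filippov_left P p : fst p <= 0 -> filippov P p (fieldL P p).
Proof.
intros H. destruct (Rle_lt_or_eq_dec _ _ H) as [h | h].
- left. split; [exact h | reflexivity].
- right; right. split; [lra |]. exists 0. split; [lra |].
  apply injective_projections; simpl; ring.
Qed.

Lemma fieldL_rot P p : fieldL P p = flip (fieldR (rot P) (flip p)).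
Proof. unfold fieldL, fieldR, rot, flip; simpl. f_equal; ring. Qed.

Lemma is_derive_flowL P p t :
  is_derive (fun s => fst (flowL P p s)) t (fst (fieldL P (flowL P p t))) /\
  is_derive (fun s => snd (flowL P p s)) t (snd (fieldL P (flowL P p t))).
Proof.
rewrite fieldL_rot. unfold flowL. rewrite flip_flip. simpl.
destruct (is_derive_flowR (rot P) (flip p) t) as [H1 H2].
split; [exact (is_derive_opp _ _ _ H1) | exact (is_derive_opp _ _ _ H2)].
Qed.

Lemma flowL_0 P p : flowL P p 0 = p.
Proof. unfold flowL, flowR. rewrite flow_0. apply flip_flip. Qed.

Lemma one_sided_right_of_curve (c f : R -> point) t v d : 0 < d ->
  (forall s, t <= s < t + d -> c s = f s) ->
  is_derive (fun s => fst (f s)) t (fst v) -> is_derive (fun s => snd (f s)) t (snd v) ->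
  one_sided_derive (at_right t) c t v.
Proof.
intros d0 He H1 H2. apply one_sided_derive_right. split.
- apply (right_slope_ext (fun s => fst (f s)) _ t _ d d0).
  + intros s Hs. now rewrite He.
  + apply is_derive_right_slope, H1.
- apply (right_slope_ext (fun s => snd (f s)) _ t _ d d0).
  + intros s Hs. now rewrite He.
  + apply is_derive_right_slope, H2.
Qed.

Lemma one_sided_left_of_curve (c f : R -> point) t v d : 0 < d ->
  (forall s, t - d < s <= t -> c s = f s) ->
  is_derive (fun s => fst (f s)) t (fst v) -> is_derive (fun s => snd (f s)) t (snd v) ->
  one_sided_derive (at_left t) c t v.
Proof.
intros d0 He H1 H2. apply one_sided_derive_left. split.
- apply (left_slope_ext (fun s => fst (f s)) _ t _ d d0).
  + intros s Hs. now rewrite He.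
  + apply is_derive_left_slope, H1.
- apply (left_slope_ext (fun s => snd (f s)) _ t _ d d0).
  + intros s Hs. now rewrite He.
  + apply is_derive_left_slope, H2.
Qed.

Lemma is_derive_translate (f : R -> R) k t l :
  is_derive f (t - k) l -> is_derive (fun s => f (s - k)) t l.
Proof.
intros H. evar_last.
- apply (is_derive_comp f (fun s => s - k)); [exact H |].
  apply (is_derive_minus (V := R_NormedModule) (fun s => s) (fun _ => k)).
  + apply is_derive_Reals, derivable_pt_lim_id.
  + apply is_derive_Reals, derivable_pt_lim_const.
- unfold minus, plus, opp, scal; simpl. unfold mult; simpl. ring.
Qed.

(** Two fundamental intervals are needed: right derivatives are checked on
    [0, T) and left derivatives on (0, T]. *)
Lemma periodic_representative T t : 0 < T ->
  (exists k s, 0 <= s < T /\ t = s + IZR k * T) /\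
  (exists k s, 0 < s <= T /\ t = s + IZR k * T).
Proof.
intros T0. destruct (archimed (t / T)) as [A1 A2].
assert (E : t = t / T * T) by (field; lra).
set (r := t / T) in *. clearbody r. split.
- exists (up r - 1)%Z, ((r - IZR (up r) + 1) * T). rewrite minus_IZR.
  split; [split; nra | rewrite E at 1; ring].
- destruct (Rle_lt_or_eq_dec _ _ A2) as [h | h].
  + exists (up r - 1)%Z, ((r - IZR (up r) + 1) * T). rewrite minus_IZR.
    split; [split; nra | rewrite E at 1; ring].
  + exists (up r - 2)%Z, T. rewrite minus_IZR.
    split; [lra |]. rewrite E. replace r with (IZR (up r) - 1) at 1 by lra. ring.
Qed.

Lemma periodic_Z (c : R -> point) T : (forall t, c (t + T) = c t) ->
  forall k t, c (t + IZR k * T) = c t.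
Proof.
intros H k t. destruct k as [| p | p].
- f_equal. ring.
- rewrite <- positive_nat_Z, <- INR_IZR_INZ. now apply periodic_nat.
- rewrite <- (periodic_nat c T H (Pos.to_nat p)). f_equal.
  rewrite INR_IZR_INZ, positive_nat_Z. change (Z.neg p) with (- Z.pos p)%Z.
  rewrite opp_IZR. ring.
Qed.

(** The two flow arcs are glued and extended periodically. At a corner the one-sided velocity is the
    field of the half-plane just left or just entered; as an end of the Filippov segment it is
    admissible on x = 0. *)
Lemma cycle_curve_exists K P y y1 tau tau' : params_bounded K P -> far K y y1 ->
  full_turn P y y1 y tau tau' ->
  exists c, solution P c /\ cycle_curve P y y1 tau tau' c.
Proof.
intros HP Hfar Hf. set (T := tau + tau').
assert (T1 := half_time _ _ _ _ _ (proj1 Hf)). assert (T2 := half_time _ _ _ _ _ (proj2 Hf)).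
assert (T0 : 0 < T) by (unfold T; lra).
destruct (full_turn_signs K P y y1 y tau tau' HP Hfar Hf) as [S1 S2].
assert (E1 : flowR P (0, y) tau = (0, y1)).
{ apply half_turn_end; [apply HP | apply Hf]. }
assert (E2 : flowL P (0, y1) tau' = (0, y)).
{ unfold flowL. rewrite flip_axis, (half_turn_end _ _ (- y)).
  - rewrite flip_axis. now rewrite Ropp_involutive.
  - apply bounded_rot in HP. apply HP.
  - apply Hf. }
assert (E0 : flowR P (0, y) 0 = (0, y)) by apply flow_0.
destruct (periodic_extension (fun t => if Rle_dec t tau then flowR P (0, y) t
  else flowL P (0, y1) (t - tau)) T T0) as [c [Cp C0]].
assert (C1 : forall t, 0 <= t <= tau -> c t = flowR P (0, y) t).
{ intros t Ht. rewrite C0 by (unfold T; lra). destruct (Rle_dec t tau); [reflexivity | lra]. }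
assert (C2 : forall t, 0 <= t <= tau' -> c (tau + t) = flowL P (0, y1) t).
{ intros t Ht. destruct (Req_dec t tau') as [-> | n].
  - replace (tau + tau') with (0 + T) by (unfold T; ring).
    rewrite Cp, C1 by lra. now rewrite E2, E0.
  - rewrite C0 by (unfold T; lra). destruct (Rle_dec (tau + t) tau) as [h | h].
    + assert (t = 0) by lra. subst t. rewrite Rplus_0_r, flowL_0. exact E1.
    + f_equal. ring. }
exists c. split; [| split; [exact Cp | split; assumption]].
assert (Hr : forall t, 0 <= t < T ->
  exists v, filippov P (c t) v /\ one_sided_derive (at_right t) c t v).
{ intros t Ht. destruct (Rlt_or_le t tau) as [h | h].
  - exists (fieldR P (c t)). split.
    + apply filippov_right. rewrite C1 by lra.
      destruct (Req_dec t 0) as [-> | n]; [rewrite E0; simpl; lra |].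
      apply Rlt_le, S1. lra.
    + rewrite C1 by lra. destruct (is_derive_flowR P (0, y) t) as [D1 D2].
      apply (one_sided_right_of_curve c (flowR P (0, y)) t _ (tau - t)); try assumption; [lra |].
      intros s Hs. apply C1. lra.
  - exists (fieldL P (c t)).
    assert (Ct : forall s, tau <= s <= T -> c s = flowL P (0, y1) (s - tau)).
    { intros s Hs. replace s with (tau + (s - tau)) at 1 by ring.
      apply C2. unfold T in Hs. lra. }
    unfold T in Ht. split.
    + apply filippov_left. rewrite Ct by (unfold T; lra).
      destruct (Req_dec (t - tau) 0) as [-> | n]; [rewrite flowL_0; simpl; lra |].
      apply Rlt_le, S2. lra.
    + rewrite Ct by (unfold T; lra).
      destruct (is_derive_flowL P (0, y1) (t - tau)) as [D1 D2].
      apply (one_sided_right_of_curve c (fun s => flowL P (0, y1) (s - tau)) t _ (T - t)).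
      * unfold T. lra.
      * intros s Hs. apply Ct. lra.
      * exact (is_derive_translate _ _ _ _ D1).
      * exact (is_derive_translate _ _ _ _ D2). }
assert (Hl : forall t, 0 < t <= T ->
  exists v, filippov P (c t) v /\ one_sided_derive (at_left t) c t v).
{ intros t Ht. destruct (Rle_or_lt t tau) as [h | h].
  - exists (fieldR P (c t)). split.
    + apply filippov_right. rewrite C1 by lra.
      destruct (Req_dec t tau) as [-> | n]; [rewrite E1; simpl; lra |].
      apply Rlt_le, S1. lra.
    + rewrite C1 by lra. destruct (is_derive_flowR P (0, y) t) as [D1 D2].
      apply (one_sided_left_of_curve c (flowR P (0, y)) t _ t); try assumption; [lra |].
      intros s Hs. apply C1. lra.
  - exists (fieldL P (c t)).
    assert (Ct : forall s, tau <= s <= T -> c s = flowL P (0, y1) (s - tau)).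
    { intros s Hs. replace s with (tau + (s - tau)) at 1 by ring.
      apply C2. unfold T in Hs. lra. }
    split.
    + apply filippov_left. rewrite Ct by lra.
      destruct (Req_dec t T) as [-> | n].
      * unfold T. replace (tau + tau' - tau) with tau' by ring. rewrite E2. simpl. lra.
      * apply Rlt_le, S2. unfold T in *. lra.
    + rewrite Ct by lra.
      destruct (is_derive_flowL P (0, y1) (t - tau)) as [D1 D2].
      apply (one_sided_left_of_curve c (fun s => flowL P (0, y1) (s - tau)) t _ (t - tau)).
      * lra.
      * intros s Hs. apply Ct. lra.
      * exact (is_derive_translate _ _ _ _ D1).
      * exact (is_derive_translate _ _ _ _ D2). }
assert (Cs : forall k s, c (s + - (IZR k * T)) = c s).
{ intros k s. replace (- (IZR k * T)) with (IZR (- k) * T) by (rewrite opp_IZR; ring).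
  now apply periodic_Z. }
intros t. destruct (periodic_representative T t T0) as [[k [s [Hs Et]]] [k' [s' [Hs' Et']]]].
split.
- destruct (Hl s' Hs') as [v [Fv Dv]]. exists v.
  assert (Ec : c t = c s') by (rewrite Et'; now apply periodic_Z).
  rewrite Ec. split; [exact Fv |].
  apply one_sided_derive_left in Dv. apply one_sided_derive_left.
  replace s' with (t + - (IZR k' * T)) in Dv by lra.
  split; (eapply (left_slope_ext _ _ _ _ 1 Rlt_0_1); [| apply left_slope_shift, Dv]);
    intros; simpl; now rewrite Cs.
- destruct (Hr s Hs) as [v [Fv Dv]]. exists v.
  assert (Ec : c t = c s) by (rewrite Et; now apply periodic_Z).
  rewrite Ec. split; [exact Fv |].
  apply one_sided_derive_right in Dv. apply one_sided_derive_right.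
  replace s with (t + - (IZR k * T)) in Dv by lra.
  split; (eapply (right_slope_ext _ _ _ _ 1 Rlt_0_1); [| apply right_slope_shift, Dv]);
    intros; simpl; now rewrite Cs.
Qed.

(** * Far solutions reach the line x = 0 *)

Lemma first_zero (f : R -> R) T : (forall t, continuous f t) -> 0 < T ->
  0 < f 0 -> f T < 0 ->
  exists t, 0 < t < T /\ f t = 0 /\ forall s, 0 <= s < t -> 0 < f s.
Proof.
intros Hc T0 H0 HT.
pose (E := fun m => 0 <= m <= T /\ forall s, 0 <= s <= m -> 0 < f s).
destruct (completeness E) as [m [Hub Hlub]].
- exists T. intros m Hm. apply Hm.
- exists 0. split; [lra |]. intros s Hs. assert (s = 0) by lra. now subst s.
- assert (Hm : 0 <= m <= T).
  { split.
    - apply Hub. split; [lra |]. intros s Hs. assert (s = 0) by lra. now subst s.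
    - apply Hlub. intros k Hk. apply Hk. }
  assert (Hin : forall s, 0 <= s < m -> 0 < f s).
  { intros s Hs. apply Rnot_le_lt. intros Hn.
    assert (m <= s); [| lra]. apply Hlub. intros k [Hk1 Hk2].
    apply Rnot_lt_le. intros Hk. specialize (Hk2 s ltac:(lra)). lra. }
  assert (N1 : ~ 0 < f m).
  { intros Hp. destruct (continuous_pos_nbhd f m (Hc m) Hp) as [d [d0 Hd]].
    destruct (Req_dec m T) as [-> | n]; [lra |].
    assert (D1 := Rmin_l (d / 2) (T - m)). assert (D2 := Rmin_r (d / 2) (T - m)).
    assert (D3 : 0 < Rmin (d / 2) (T - m)) by (apply Rmin_glb_lt; lra).
    assert (m + Rmin (d / 2) (T - m) <= m); [| lra].
    apply Hub. split; [lra |]. intros s Hs.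
    destruct (Rlt_or_le s m) as [sm | sm]; [apply Hin; lra |].
    apply Hd. rewrite Rabs_pos_eq; lra. }
  assert (N2 : ~ 0 < - f m).
  { intros Hp.
    destruct (continuous_pos_nbhd (fun s => - f s) m) as [d [d0 Hd]]; [| exact Hp |].
    { apply (continuous_opp (V := R_NormedModule)), Hc. }
    destruct (Req_dec m 0) as [-> | n]; [lra |].
    assert (D1 := Rmin_l (d / 2) m). assert (D2 := Rmin_r (d / 2) m).
    assert (D3 : 0 < Rmin (d / 2) m) by (apply Rmin_glb_lt; lra).
    specialize (Hd (m - Rmin (d / 2) m)).
    rewrite Rabs_left in Hd by lra. specialize (Hd ltac:(lra)).
    specialize (Hin (m - Rmin (d / 2) m) ltac:(lra)). lra. }
  assert (Em : f m = 0) by lra.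
  exists m. split; [| split; assumption].
  split; apply Rnot_le_lt; intros N.
  + assert (m = 0) by lra. subst m. lra.
  + assert (m = T) by lra. subst m. lra.
Qed.

Lemma derive_at_first_zero f t l : is_derive f t l -> 0 < t -> f t = 0 ->
  (forall s, 0 <= s < t -> 0 < f s) -> l <= 0.
Proof.
intros Hd t0 E H. apply Rnot_lt_le. intros l0.
destruct (is_derive_left_slope f t l Hd l l0) as [d [d0 Hd']].
assert (D1 := Rmin_l (d / 2) t). assert (D2 := Rmin_r (d / 2) t).
assert (D3 : 0 < Rmin (d / 2) t) by (apply Rmin_glb_lt; lra).
set (h := Rmin (d / 2) t) in *.
specialize (Hd' h ltac:(lra)). specialize (H (t - h) ltac:(lra)).
rewrite E, Rminus_0_r in Hd'. apply Rabs_def2 in Hd'.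
assert (f (t - h) / - h < 0); [| lra].
replace (f (t - h) / - h) with (- (f (t - h) / h)) by (field; lra).
assert (0 < f (t - h) / h) by (apply Rdiv_lt_0_compat; lra). lra.
Qed.

Lemma pdist_le p : pdist p (0, 0) <= Rabs (fst p) + Rabs (snd p).
Proof.
unfold pdist, dist_euc; simpl. rewrite !Rminus_0_r.
assert (A := Rabs_pos (fst p)). assert (B := Rabs_pos (snd p)).
apply Rsqr_incr_0_var; [| lra].
rewrite Rsqr_sqrt by (assert (C := Rle_0_sqr (fst p)); assert (D := Rle_0_sqr (snd p)); lra).
rewrite (Rsqr_abs (fst p)), (Rsqr_abs (snd p)). unfold Rsqr. nra.
Qed.

Lemma pdist_ge p : Rabs (fst p) <= pdist p (0, 0) /\ Rabs (snd p) <= pdist p (0, 0).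
Proof.
unfold pdist, dist_euc; simpl. rewrite !Rminus_0_r.
assert (A := Rle_0_sqr (fst p)). assert (B := Rle_0_sqr (snd p)).
split; apply Rsqr_incr_0_var; try apply sqrt_pos; rewrite Rsqr_sqrt by lra;
  rewrite <- Rsqr_abs; lra.
Qed.

Lemma coords_lower K P p : params_bounded K P ->
  pdist p (0, 0) <=
  (K + 1) * (Rabs (ucoord (xR P) p) + K)
    + Rabs (qcoord (gammaR P) (xR P) (bpar P) p) + K * K + K.
Proof.
intros HP. assert (B := bounded_shift K P HP). assert (K0 := bounded_pos K P HP).
destruct HP as [[_ [Hg [_ [_ Ha]]]] _].
eapply Rle_trans; [apply pdist_le |].
assert (Hx : Rabs (fst p) <= Rabs (ucoord (xR P) p) + K).
{ replace (fst p) with (ucoord (xR P) p + xR P) by (unfold ucoord; ring).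
  eapply Rle_trans; [apply Rabs_triang |]. lra. }
assert (Hy : Rabs (snd p) <= K * Rabs (fst p) + (K * K + K)
  + Rabs (qcoord (gammaR P) (xR P) (bpar P) p)).
{ replace (snd p) with (gammaR P * fst p + (gammaR P * xR P + bpar P)
    + - qcoord (gammaR P) (xR P) (bpar P) p) by (unfold qcoord; ring).
  eapply Rle_trans; [apply Rabs_triang |]. rewrite Rabs_Ropp.
  apply Rplus_le_compat_r.
  eapply Rle_trans; [apply Rabs_triang |]. apply Rplus_le_compat; [| exact B].
  rewrite Rabs_mult. apply Rmult_le_compat_r; [apply Rabs_pos | exact Hg]. }
assert (X0 := Rabs_pos (fst p)). nra.
Qed.

Lemma flow_energy g a b p t :
  uflow g a b p t ^ 2 + qflow g a b p t ^ 2 =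
  exp (g * t) ^ 2 * (ucoord a p ^ 2 + qcoord g a b p ^ 2).
Proof.
unfold uflow, qflow. assert (CS := sin2_cos2 t). unfold Rsqr in CS.
transitivity (exp (g * t) ^ 2 * (ucoord a p ^ 2 + qcoord g a b p ^ 2)
  * (sin t * sin t + cos t * cos t)); [ring | rewrite CS; ring].
Qed.

Lemma exp_time_lower K g t : Rabs g <= K -> 0 <= t <= 6 ->
  exp (- (6 * K)) <= exp (g * t).
Proof.
intros Hg Ht. rewrite exp_Ropp.
assert (B := exp_time_bound K (- g) t ltac:(now rewrite Rabs_Ropp) Ht).
replace (g * t) with (- (- g * t)) by ring. rewrite exp_Ropp.
apply Rinv_le_contravar; apply B.
Qed.

(* Of the four angles 0, PI/2, PI, 3PI/2 one makes the rotated first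
   coordinate at most minus the sup norm. *)
Lemma quarter_turn u q : exists t, 0 <= t <= 6 /\
  u * cos t + q * sin t <= - Rmax (Rabs u) (Rabs q).
Proof.
assert (P0 := PI_RGT_0). assert (P1 := PI_4).
destruct (Rle_or_lt (Rabs u) (Rabs q)) as [h | h].
- rewrite Rmax_right by lra. destruct (Rle_or_lt 0 q) as [s | s].
  + exists (3 * (PI / 2)). rewrite cos_3PI2, sin_3PI2, Rabs_pos_eq by lra. lra.
  + exists (PI / 2). rewrite cos_PI2, sin_PI2, Rabs_left by lra. lra.
- rewrite Rmax_left by lra. destruct (Rle_or_lt 0 u) as [s | s].
  + exists PI. rewrite cos_PI, sin_PI, Rabs_pos_eq by lra. lra.
  + exists 0. rewrite cos_0, sin_0, Rabs_left by lra. lra.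
Qed.

(** By [quarter_turn] a far point is carried to x < 0 within time 6, so there is a first zero of x.
    There x' <= 0 gives y >= b, while [flow_energy] keeps u ^ 2 + q ^ 2 large although u is only -
    a; hence y itself must be large. *)
Lemma flow_hits_axis K N : 0 < K -> exists r, forall P p, params_bounded K P ->
  0 < fst p -> r < pdist p (0, 0) ->
  exists t y, 0 < t /\ flowR P p t = (0, y) /\ N <= y /\
    forall s, 0 <= s < t -> 0 < fst (flowR P p s).
Proof.
intros K0. set (e := exp (- (6 * K))).
assert (e0 : 0 < e) by apply exp_pos.
(* If b <= y < N at the hit, both |u| and |q| are at most [B], so the energy is at most 2 B ^ 2; a
   start with max (|u|, |q|) > M gives more than 4 B ^ 2. The radius below is the bound of
   [coords_lower] for |u| and |q| up to [M]. *)
set (B := K * K + 3 * K + Rabs N). set (M := 2 * B / e).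
exists ((K + 1) * (M + K) + M + K * K + K). intros P p HP Hx Hr.
assert (N0 := Rabs_pos N). assert (NN := Rle_abs N).
assert (B0 : K < B) by (unfold B; nra).
set (g := gammaR P). set (a := xR P). set (b := bpar P).
assert (Hg : Rabs g <= K) by apply HP. assert (Ha : Rabs a <= K) by apply HP.
assert (Hb : Rabs b <= K) by apply HP.
apply Rabs_le_between in Ha. apply Rabs_le_between in Hb.
assert (Hga := bounded_shift K P HP). fold g a b in Hga. apply Rabs_le_between in Hga.
set (u := ucoord a p). set (q := qcoord g a b p).
assert (HM : M < Rmax (Rabs u) (Rabs q)).
{ apply Rnot_le_lt. intros H. assert (C := coords_lower K P p HP). fold g a b u q in C.
  assert (A1 := Rmax_l (Rabs u) (Rabs q)). assert (A2 := Rmax_r (Rabs u) (Rabs q)).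
  nra. }
assert (HMe : 2 * B < e * Rmax (Rabs u) (Rabs q)).
{ replace (2 * B) with (e * M) by (unfold M; field; lra).
  apply Rmult_lt_compat_l; assumption. }
destruct (quarter_turn u q) as [T [HT Hq]].
assert (HuT : fst (flowR P p T) < 0).
{ unfold flowR, flow, uflow; simpl. fold g a b u q.
  assert (L := exp_time_lower K g T Hg HT). fold e in L.
  assert (Z : 0 <= Rmax (Rabs u) (Rabs q)).
  { apply Rle_trans with (Rabs u); [apply Rabs_pos | apply Rmax_l]. }
  nra. }
assert (H0 : 0 < fst (flowR P p 0)) by (unfold flowR; rewrite flow_0; exact Hx).
assert (T0 : 0 < T).
{ destruct (Req_dec T 0) as [-> | n]; lra. }
destruct (first_zero (fun t => fst (flowR P p t)) T) as [t [Ht [Et Hpos]]];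
  [intros s; apply flow_continuous | exact T0 | exact H0 | exact HuT |].
exists t, (snd (flowR P p t)).
split; [lra |]. split; [now apply injective_projections |]. split; [| exact Hpos].
assert (Hd := derive_at_first_zero _ t _ (proj1 (is_derive_flowR P p t)) ltac:(lra) Et Hpos).
set (y := snd (flowR P p t)).
assert (Hy : b <= y).
{ assert (X : fst (fieldR P (flowR P p t)) = 2 * gammaR P * fst (flowR P p t) - y + b)
    by reflexivity.
  rewrite X, Et in Hd. lra. }
assert (En := flow_energy g a b p t). fold u q in En.
rewrite <- (ucoord_flow g a b p t), <- (qcoord_flow g a b p t) in En.
unfold ucoord at 1, qcoord at 1 in En. change (flow g a b p t) with (flowR P p t) in En.
rewrite Et in En. fold y in En.
assert (L := exp_time_lower K g t Hg ltac:(lra)). fold e in L.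
assert (Low : (2 * B) ^ 2 < exp (g * t) ^ 2 * (u ^ 2 + q ^ 2)).
{ apply Rlt_le_trans with ((e * Rmax (Rabs u) (Rabs q)) ^ 2).
  - nra.
  - rewrite Rpow_mult_distr. apply Rmult_le_compat; try apply pow2_ge_0.
    + apply pow_incr. lra.
    + unfold Rmax. destruct (Rle_dec (Rabs u) (Rabs q)); rewrite pow2_abs;
        assert (U := pow2_ge_0 u); assert (Q := pow2_ge_0 q); lra. }
rewrite <- En in Low.
apply Rnot_lt_le. intros HN.
assert (Bq : - B <= g * 0 + g * a + b - y <= B) by (unfold B; lra).
assert (Ba : - B <= 0 - a <= B) by lra.
nra.
Qed.

(** A far solution in x > 0 meets the upper axis so high that the following left half turn ends
    below [- N]. From x < 0 the lower axis is met directly, by the rotated statement. *)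
Lemma far_solution_hits K N : 0 < K -> exists r, forall P z t0, params_bounded K P ->
  solution P z -> r < pdist (z t0) (0, 0) ->
  exists t y, z t = (0, y) /\ y <= - N.
Proof.
intros K0. destruct (half_turn_far K N K0) as [r1 [Hr1 F1]].
destruct (flow_hits_axis K (Rmax N r1) K0) as [r2 F2].
exists (Rmax r2 (Rmax N r1)).
assert (Pos : forall P z t0, params_bounded K P -> solution P z -> 0 < fst (z t0) ->
  Rmax r2 (Rmax N r1) < pdist (z t0) (0, 0) ->
  exists t y, z t = (0, y) /\ Rmax N r1 <= y).
{ intros P z t0 HP Hz Hx Hr.
  destruct (F2 P (z t0) HP Hx) as [t [y [t1 [E [Hy Hp]]]]].
  { eapply Rle_lt_trans; [apply Rmax_l | exact Hr]. }
  exists (t + t0), y. split; [| exact Hy]. rewrite <- E.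
  assert (Hz' := solution_shift P z t0 Hz).
  destruct (continuous_pos_nbhd (fun s => fst (z s)) t0) as [d [d0 Hd]];
    [apply (solution_continuous P z t0 Hz) | exact Hx |].
  assert (A := solution_follows_flow P _ d t Hz' d0). cbv beta in A.
  rewrite Rplus_0_l in A. apply A.
  - intros s Hs. apply Hd. rewrite Rabs_pos_eq; lra.
  - intros s Hs. apply Hp. lra.
  - lra. }
assert (Turn : forall P z t0 y, params_bounded K P -> solution P z -> z t0 = (0, y) ->
  Rmax N r1 <= y -> exists t y', z t = (0, y') /\ y' <= - N).
{ intros P z t0 y HP Hz E Hy.
  assert (M := Rmax_r N r1).
  destruct (half_turn_exists K (rot P) (- y) (bounded_rot K P HP)) as [y1 [tau Ht]]; [lra |].
  assert (A := F1 _ (- y) _ _ (bounded_rot K P HP) ltac:(lra) Ht).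
  exists (t0 + tau), (- y1). split; [| lra].
  assert (E' : flip (z t0) = (0, - y)) by (rewrite E; apply flip_axis).
  assert (B := solution_half_turn K _ _ t0 (- y) y1 tau (bounded_rot K P HP)
    (solution_rot P z Hz) E' ltac:(lra) Ht tau).
  assert (T := half_time _ _ _ _ _ Ht). cbv beta in B.
  rewrite <- (flip_flip (z _)), B by lra.
  rewrite (half_turn_end _ _ y1); [apply flip_axis | apply bounded_rot in HP; apply HP | exact Ht]. }
intros P z t0 HP Hz Hr.
destruct (Rtotal_order (fst (z t0)) 0) as [h | [h | h]].
- destruct (Pos (rot P) (fun t => flip (z t)) t0) as [t [y [E Hy]]].
  + now apply bounded_rot.
  + now apply solution_rot.
  + simpl. lra.
  + replace (pdist (flip (z t0)) (0, 0)) with (pdist (z t0) (0, 0)); [exact Hr |].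
    unfold pdist, dist_euc, flip; simpl. f_equal. unfold Rsqr. ring.
  + exists t, (- y). split; [| assert (M := Rmax_l N r1); lra].
    rewrite <- (flip_flip (z t)), E. apply flip_axis.
- assert (E : z t0 = (0, snd (z t0))) by now apply injective_projections.
  assert (A : Rmax N r1 < Rabs (snd (z t0))).
  { assert (B := pdist_le (z t0)). rewrite h, Rabs_R0 in B.
    assert (M := Rmax_r r2 (Rmax N r1)). lra. }
  destruct (Rle_or_lt 0 (snd (z t0))) as [s | s].
  + rewrite Rabs_pos_eq in A by lra. apply (Turn P z t0 _ HP Hz E). lra.
  + rewrite Rabs_left in A by lra. exists t0, (snd (z t0)). split; [exact E |].
    assert (M := Rmax_l N r1). lra.
- destruct (Pos P z t0 HP Hz h Hr) as [t [y [E Hy]]].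
  exact (Turn P z t y HP Hz E Hy).
Qed.

Lemma flow_back P p t s :
  flowR P (mirror (flowR (rev P) (mirror p) t)) s =
  mirror (flowR (rev P) (mirror p) (t - s)).
Proof.
set (g := gammaR P). set (a := xR P). set (b := bpar P).
assert (Hm : forall p', ucoord a (mirror p') = ucoord a p') by reflexivity.
assert (Hq : forall p', qcoord g a b (mirror p') = - qcoord (- g) a (- b) p')
  by (intros p'; unfold qcoord, mirror; simpl; ring).
assert (Hq' : forall p', qcoord (- g) a (- b) (mirror p') = - qcoord g a b p')
  by (intros p'; unfold qcoord, mirror; simpl; ring).
change (flowR P) with (flow g a b). change (flowR (rev P)) with (flow (- g) a (- b)).
assert (E : exp (- g * (t - s)) = exp (g * s) * exp (- g * t))
  by (rewrite <- exp_plus; f_equal; ring).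
apply (coords_eq g a b).
- rewrite ucoord_flow. unfold uflow at 1.
  rewrite Hm, Hm, Hq, !ucoord_flow, qcoord_flow. unfold uflow, qflow.
  rewrite Hm, Hq', E, cos_minus, sin_minus. ring.
- rewrite qcoord_flow. unfold qflow at 1.
  rewrite Hm, !Hq, !ucoord_flow, !qcoord_flow. unfold uflow, qflow.
  rewrite Hm, Hq', E, cos_minus, sin_minus. ring.
Qed.

(** [flow_hits_axis] run backwards in time. It puts every far point of x > 0 on an arc that starts
    deep on the lower axis, which yields solutions through arbitrary far points. *)
Lemma flow_from_axis K N : 0 < K -> exists r, forall P p, params_bounded K P ->
  0 < fst p -> r < pdist p (0, 0) ->
  exists t y, 0 < t /\ y <= - N /\ flowR P (0, y) t = p /\
    forall s, 0 < s <= t -> 0 < fst (flowR P (0, y) s).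
Proof.
intros K0. destruct (flow_hits_axis K N K0) as [r H].
exists r. intros P p HP Hx Hr.
destruct (H (rev P) (mirror p) (bounded_rev K P HP) Hx) as [t [y [t0 [E [Hy Hp]]]]].
{ replace (pdist (mirror p) (0, 0)) with (pdist p (0, 0)); [exact Hr |].
  unfold pdist, dist_euc, mirror; simpl. f_equal. unfold Rsqr. ring. }
assert (Em : mirror (0, y) = (0, - y)) by reflexivity.
assert (F : forall s, flowR P (0, - y) s = mirror (flowR (rev P) (mirror p) (t - s))).
{ intros s. rewrite <- flow_back, E. reflexivity. }
exists t, (- y). split; [exact t0 |]. split; [lra |]. split.
- rewrite F. replace (t - t) with 0 by ring. unfold flowR at 1. rewrite flow_0.
  apply mirror_mirror.
- intros s Hs. rewrite F. apply Hp. lra.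
Qed.

(** The energy shrinks by at most a fixed factor in time 6, and |u| + |q| is at most an affine
    function of the distance to the origin. So arcs that start far out stay far out. *)
Lemma flow_norm_lower K N : 0 < K -> exists r, forall P y t, params_bounded K P ->
  y <= - r -> 0 <= t <= 6 -> N <= pdist (flowR P (0, y) t) (0, 0).
Proof.
intros K0. set (e := exp (- (6 * K))). assert (e0 : 0 < e) by apply exp_pos.
exists (K * K + K + (K + 2) * (Rabs N + K * K + K + 1) / e).
intros P y t HP Hy Ht.
set (g := gammaR P). set (a := xR P). set (b := bpar P).
assert (Hg : Rabs g <= K) by apply HP. assert (Ha : Rabs a <= K) by apply HP.
assert (Hga := bounded_shift K P HP). fold g a b in Hga.
assert (Hga' := Hga). apply Rabs_le_between in Hga'.
set (p := flowR P (0, y) t). set (D := pdist p (0, 0)).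
destruct (pdist_ge p) as [Dx Dy]. fold D in Dx, Dy.
assert (D0 : 0 <= D) by (apply Rle_trans with (Rabs (fst p)); [apply Rabs_pos | exact Dx]).
assert (En := flow_energy g a b (0, y) t).
rewrite <- (ucoord_flow g a b (0, y) t), <- (qcoord_flow g a b (0, y) t) in En.
change (flow g a b (0, y) t) with p in En.
assert (U : Rabs (ucoord a p) <= D + K).
{ unfold ucoord, Rminus. eapply Rle_trans; [apply Rabs_triang |]. rewrite Rabs_Ropp. lra. }
assert (Q : Rabs (qcoord g a b p) <= (K + 1) * D + (K * K + K)).
{ replace (qcoord g a b p) with (g * fst p + (g * a + b) + - snd p)
    by (unfold qcoord; ring).
  eapply Rle_trans; [apply Rabs_triang |]. rewrite Rabs_Ropp.
  assert (Rabs (g * fst p + (g * a + b)) <= K * D + (K * K + K)); [| lra].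
  eapply Rle_trans; [apply Rabs_triang |]. apply Rplus_le_compat; [| exact Hga].
  rewrite Rabs_mult. apply Rmult_le_compat; try apply Rabs_pos; assumption. }
set (s := qcoord g a b (0, y)) in En.
assert (Hs : (K + 2) * (Rabs N + K * K + K + 1) / e <= s)
  by (unfold s, qcoord; simpl; lra).
assert (L := exp_time_lower K g t Hg Ht). fold e in L.
assert (N0 := Rabs_pos N). assert (NN := Rle_abs N).
set (W := (K + 2) * (Rabs N + K * K + K + 1)) in *.
assert (W0 : 0 < W) by (unfold W; nra).
assert (Hes : W <= exp (g * t) * s).
{ apply Rle_trans with (e * s).
  - replace W with (e * (W / e)) by (field; lra). apply Rmult_le_compat_l; lra.
  - apply Rmult_le_compat_r; [| exact L].
    apply Rle_trans with (W / e); [| exact Hs].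
    apply Rlt_le, Rdiv_lt_0_compat; assumption. }
assert (Low : W ^ 2 <= ucoord a p ^ 2 + qcoord g a b p ^ 2).
{ rewrite En, Rmult_plus_distr_l, <- !Rpow_mult_distr.
  assert (A := pow2_ge_0 (exp (g * t) * ucoord a (0, y))).
  assert (W ^ 2 <= (exp (g * t) * s) ^ 2) by (apply pow_incr; lra). lra. }
assert (Up : W <= Rabs (ucoord a p) + Rabs (qcoord g a b p)).
{ rewrite <- (pow2_abs (ucoord a p)), <- (pow2_abs (qcoord g a b p)) in Low.
  assert (A1 := Rabs_pos (ucoord a p)). assert (A2 := Rabs_pos (qcoord g a b p)). nra. }
apply Rnot_lt_le. intros HN. unfold W in Up. nra.
Qed.

(** * The center at infinity *)

Lemma cycle_curve_start P y y1 y2 tau tau' c : full_turn P y y1 y2 tau tau' ->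
  xR P <> 0 -> cycle_curve P y y1 tau tau' c -> c 0 = (0, y) /\ c tau = (0, y1).
Proof.
intros Hf a0 [_ [C1 _]]. assert (T := half_time _ _ _ _ _ (proj1 Hf)).
split; rewrite C1 by lra.
- apply flow_0.
- apply half_turn_end; [exact a0 | apply Hf].
Qed.

Lemma cycle_periodic K P y y1 tau tau' c z t0 : params_bounded K P -> far K y y1 ->
  full_turn P y y1 y tau tau' -> cycle_curve P y y1 tau tau' c ->
  (forall t, z t = c (t - t0)) -> periodic z.
Proof.
intros HP Hfar Hf Hc Hz.
assert (R := reach_big K (bounded_pos K P HP)).
assert (T1 := half_time _ _ _ _ _ (proj1 Hf)). assert (T2 := half_time _ _ _ _ _ (proj2 Hf)).
destruct (cycle_curve_start P y y1 y tau tau' c Hf ltac:(apply HP) Hc) as [C0 C1].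
split.
- exists (tau + tau'). split; [lra |]. intros t. rewrite !Hz.
  replace (t + (tau + tau') - t0) with (t - t0 + (tau + tau')) by ring. apply Hc.
- assert (E0 : z t0 = (0, y)) by (rewrite Hz, <- C0; f_equal; ring).
  assert (E1 : z (t0 + tau) = (0, y1)) by (rewrite Hz, <- C1; f_equal; ring).
  (* The curve passes through two ordinates of opposite signs, [y] and [y1]; at least one of these
     points differs from [z 0]. *)
  destruct (Req_dec (snd (z 0)) y) as [h | h].
  + exists (t0 + tau). rewrite E1. intros E. rewrite <- E in h. simpl in h.
    destruct Hfar. lra.
  + exists t0. rewrite E0. intros E. rewrite <- E in h. now apply h.
Qed.

Definition symmetric_params (eta xi : R) : params :=
  {| gammaL := - eta; gammaR := eta; bpar := 0; xL := - xi; xR := xi |}.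

(** Reversibility: the unperturbed system is invariant under (x, y, t) -> (-x, y, -t), so the left
    half turn retraces the right one and ends where the latter began. *)
Lemma symmetric_full_turn eta xi y y1 tau :
  half_turn (symmetric_params eta xi) y y1 tau ->
  full_turn (symmetric_params eta xi) y y1 y tau tau.
Proof.
intros H. split; [exact H |]. unfold half_turn in *. simpl in *.
apply half_rev in H. rewrite Ropp_involutive.
replace (- eta * xi + 0 - - y1) with (y1 - eta * xi - 0) by ring.
replace (- y - - eta * xi - 0) with (eta * xi + 0 - y) by ring. exact H.
Qed.

Lemma symmetric_rot eta xi :
  rot (symmetric_params (- eta) xi) = symmetric_params eta xi.
Proof. unfold rot, symmetric_params; simpl. f_equal; ring. Qed.

Lemma symmetric_bounded eta xi : xi <> 0 ->
  params_bounded (Rabs eta + Rabs xi) (symmetric_params eta xi).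
Proof.
intros h. assert (A := Rabs_pos eta). assert (B := Rabs_pos xi).
unfold params_bounded; simpl. rewrite !Rabs_Ropp, Rabs_R0.
repeat split; try lra; try exact h.
Qed.

(** Each far solution passes deep through the lower axis, where the turn closes, and is then a
    translate of that cycle. For existence, points with x > 0 or on the lower axis lie on such
    cycles; the others are rotated into the system with [- eta]. *)
Lemma symmetric_center eta xi : xi <> 0 ->
  center_at_infinity (symmetric_params eta xi).
Proof.
intros hxi. set (K := Rabs eta + Rabs xi).
assert (HB := symmetric_bounded eta xi hxi). fold K in HB.
assert (HB' : params_bounded K (symmetric_params (- eta) xi)).
{ unfold K. rewrite <- (Rabs_Ropp eta). now apply symmetric_bounded. }
assert (K0 := bounded_pos _ _ HB).
assert (RB := reach_big K K0).
destruct (half_turn_far K (reach K) K0) as [N [HN FN]].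
destruct (far_solution_hits K N K0) as [r1 H1].
destruct (flow_from_axis K N K0) as [r2 H2].
assert (Cyc : forall e y, params_bounded K (symmetric_params e xi) -> y <= - N ->
  exists y1 tau c, far K y y1 /\ full_turn (symmetric_params e xi) y y1 y tau tau /\
    solution (symmetric_params e xi) c /\ cycle_curve (symmetric_params e xi) y y1 tau tau c).
{ intros e y He Hy. destruct (half_turn_exists K _ y He ltac:(lra)) as [y1 [tau Ht]].
  assert (Hfar : far K y y1).
  { split; [lra |]. exact (FN _ _ _ _ He Hy Ht). }
  assert (Hf := symmetric_full_turn _ _ _ _ _ Ht).
  destruct (cycle_curve_exists K _ y y1 tau tau He Hfar Hf) as [c [Hc1 Hc2]].
  exists y1, tau, c. auto. }
assert (Ex : forall e p, params_bounded K (symmetric_params e xi) ->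
  Rmax N r2 < pdist p (0, 0) -> 0 < fst p \/ (fst p = 0 /\ snd p < 0) ->
  exists z, solution (symmetric_params e xi) z /\ z 0 = p).
{ intros e p He Hp [Hx | [Hx Hy]].
  - destruct (H2 _ p He Hx) as [t [y [t0 [Hy [Ep Hpos]]]]].
    { assert (M := Rmax_r N r2). lra. }
    destruct (Cyc e y He Hy) as [y1 [tau [c [Hfar [Hf [Hc1 Hc2]]]]]].
    exists (fun s => c (s + t)). split; [now apply solution_shift |].
    rewrite Rplus_0_l. destruct Hc2 as [_ [C1 _]]. rewrite C1; [exact Ep |].
    (* The flow is back on the axis at time [tau] but is in x > 0 up to time [t], so [t] cannot
       exceed [tau]. *)
    split; [lra |]. apply Rnot_lt_le. intros N1.
    assert (T := half_time _ _ _ _ _ (proj1 Hf)). specialize (Hpos tau ltac:(lra)).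
    rewrite (half_turn_end _ _ y1) in Hpos; [simpl in Hpos; lra | apply He | apply Hf].
  - destruct (Cyc e (snd p) He) as [y1 [tau [c [Hfar [Hf [Hc1 Hc2]]]]]].
    { assert (B := pdist_le p). rewrite Hx, Rabs_R0, Rabs_left in B by lra.
      assert (M := Rmax_l N r2). lra. }
    exists c. split; [exact Hc1 |].
    destruct (cycle_curve_start _ _ _ _ _ _ _ Hf ltac:(apply He) Hc2) as [-> _].
    now apply injective_projections. }
exists (Rmax r1 (Rmax N r2)). intros p Hp.
assert (M1 := Rmax_l r1 (Rmax N r2)). assert (M2 := Rmax_r r1 (Rmax N r2)).
assert (M3 := Rmax_l N r2). split.
- destruct (Rlt_or_le 0 (fst p)) as [Hx | Hx]; [apply Ex; auto; lra |].
  destruct (Rlt_or_le (fst p) 0) as [Hx' | Hx'].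
  + destruct (Ex (- eta) (flip p) HB') as [z [Hz Ez]].
    * replace (pdist (flip p) (0, 0)) with (pdist p (0, 0)); [lra |].
      unfold pdist, dist_euc, flip; simpl. f_equal. unfold Rsqr. ring.
    * left. simpl. lra.
    * exists (fun t => flip (z t)). split.
      -- rewrite <- symmetric_rot. now apply solution_rot.
      -- rewrite Ez. apply flip_flip.
  + destruct (Rlt_or_le (snd p) 0) as [Hy | Hy]; [apply Ex; auto; [lra | right; lra] |].
    destruct (Ex (- eta) (flip p) HB') as [z [Hz Ez]].
    * replace (pdist (flip p) (0, 0)) with (pdist p (0, 0)); [lra |].
      unfold pdist, dist_euc, flip; simpl. f_equal. unfold Rsqr. ring.
    * right. simpl. split; [lra |].
      assert (B := pdist_le p). replace (fst p) with 0 in B by lra.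
      rewrite Rabs_R0, Rabs_pos_eq in B by lra. lra.
    * exists (fun t => flip (z t)). split.
      -- rewrite <- symmetric_rot. now apply solution_rot.
      -- rewrite Ez. apply flip_flip.
- intros z Hz Ez.
  destruct (H1 _ z 0 HB Hz) as [t [y [Et Hy]]]; [rewrite Ez; lra |].
  destruct (Cyc eta y HB Hy) as [y1 [tau [c [Hfar [Hf [Hc1 Hc2]]]]]].
  apply (cycle_periodic K _ y y1 tau tau c z t HB Hfar Hf Hc2).
  exact (solution_cycle K _ z t y y1 tau tau c HB Hz Et Hfar Hf Hc2).
Qed.

(** * Zeros of a perturbed concave function *)

(** Rolle's argument twice: three zeros of [f] give two zeros of [f1] and a zero of [f2]. *)
Lemma concave_three_zeros (f f1 f2 : R -> R) x1 x2 x3 : x1 < x2 -> x2 < x3 ->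
  (forall w, x1 <= w <= x3 -> is_derive f w (f1 w)) ->
  (forall w, x1 <= w <= x3 -> is_derive f1 w (f2 w)) ->
  (forall w, x1 <= w <= x3 -> f2 w < 0) ->
  f x1 = 0 -> f x2 = 0 -> f x3 = 0 -> False.
Proof.
intros H12 H23 D1 D2 N E1 E2 E3.
destruct (MVT_cor2 f f1 x1 x2 H12) as [c1 [F1 I1]].
{ intros c Hc. apply is_derive_Reals, D1. lra. }
destruct (MVT_cor2 f f1 x2 x3 H23) as [c2 [F2 I2]].
{ intros c Hc. apply is_derive_Reals, D1. lra. }
destruct (MVT_cor2 f1 f2 c1 c2) as [c [F I]]; [lra | |].
{ intros c Hc. apply is_derive_Reals, D2. lra. }
assert (Z1 : f1 c1 = 0) by (apply (Rmult_eq_reg_r (x2 - x1)); lra).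
assert (Z2 : f1 c2 = 0) by (apply (Rmult_eq_reg_r (x3 - x2)); lra).
specialize (N c ltac:(lra)). nra.
Qed.

(** For [g = eta] the concave graph leaves 0 with slope [l]. A line of slope [l'] slightly smaller
    lies below the graph at some [wm] and still above it at [wb]. A much smaller move of [g] keeps
    these two strict signs and makes the value at 0 negative, so A g w - l' w has signs -, +, - at
    0, [wm], [wb]; concavity excludes a third zero. *)
Lemma bifurcation_of_two_zeros (A A1 A2 : R -> R -> R) (eta l d w0 wb e : R) :
  0 < d -> 0 < wb <= w0 -> 0 < e ->
  (forall g w, Rabs (g - eta) < d -> 0 <= w <= w0 ->
     is_derive (A g) w (A1 g w) /\ is_derive (A1 g) w (A2 g w) /\ A2 g w < 0) ->
  A eta 0 = 0 -> A1 eta 0 = l ->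
  (forall w eps, 0 <= w <= w0 -> 0 < eps -> exists d', 0 < d' /\
     forall g, Rabs (g - eta) < d' -> Rabs (A g w - A eta w) < eps) ->
  (forall d', 0 < d' -> exists g, Rabs (g - eta) < d' /\ A g 0 < 0) ->
  exists g l' w1 w2, Rabs (g - eta) < d /\ Rabs (g - eta) < e /\
    Rabs (l' - l) < e /\ 0 < w1 < w2 /\ w2 < wb /\
    A g w1 = l' * w1 /\ A g w2 = l' * w2 /\
    (forall w, 0 < w <= w0 -> A g w = l' * w -> w = w1 \/ w = w2).
Proof.
intros d0 Hwb e0 HA Z0 Z1 Hcont Hneg.
assert (He : Rabs (eta - eta) < d) by (rewrite Rminus_diag, Rabs_R0; exact d0).
assert (Hb : A eta wb < l * wb).
{ destruct (MVT_cor2 (A eta) (A1 eta) 0 wb) as [c [F I]]; [lra | |].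
  { intros c Hc. apply is_derive_Reals, HA; [exact He | lra]. }
  destruct (MVT_cor2 (A1 eta) (A2 eta) 0 c) as [c' [F' I']]; [lra | |].
  { intros x Hx. apply is_derive_Reals, HA; [exact He | lra]. }
  assert (N : A2 eta c' < 0) by (apply HA; [exact He | lra]).
  rewrite Z0 in F. rewrite Z1 in F'. assert (A1 eta c < l) by nra. nra. }
(* Half the gap between the tangent slope at 0 and the slope of the chord to [wb]: lowering [l] by
   at most [k] stays above the chord slope. *)
set (k := (l - A eta wb / wb) / 2).
assert (Hq : A eta wb / wb * wb = A eta wb) by (field; lra).
assert (k0 : 0 < k) by (unfold k; nra).
set (l' := l - Rmin (e / 2) k).
assert (M1 := Rmin_l (e / 2) k). assert (M2 := Rmin_r (e / 2) k).
assert (M0 : 0 < Rmin (e / 2) k) by (apply Rmin_glb_lt; lra).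
assert (Hl : A eta wb < l' * wb) by (unfold l', k in *; nra).
assert (Hm : exists wm, 0 < wm < wb /\ l' * wm < A eta wm).
{ assert (Dr : is_derive (A eta) 0 l) by (rewrite <- Z1; apply HA; [exact He | lra]).
  apply is_derive_Reals in Dr. destruct (Dr _ M0) as [h Hh].
  assert (B1 := Rmin_l (h / 2) (wb / 2)). assert (B2 := Rmin_r (h / 2) (wb / 2)).
  assert (h0 := cond_pos h).
  assert (B0 : 0 < Rmin (h / 2) (wb / 2)) by (apply Rmin_glb_lt; lra).
  set (wm := Rmin (h / 2) (wb / 2)) in *.
  exists wm. split; [lra |].
  specialize (Hh wm ltac:(lra)). rewrite (Rabs_pos_eq wm) in Hh by lra.
  specialize (Hh ltac:(lra)). rewrite Rplus_0_l, Z0, Rminus_0_r in Hh.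
  apply Rabs_def2 in Hh.
  replace (A eta wm) with (A eta wm / wm * wm) by (field; lra). unfold l'. nra. }
destruct Hm as [wm [Im Hm]].
destruct (Hcont wb (l' * wb - A eta wb)) as [da [da0 Ha]]; [lra | lra |].
destruct (Hcont wm (A eta wm - l' * wm)) as [db [db0 Hb']]; [lra | lra |].
destruct (Hneg (Rmin (Rmin da db) (Rmin d e))) as [g [Hg G0]].
{ repeat apply Rmin_glb_lt; lra. }
assert (R1 := Rmin_l (Rmin da db) (Rmin d e)). assert (R2 := Rmin_r (Rmin da db) (Rmin d e)).
assert (R3 := Rmin_l da db). assert (R4 := Rmin_r da db).
assert (R5 := Rmin_l d e). assert (R6 := Rmin_r d e).
specialize (Ha g ltac:(lra)). specialize (Hb' g ltac:(lra)).
apply Rabs_def2 in Ha. apply Rabs_def2 in Hb'.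
assert (HgA : forall w, 0 <= w <= w0 -> is_derive (A g) w (A1 g w) /\
  is_derive (A1 g) w (A2 g w) /\ A2 g w < 0) by (intros w Hw; apply HA; lra).
set (f := fun w => A g w - l' * w).
assert (Df : forall w, 0 <= w <= w0 -> is_derive f w (A1 g w - l')).
{ intros w Hw. apply (is_derive_minus (V := R_NormedModule)); [now apply HgA |].
  apply is_derive_Reals. rewrite <- (Rmult_1_r l') at 2.
  apply (derivable_pt_lim_scal id). apply derivable_pt_lim_id. }
assert (D2f : forall w, 0 <= w <= w0 -> is_derive (fun w => A1 g w - l') w (A2 g w)).
{ intros w Hw. rewrite <- (Rminus_0_r (A2 g w)).
  apply (is_derive_minus (V := R_NormedModule) _ (fun _ => l')); [now apply HgA |].
  apply is_derive_Reals, derivable_pt_lim_const. }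
assert (Cf : forall w, 0 <= w <= w0 -> continuity_pt f w).
{ intros w Hw. apply derivable_continuous_pt. exists (A1 g w - l').
  apply is_derive_Reals. now apply Df. }
destruct (IVT_interv f 0 wm) as [w1 [I1 E1]].
{ intros w Hw. apply Cf. lra. }
{ lra. } { unfold f. lra. } { unfold f. lra. }
destruct (IVT_interv (fun w => - f w) wm wb) as [w2 [I2 E2]].
{ intros w Hw. apply continuity_pt_opp, Cf. lra. }
{ lra. } { unfold f. lra. } { unfold f. lra. }
assert (J1 : 0 < w1 < wm).
{ split; apply Rnot_le_lt; intros N.
  - assert (w1 = 0) by lra. subst w1. unfold f in E1. lra.
  - assert (w1 = wm) by lra. subst w1. unfold f in E1. lra. }
assert (J2 : wm < w2 < wb).
{ split; apply Rnot_le_lt; intros N.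
  - assert (w2 = wm) by lra. subst w2. unfold f in E2. lra.
  - assert (w2 = wb) by lra. subst w2. unfold f in E2. lra. }
assert (E2' : f w2 = 0) by lra.
exists g, l', w1, w2.
repeat split; try lra; try (unfold f in *; lra).
- unfold l'. replace (l - Rmin (e / 2) k - l) with (- Rmin (e / 2) k) by ring.
  rewrite Rabs_Ropp, Rabs_pos_eq; lra.
- intros w Hw Ew. assert (E3 : f w = 0) by (unfold f; lra).
  assert (T : forall x1 x2 x3, 0 <= x1 -> x1 < x2 -> x2 < x3 -> x3 <= w0 ->
    f x1 = 0 -> f x2 = 0 -> f x3 = 0 -> False).
  { intros x1 x2 x3 H1 H2 H3 H4.
    apply (concave_three_zeros f (fun w => A1 g w - l') (A2 g) x1 x2 x3 H2 H3).
    - intros x Hx. apply Df. lra.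
    - intros x Hx. apply D2f. lra.
    - intros x Hx. apply HgA. lra. }
  destruct (Rtotal_order w w1) as [h | [h | h]]; [| left; exact h |].
  + exfalso. apply (T w w1 w2); try assumption; lra.
  + destruct (Rtotal_order w w2) as [h' | [h' | h']]; [| right; exact h' |].
    * exfalso. apply (T w1 w w2); try assumption; lra.
    * exfalso. apply (T w1 w2 w); try assumption; lra.
Qed.

(** * The profile of a half turn *)

Lemma increasing_of_derive (m m' : R -> R) del :
  (forall th, Rabs th <= del -> is_derive m th (m' th) /\ 0 < m' th) ->
  forall x y, - del <= x -> x < y -> y <= del -> m x < m y.
Proof.
intros H x y Hx Hxy Hy.
destruct (MVT_cor2 m m' x y Hxy) as [c [E I]].
{ intros c Hc. apply is_derive_Reals, H. apply Rabs_le. lra. }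
assert (P : 0 < m' c) by (apply H, Rabs_le; lra). nra.
Qed.

Lemma inverse_exists (m m' : R -> R) del w : 0 < del ->
  (forall th, Rabs th <= del -> is_derive m th (m' th) /\ 0 < m' th) ->
  m (- del) < w < m del -> exists th, - del < th < del /\ m th = w.
Proof.
intros d0 H Hw.
destruct (IVT_interv (fun th => m th - w) (- del) del) as [x [Ix Ex]]; try lra.
{ intros th Hth. apply (continuity_pt_minus m (fun _ => w)).
  - apply derivable_continuous_pt. exists (m' th). apply is_derive_Reals, H, Rabs_le. lra.
  - apply continuity_pt_const. intros ? ?. reflexivity. }
exists x. split; [| lra]. split; apply Rnot_le_lt; intros N.
- assert (x = - del) by lra. subst x. lra.
- assert (x = del) by lra. subst x. lra.
Qed.

(** Monotonicity confines the increment [h] of [mu] to a small interval when the increment [k] of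
    the argument is small; then h / k is the inverse of the difference quotient of [m]. *)
Lemma is_derive_inverse (m m' mu : R -> R) del w :
  (forall th, Rabs th <= del -> is_derive m th (m' th) /\ 0 < m' th) ->
  (forall v, m (- del) < v < m del -> - del < mu v < del /\ m (mu v) = v) ->
  m (- del) < w < m del -> is_derive mu w (/ m' (mu w)).
Proof.
intros H Hmu Hw. destruct (Hmu w Hw) as [I E].
assert (Inc := increasing_of_derive m m' del H).
set (th := mu w) in *. set (L := m' th).
destruct (H th) as [D L0]; [apply Rabs_le; lra |]. fold L in D, L0.
apply is_derive_Reals. intros eps eps0.
apply is_derive_Reals in D.
(* The first bound keeps the quotient [q] above L / 2, hence q L > L ^ 2 / 2; the second then makes
   |q - L| / (q L) smaller than [eps]. *)
set (e1 := Rmin (L / 2) (eps * (L * L / 2))).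
assert (e10 : 0 < e1) by (apply Rmin_glb_lt; [lra |]; apply Rmult_lt_0_compat; nra).
assert (e1a := Rmin_l (L / 2) (eps * (L * L / 2))).
assert (e1b := Rmin_r (L / 2) (eps * (L * L / 2))). fold e1 in e1a, e1b.
destruct (D e1 e10) as [d Hd].
set (r := Rmin (d / 2) (Rmin (del - th) (th + del) / 2)).
assert (r1 := Rmin_l (d / 2) (Rmin (del - th) (th + del) / 2)).
assert (r2 := Rmin_r (d / 2) (Rmin (del - th) (th + del) / 2)).
assert (r3 := Rmin_l (del - th) (th + del)). assert (r4 := Rmin_r (del - th) (th + del)).
assert (r5 : 0 < Rmin (del - th) (th + del)) by (apply Rmin_glb_lt; lra).
assert (dpos := cond_pos d).
assert (r0 : 0 < r) by (apply Rmin_glb_lt; lra). fold r in r1, r2.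
assert (U : w < m (th + r)) by (rewrite <- E; apply Inc; lra).
assert (V : m (th - r) < w) by (rewrite <- E; apply Inc; lra).
assert (k0 : 0 < Rmin (m (th + r) - w) (w - m (th - r))) by (apply Rmin_glb_lt; lra).
exists (mkposreal _ k0). simpl. intros k kn Hk.
assert (k1 := Rmin_l (m (th + r) - w) (w - m (th - r))).
assert (k2 := Rmin_r (m (th + r) - w) (w - m (th - r))).
assert (Hk' := Hk). apply Rabs_def2 in Hk'.
assert (Hend1 : m (- del) <= m (th - r)).
{ destruct (Req_dec (- del) (th - r)) as [<- | n]; [lra |]. apply Rlt_le, Inc; lra. }
assert (Hend2 : m (th + r) <= m del).
{ destruct (Req_dec (th + r) del) as [-> | n]; [lra |]. apply Rlt_le, Inc; lra. }
destruct (Hmu (w + k)) as [I' E']; [lra |].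
set (h := mu (w + k) - th).
assert (Eh : m (th + h) = w + k).
{ replace (th + h) with (mu (w + k)) by (unfold h; ring). exact E'. }
assert (hn : h <> 0).
{ intros Z. rewrite Z, Rplus_0_r, E in Eh. lra. }
assert (hr : Rabs h < r).
{ apply Rnot_le_lt. intros N.
  destruct (Rle_or_lt 0 h) as [hp | hp].
  - rewrite Rabs_pos_eq in N by lra.
    assert (m (th + r) <= m (th + h)); [| lra].
    destruct (Req_dec r h) as [<- | n]; [lra |]. apply Rlt_le, Inc; unfold h in *; lra.
  - rewrite Rabs_left in N by lra.
    assert (m (th + h) <= m (th - r)); [| lra].
    destruct (Req_dec h (- r)) as [-> | n]; [right; f_equal; ring |].
    apply Rlt_le, Inc; unfold h in *; lra. }
fold th. specialize (Hd h hn ltac:(lra)). rewrite Eh, E in Hd.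
replace (w + k - w) with k in Hd by ring.
set (q := k / h) in *. assert (Hd' := Hd). apply Rabs_def2 in Hd'.
assert (q0 : L / 2 < q) by lra.
replace ((mu (w + k) - th) / k) with (/ q) by (unfold q; fold h; field; split; assumption).
replace (/ q - / L) with (- ((q - L) * / (q * L))) by (field; split; lra).
rewrite Rabs_Ropp, Rabs_mult.
rewrite (Rabs_pos_eq (/ (q * L))) by (apply Rlt_le, Rinv_0_lt_compat; nra).
apply (Rmult_lt_reg_r (q * L)); [nra |].
rewrite Rmult_assoc, Rinv_l, Rmult_1_r by nra.
apply Rlt_le_trans with (eps * (L * L / 2)); [lra |].
apply Rmult_le_compat_l; [lra | nra].
Qed.

(* For a half turn of duration [PI + th], [half] gives
   [(s + p) sin th = 2 a hE] and [(p - s) sin th = 2 a sinh (g (PI + th))].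
   [hD] and [hN] are the numerators of the derivatives of [hm] and [hT], so along
   [hm] the slope of [hT] is [hN / hD], and the slope of the latter is [hX]. *)
Definition hE (g th : R) : R := cos th + cosh (g * (PI + th)).
Definition hm (g th : R) : R := sin th / hE g th.
Definition hT (g th : R) : R := sinh (g * (PI + th)) / hE g th.
Definition hD (g th : R) : R := 1 + cosh (g * (PI + th)) * cos th - g * sinh (g * (PI + th)) * sin th.
Definition hN (g th : R) : R := g * (1 + cosh (g * (PI + th)) * cos th) + sinh (g * (PI + th)) * sin th.
Definition hX (g th : R) : R := (1 + g ^ 2) * (sinh (g * (PI + th)) + g * sin th) *
  hE g th ^ 3 / hD g th ^ 3.

Lemma cosh2_sinh2 x : cosh x * cosh x - sinh x * sinh x = 1.
Proof.
unfold cosh, sinh. assert (E : exp x * exp (- x) = 1).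
{ rewrite <- exp_plus, Rplus_opp_r. apply exp_0. }
transitivity (exp x * exp (- x)); [field | exact E].
Qed.

Section HalfMapProfile.
Variable g : R.

Let ch th := cosh (g * (PI + th)).
Let sh th := sinh (g * (PI + th)).

Lemma is_derive_sh th : is_derive sh th (g * ch th).
Proof. unfold sh, ch, sinh, cosh. auto_derive; [trivial | field]. Qed.

Lemma is_derive_ch th : is_derive ch th (g * sh th).
Proof. unfold sh, ch, sinh, cosh. auto_derive; [trivial | field]. Qed.

Lemma is_derive_hE th : is_derive (hE g) th (- sin th + g * sh th).
Proof.
apply (is_derive_plus (V := R_NormedModule) cos ch).
- apply is_derive_Reals, derivable_pt_lim_cos.
- apply is_derive_ch.
Qed.

Lemma is_derive_sin_real th : is_derive sin th (cos th).
Proof. apply is_derive_Reals, derivable_pt_lim_sin. Qed.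

Let trig th : sin th * sin th + cos th * cos th = 1.
Proof. exact (sin2_cos2 th). Qed.

Let hyp th : ch th * ch th - sh th * sh th = 1.
Proof. apply cosh2_sinh2. Qed.

Lemma is_derive_hm th : hE g th <> 0 -> is_derive (hm g) th (hD g th / hE g th ^ 2).
Proof.
intros H. evar_last.
- apply (is_derive_div sin (hE g)); [apply is_derive_sin_real | apply is_derive_hE | exact H].
- f_equal. unfold hE, hD. fold (ch th) (sh th).
  transitivity (sin th * sin th + cos th * cos th + ch th * cos th - g * sh th * sin th);
    [ring | rewrite trig; ring].
Qed.

Lemma is_derive_hT th : hE g th <> 0 -> is_derive (hT g) th (hN g th / hE g th ^ 2).
Proof.
intros H. evar_last.
- apply (is_derive_div sh (hE g)); [apply is_derive_sh | apply is_derive_hE | exact H].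
- f_equal. unfold hE, hN. fold (ch th) (sh th).
  transitivity (g * (ch th * ch th - sh th * sh th + ch th * cos th) + sh th * sin th);
    [ring | rewrite hyp; ring].
Qed.

Lemma is_derive_hN th : is_derive (hN g) th ((1 + g ^ 2) * sh th * cos th).
Proof.
unfold hN.
evar_last.
- apply (is_derive_plus (V := R_NormedModule) (fun x => g * (1 + ch x * cos x))
    (fun x => sh x * sin x)).
  + apply is_derive_scal. apply (is_derive_plus (V := R_NormedModule) (fun _ => 1)
      (fun x => ch x * cos x)).
    * apply is_derive_Reals, derivable_pt_lim_const.
    * apply (is_derive_mult ch cos); [apply is_derive_ch | | intros; apply Rmult_comm].
      apply is_derive_Reals, derivable_pt_lim_cos.
  + apply (is_derive_mult sh sin); [apply is_derive_sh | | intros; apply Rmult_comm].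
    apply is_derive_sin_real.
- unfold plus, mult; simpl. ring.
Qed.

Lemma is_derive_hD th : is_derive (hD g) th (- (1 + g ^ 2) * ch th * sin th).
Proof.
unfold hD.
evar_last.
- apply (is_derive_minus (V := R_NormedModule) (fun x => 1 + ch x * cos x)
    (fun x => g * sh x * sin x)).
  + apply (is_derive_plus (V := R_NormedModule) (fun _ => 1) (fun x => ch x * cos x)).
    * apply is_derive_Reals, derivable_pt_lim_const.
    * apply (is_derive_mult ch cos); [apply is_derive_ch | | intros; apply Rmult_comm].
      apply is_derive_Reals, derivable_pt_lim_cos.
  + apply (is_derive_mult (fun x => g * sh x) sin); [| | intros; apply Rmult_comm].
    * apply is_derive_scal, is_derive_sh.
    * apply is_derive_sin_real.
- unfold minus, plus, opp, mult, zero; simpl. ring.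
Qed.

Lemma is_derive_hN_hD th : hD g th <> 0 -> is_derive (fun x => hN g x / hD g x) th
  ((1 + g ^ 2) * (sh th + g * sin th) * hE g th / hD g th ^ 2).
Proof.
intros H. evar_last.
- apply (is_derive_div (hN g) (hD g)); [apply is_derive_hN | apply is_derive_hD | exact H].
- f_equal. unfold hE, hD, hN. fold (ch th) (sh th).
  transitivity ((1 + g ^ 2) * (sh th * cos th + sh th * ch th *
    (sin th * sin th + cos th * cos th)
    + g * sin th * cos th * (ch th * ch th - sh th * sh th) + g * ch th * sin th)).
  + ring.
  + rewrite trig, hyp. ring.
Qed.

End HalfMapProfile.

(** * Joint continuity in the parameter and the angle, and values at the angle 0 *)

Lemma continuity_2d_cosh g th :
  continuity_2d_pt (fun g th => cosh (g * (PI + th))) g th.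
Proof.
apply continuity_1d_2d_pt_comp.
- apply derivable_continuous_pt, derivable_pt_cosh.
- apply continuity_2d_pt_mult; [apply continuity_2d_pt_id1 |].
  apply continuity_2d_pt_plus; [apply continuity_2d_pt_const | apply continuity_2d_pt_id2].
Qed.

Lemma continuity_2d_sinh g th :
  continuity_2d_pt (fun g th => sinh (g * (PI + th))) g th.
Proof.
apply continuity_1d_2d_pt_comp.
- apply derivable_continuous_pt, derivable_pt_sinh.
- apply continuity_2d_pt_mult; [apply continuity_2d_pt_id1 |].
  apply continuity_2d_pt_plus; [apply continuity_2d_pt_const | apply continuity_2d_pt_id2].
Qed.

Lemma continuity_2d_sin g th : continuity_2d_pt (fun _ th => sin th) g th.
Proof.
apply (continuity_1d_2d_pt_comp sin (fun _ th => th)); [apply continuity_sin | apply continuity_2d_pt_id2].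
Qed.

Lemma continuity_2d_cos g th : continuity_2d_pt (fun _ th => cos th) g th.
Proof.
apply (continuity_1d_2d_pt_comp cos (fun _ th => th)); [apply continuity_cos | apply continuity_2d_pt_id2].
Qed.

Lemma continuity_2d_hE g th : continuity_2d_pt hE g th.
Proof. apply continuity_2d_pt_plus; [apply continuity_2d_cos | apply continuity_2d_cosh]. Qed.

Lemma continuity_2d_hm g th : hE g th <> 0 -> continuity_2d_pt hm g th.
Proof.
intros H. apply continuity_2d_pt_mult; [apply continuity_2d_sin |].
apply continuity_2d_pt_inv; [apply continuity_2d_hE | exact H].
Qed.

Lemma continuity_2d_hT g th : hE g th <> 0 -> continuity_2d_pt hT g th.
Proof.
intros H. apply continuity_2d_pt_mult; [apply continuity_2d_sinh |].
apply continuity_2d_pt_inv; [apply continuity_2d_hE | exact H].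
Qed.

Lemma continuity_2d_hD g th : continuity_2d_pt hD g th.
Proof.
apply continuity_2d_pt_minus.
- apply continuity_2d_pt_plus; [apply continuity_2d_pt_const |].
  apply continuity_2d_pt_mult; [apply continuity_2d_cosh | apply continuity_2d_cos].
- apply continuity_2d_pt_mult; [| apply continuity_2d_sin].
  apply continuity_2d_pt_mult; [apply continuity_2d_pt_id1 | apply continuity_2d_sinh].
Qed.

Lemma continuity_2d_hX g th : hD g th <> 0 -> continuity_2d_pt hX g th.
Proof.
intros H. unfold hX.
assert (P3 : forall f : R -> R -> R, continuity_2d_pt f g th ->
  continuity_2d_pt (fun x y => f x y ^ 3) g th).
{ intros f Hf. simpl. repeat apply continuity_2d_pt_mult; try exact Hf.
  apply continuity_2d_pt_const. }
apply continuity_2d_pt_mult; [apply continuity_2d_pt_mult |].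
- apply continuity_2d_pt_mult.
  + simpl. apply continuity_2d_pt_plus; [apply continuity_2d_pt_const |].
    repeat apply continuity_2d_pt_mult; try apply continuity_2d_pt_id1.
    apply continuity_2d_pt_const.
  + apply continuity_2d_pt_plus; [apply continuity_2d_sinh |].
    apply continuity_2d_pt_mult; [apply continuity_2d_pt_id1 | apply continuity_2d_sin].
- apply P3, continuity_2d_hE.
- apply continuity_2d_pt_inv; [apply P3, continuity_2d_hD |].
  now apply pow_nonzero.
Qed.

Lemma continuity_2d_near f g th eps : continuity_2d_pt f g th -> 0 < eps ->
  exists d, 0 < d /\ forall g' th', Rabs (g' - g) < d -> Rabs (th' - th) < d ->
    Rabs (f g' th' - f g th) < eps.
Proof.
intros H e0. destruct (H (mkposreal eps e0)) as [d Hd].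
exists d. split; [apply cond_pos |]. intros g' th' H1 H2. now apply Hd.
Qed.

Lemma cosh_ge_1 x : 1 <= cosh x.
Proof.
unfold cosh. assert (A := exp_ineq1_le x). assert (B := exp_ineq1_le (- x)). lra.
Qed.

Lemma sinh_pos x : 0 < x -> 0 < sinh x.
Proof. intros H. unfold sinh. assert (exp (- x) < exp x) by (apply exp_increasing; lra). lra. Qed.

Lemma hE_pos g th : Rabs th <= 1 -> 0 < hE g th.
Proof.
intros H. unfold hE. assert (C := cosh_ge_1 (g * (PI + th))).
assert (P := PI2_3_2). unfold PI2 in P. apply Rabs_le_between in H.
assert (0 < cos th) by (apply cos_gt_0; lra). lra.
Qed.

Lemma hE_0 g : hE g 0 = 1 + cosh (g * PI).
Proof. unfold hE. now rewrite cos_0, Rplus_0_r. Qed.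

Lemma hD_0 g : hD g 0 = 1 + cosh (g * PI).
Proof. unfold hD. rewrite cos_0, sin_0, Rplus_0_r. ring. Qed.

(** So the profile has slope [g] at infinity; this gives the critical value eta (xi - a) of the
    coefficient [c]. *)
Lemma hN_0 g : hN g 0 = g * hD g 0.
Proof. rewrite hD_0. unfold hN. rewrite cos_0, sin_0, Rplus_0_r. ring. Qed.

Lemma hm_0 g : hm g 0 = 0.
Proof. unfold hm. rewrite sin_0. unfold Rdiv. ring. Qed.

Lemma hX_0 g : hX g 0 = (1 + g ^ 2) * sinh (g * PI).
Proof.
unfold hX. rewrite hE_0, hD_0, sin_0, Rplus_0_r.
assert (C := cosh_ge_1 (g * PI)). field. lra.
Qed.

(** Both sides are tanh (g PI / 2); the form on the right makes monotonicity in [g] visible, through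
    which [g] controls the sign of [F 0]. *)
Lemma hT_0 g : hT g 0 = 1 - 2 / (exp (g * PI) + 1).
Proof.
unfold hT. rewrite hE_0, Rplus_0_r. unfold sinh, cosh. rewrite exp_Ropp.
assert (E := exp_pos (g * PI)). field. split; nra.
Qed.

Lemma hT_0_increasing g g' : g < g' -> hT g 0 < hT g' 0.
Proof.
intros H. rewrite !hT_0. assert (P0 := PI_RGT_0).
assert (E := exp_pos (g * PI)). assert (E' : exp (g * PI) < exp (g' * PI)).
{ apply exp_increasing, Rmult_lt_compat_r; lra. }
assert (/ (exp (g' * PI) + 1) < / (exp (g * PI) + 1)).
{ apply Rinv_lt_contravar; [apply Rmult_lt_0_compat |]; lra. }
unfold Rdiv. lra.
Qed.

Lemma hE_upper K g th : Rabs g <= K -> Rabs th <= 1 -> hE g th <= 1 + exp (6 * K).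
Proof.
intros Hg Hth. unfold hE. assert (C := COS_bound th).
assert (P0 := PI_RGT_0). assert (P4 := PI_4). assert (P3 := PI2_3_2). unfold PI2 in P3. apply Rabs_le_between in Hth.
assert (B : - (6 * K) <= g * (PI + th) <= 6 * K).
{ apply Rabs_le_between. rewrite Rabs_mult, (Rabs_pos_eq (PI + th)) by lra.
  assert (G := Rabs_pos g). nra. }
assert (M : forall x, x <= 6 * K -> exp x <= exp (6 * K)).
{ intros x Hx. destruct (Req_dec x (6 * K)) as [-> | n]; [lra |].
  apply Rlt_le, exp_increasing. lra. }
assert (M1 := M (g * (PI + th)) ltac:(lra)). assert (M2 := M (- (g * (PI + th))) ltac:(lra)).
unfold cosh. lra.
Qed.

(** * The profile as a function of the amplitude *)

Definition hmu (del g w : R) : R :=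
  epsilon (inhabits 0) (fun th => - del < th < del /\ hm g th = w).

Definition rho (del g w : R) : R := hT g (hmu del g w).
Definition rho1 (del g w : R) : R := hN g (hmu del g w) / hD g (hmu del g w).
Definition rho2 (del g w : R) : R := hX g (hmu del g w).

Section Profile.
Variables del g wbar : R.
Hypothesis hdel : 0 < del <= 1.
Hypothesis hDpos : forall th, Rabs th <= del -> 0 < hD g th.
Hypothesis hwbar : hm g (- del) < - wbar /\ wbar < hm g del.

Lemma hm_slope th : Rabs th <= del ->
  is_derive (hm g) th (hD g th / hE g th ^ 2) /\ 0 < hD g th / hE g th ^ 2.
Proof.
intros H. assert (E := hE_pos g th ltac:(lra)). split.
- apply is_derive_hm. lra.
- apply Rdiv_lt_0_compat; [now apply hDpos | nra].
Qed.

(** Within the range of [hm] a preimage exists, so the choice operator in [hmu] returns one;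
    elsewhere the value of [hmu] is arbitrary. *)
Lemma hmu_spec w : hm g (- del) < w < hm g del ->
  - del < hmu del g w < del /\ hm g (hmu del g w) = w.
Proof.
intros Hw. unfold hmu. apply epsilon_spec.
apply (inverse_exists (hm g) (fun th => hD g th / hE g th ^ 2)); try lra.
exact hm_slope.
Qed.

Lemma hm_increasing x y : - del <= x -> x < y -> y <= del -> hm g x < hm g y.
Proof. apply (increasing_of_derive (hm g) (fun th => hD g th / hE g th ^ 2) del hm_slope). Qed.

Lemma hm_injective x y : - del < x < del -> - del < y < del -> hm g x = hm g y -> x = y.
Proof.
intros Hx Hy E. destruct (Rtotal_order x y) as [h | [h | h]]; [| exact h |].
- assert (A := hm_increasing x y). lra.
- assert (A := hm_increasing y x). lra.
Qed.

Lemma hmu_0 : hmu del g 0 = 0.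
Proof.
assert (H1 := hm_increasing (- del) 0). assert (H2 := hm_increasing 0 del).
rewrite hm_0 in H1, H2.
destruct (hmu_spec 0) as [I E]; [lra |].
apply hm_injective; [exact I | lra |]. now rewrite E, hm_0.
Qed.

Lemma is_derive_hmu w : Rabs w < wbar ->
  is_derive (hmu del g) w (hE g (hmu del g w) ^ 2 / hD g (hmu del g w)).
Proof.
intros Hw. apply Rabs_def2 in Hw. destruct (hmu_spec w) as [I _]; [lra |].
evar_last.
- apply (is_derive_inverse (hm g) (fun th => hD g th / hE g th ^ 2) (hmu del g) del w hm_slope hmu_spec).
  lra.
- assert (A : Rabs (hmu del g w) <= del) by (apply Rabs_le; lra).
  assert (E := hE_pos g (hmu del g w) ltac:(lra)). assert (D := hDpos (hmu del g w) A).
  simpl. field. lra.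
Qed.

Lemma is_derive_rho w : Rabs w < wbar -> is_derive (rho del g) w (rho1 del g w).
Proof.
intros Hw. assert (H := is_derive_hmu w Hw). apply Rabs_def2 in Hw.
destruct (hmu_spec w) as [I _]; [lra |].
assert (A : Rabs (hmu del g w) <= del) by (apply Rabs_le; lra).
assert (E := hE_pos g (hmu del g w) ltac:(lra)). assert (D := hDpos (hmu del g w) A).
evar_last.
- apply (is_derive_comp (hT g) (hmu del g)); [| exact H].
  apply is_derive_hT. lra.
- unfold scal; simpl; unfold mult; simpl. unfold rho1. field. lra.
Qed.

Lemma is_derive_rho1 w : Rabs w < wbar -> is_derive (rho1 del g) w (rho2 del g w).
Proof.
intros Hw. assert (H := is_derive_hmu w Hw). apply Rabs_def2 in Hw.
destruct (hmu_spec w) as [I _]; [lra |].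
assert (A : Rabs (hmu del g w) <= del) by (apply Rabs_le; lra).
assert (E := hE_pos g (hmu del g w) ltac:(lra)). assert (D := hDpos (hmu del g w) A).
evar_last.
- apply (is_derive_comp (fun th => hN g th / hD g th) (hmu del g)); [| exact H].
  apply is_derive_hN_hD. lra.
- unfold scal; simpl; unfold mult; simpl. unfold rho2, hX. field. lra.
Qed.

End Profile.

Lemma hm_odd g th : hm g (- th) = - (sin th / hE g (- th)).
Proof. unfold hm. rewrite sin_neg. unfold Rdiv. ring. Qed.

(** The bound [hE_upper] gives a range of amplitudes common to all |g| <= K; the factor 2 makes the
    inequalities strict. *)
Lemma hm_range K g del : Rabs g <= K -> 0 < del <= 1 ->
  let wbar := sin del / (2 * (1 + exp (6 * K))) in
  0 < wbar /\ hm g (- del) < - wbar /\ wbar < hm g del.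
Proof.
intros Hg Hd wbar. assert (X := exp_pos (6 * K)). assert (P := PI2_3_2). unfold PI2 in P.
assert (S : 0 < sin del) by (apply sin_gt_0; lra).
assert (A : forall th, Rabs th <= 1 -> wbar < sin del / hE g th).
{ intros th Hth. assert (E := hE_pos g th Hth). assert (U := hE_upper K g th Hg Hth).
  unfold wbar, Rdiv. apply Rmult_lt_compat_l; [exact S |].
  apply Rinv_lt_contravar; nra. }
split; [apply Rdiv_lt_0_compat; lra |]. split.
- rewrite hm_odd. assert (B := A (- del)). rewrite Rabs_Ropp, Rabs_pos_eq in B by lra. lra.
- assert (B := A del). rewrite Rabs_pos_eq in B by lra. unfold hm. lra.
Qed.

(** At [eta], the values of [hm] at th - r and th + r enclose [w] strictly. They still do for nearby
    [g], so the preimage of [w] moves by less than [r], and joint continuity of [hT] concludes. *)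
Lemma rho_continuous_parameter del eta d1 w : 0 < del <= 1 -> 0 < d1 ->
  (forall g th, Rabs (g - eta) < d1 -> Rabs th <= del -> 0 < hD g th) ->
  (forall g, Rabs (g - eta) < d1 -> hm g (- del) < w < hm g del) ->
  forall eps, 0 < eps -> exists d, 0 < d /\ forall g, Rabs (g - eta) < d ->
    Rabs (rho del g w - rho del eta w) < eps.
Proof.
intros Hdel d10 HD Hw eps e0.
assert (He : Rabs (eta - eta) < d1) by (rewrite Rminus_diag, Rabs_R0; exact d10).
destruct (hmu_spec del eta Hdel (fun th => HD eta th He) w (Hw eta He)) as [I E].
set (th := hmu del eta w) in *.
assert (Eth := hE_pos eta th ltac:(apply Rabs_le; lra)).
destruct (continuity_2d_near hT eta th eps) as [d [d0 Hd]];
  [apply continuity_2d_hT; lra | exact e0 |].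
set (r := Rmin (d / 2) (Rmin (del - th) (th + del) / 2)).
assert (r1 := Rmin_l (d / 2) (Rmin (del - th) (th + del) / 2)).
assert (r2 := Rmin_r (d / 2) (Rmin (del - th) (th + del) / 2)).
assert (r3 := Rmin_l (del - th) (th + del)). assert (r4 := Rmin_r (del - th) (th + del)).
assert (r5 : 0 < Rmin (del - th) (th + del)) by (apply Rmin_glb_lt; lra).
assert (r0 : 0 < r) by (apply Rmin_glb_lt; lra). fold r in r1, r2.
assert (Inc := hm_increasing del eta Hdel (fun th => HD eta th He)).
assert (U : w < hm eta (th + r)) by (rewrite <- E; apply Inc; lra).
assert (V : hm eta (th - r) < w) by (rewrite <- E; apply Inc; lra).
assert (EU := hE_pos eta (th + r) ltac:(apply Rabs_le; lra)).
assert (EV := hE_pos eta (th - r) ltac:(apply Rabs_le; lra)).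
destruct (continuity_2d_near hm eta (th + r) (hm eta (th + r) - w)) as [du [du0 Hu]];
  [apply continuity_2d_hm; lra | lra |].
destruct (continuity_2d_near hm eta (th - r) (w - hm eta (th - r))) as [dv [dv0 Hv]];
  [apply continuity_2d_hm; lra | lra |].
exists (Rmin (Rmin d d1) (Rmin du dv)). split; [repeat apply Rmin_glb_lt; lra |].
intros g Hg.
assert (M1 := Rmin_l (Rmin d d1) (Rmin du dv)). assert (M2 := Rmin_r (Rmin d d1) (Rmin du dv)).
assert (M3 := Rmin_l d d1). assert (M4 := Rmin_r d d1).
assert (M5 := Rmin_l du dv). assert (M6 := Rmin_r du dv).
specialize (Hu g (th + r) ltac:(lra)). rewrite Rminus_diag, Rabs_R0 in Hu.
specialize (Hu ltac:(lra)). apply Rabs_def2 in Hu.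
specialize (Hv g (th - r) ltac:(lra)). rewrite Rminus_diag, Rabs_R0 in Hv.
specialize (Hv ltac:(lra)). apply Rabs_def2 in Hv.
assert (Hg1 : Rabs (g - eta) < d1) by lra.
destruct (hmu_spec del g Hdel (fun th => HD g th Hg1) w (Hw g Hg1)) as [I' E'].
assert (Inc' := hm_increasing del g Hdel (fun th => HD g th Hg1)).
unfold rho. fold th. apply Hd; [lra |].
set (x := hmu del g w) in *.
assert (Rabs (x - th) < r); [| lra]. apply Rabs_def1; apply Rnot_le_lt; intros N.
- assert (hm g (th + r) <= hm g x); [| lra].
  destruct (Req_dec (th + r) x) as [-> | n]; [lra |]. apply Rlt_le, Inc'; lra.
- assert (hm g x <= hm g (th - r)); [| lra].
  destruct (Req_dec x (th - r)) as [-> | n]; [lra |]. apply Rlt_le, Inc'; lra.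
Qed.

(** At both angles 0 and [g = eta] the expression is s (a' ^ 2 - a ^ 2) [hX eta 0], negative because
    [hX eta 0] has the sign of [eta]; joint continuity extends the sign. *)
Lemma uniform_concavity eta s a a' : 0 < s * eta -> a' ^ 2 < a ^ 2 ->
  exists del d, 0 < del <= 1 /\ 0 < d <= 1 /\
    forall g, Rabs (g - eta) < d -> forall th th', Rabs th <= del -> Rabs th' <= del ->
      0 < hD g th /\ s * (a' ^ 2 * hX eta th' - a ^ 2 * hX g th) < 0.
Proof.
intros Hs Ha. set (L := hX eta 0).
assert (D0 : 0 < hD eta 0).
{ rewrite hD_0. assert (C := cosh_ge_1 (eta * PI)). lra. }
assert (L0 : 0 < s * L).
{ unfold L. rewrite hX_0. assert (P0 := PI_RGT_0). assert (E2 := pow2_ge_0 eta).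
  assert (0 < s * sinh (eta * PI)); [| nra].
  destruct (Rtotal_order eta 0) as [h | [-> | h]]; [| lra |].
  - assert (sinh (- (eta * PI)) = - sinh (eta * PI)).
    { unfold sinh. rewrite Ropp_involutive. field. }
    assert (0 < sinh (- (eta * PI))) by (apply sinh_pos; nra). nra.
  - assert (0 < sinh (eta * PI)) by (apply sinh_pos; nra). nra. }
set (k := (a ^ 2 - a' ^ 2) * (s * L)).
assert (k0 : 0 < k) by (unfold k; nra).
(* An error [eps] in each value of [hX] changes the expression by at most (a ^ 2 + a' ^ 2) |s| eps,
   less than the gap [k]. *)
set (eps := k / (2 * (a ^ 2 + a' ^ 2 + 1) * (Rabs s + 1))).
assert (s0 := Rabs_pos s). assert (a0 := pow2_ge_0 a). assert (a0' := pow2_ge_0 a').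
assert (W0 : 0 < 2 * (a ^ 2 + a' ^ 2 + 1) * (Rabs s + 1)) by (apply Rmult_lt_0_compat; lra).
assert (eps0 : 0 < eps) by (apply Rdiv_lt_0_compat; assumption).
assert (Ek : eps * (2 * (a ^ 2 + a' ^ 2 + 1) * (Rabs s + 1)) = k) by (unfold eps; field; lra).
destruct (continuity_2d_near hX eta 0 eps) as [d1 [d10 H1]];
  [apply continuity_2d_hX; lra | exact eps0 |].
destruct (continuity_2d_near hD eta 0 (hD eta 0)) as [d2 [d20 H2]];
  [apply continuity_2d_hD | exact D0 |].
set (d := Rmin (Rmin d1 d2) 1).
assert (M1 := Rmin_l (Rmin d1 d2) 1). assert (M2 := Rmin_r (Rmin d1 d2) 1).
assert (M3 := Rmin_l d1 d2). assert (M4 := Rmin_r d1 d2).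
assert (d0 : 0 < d) by (repeat apply Rmin_glb_lt; lra). fold d in M1, M2.
exists (d / 2), d. split; [lra |]. split; [lra |].
intros g Hg th th' Hth Hth'.
assert (He : Rabs (eta - eta) < d1) by (rewrite Rminus_diag, Rabs_R0; exact d10).
assert (A1 := H1 g th ltac:(lra)). rewrite Rminus_0_r in A1. specialize (A1 ltac:(lra)).
assert (A2 := H1 eta th' He). rewrite Rminus_0_r in A2. specialize (A2 ltac:(lra)).
assert (A3 := H2 g th ltac:(lra)). rewrite Rminus_0_r in A3. specialize (A3 ltac:(lra)).
fold L in A1, A2. apply Rabs_def2 in A3. split; [lra |].
assert (B : forall x, Rabs (x - L) < eps -> Rabs (s * (x - L)) <= Rabs s * eps).
{ intros x Hx. rewrite Rabs_mult. apply Rmult_le_compat_l; lra. }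
assert (B1 := B _ A1). assert (B2 := B _ A2).
apply Rabs_le_between in B1. apply Rabs_le_between in B2.
replace (s * (a' ^ 2 * hX eta th' - a ^ 2 * hX g th)) with
  (a' ^ 2 * (s * (hX eta th' - L)) - a ^ 2 * (s * (hX g th - L)) - k) by (unfold k; ring).
set (x := s * (hX eta th' - L)) in *. set (y := s * (hX g th - L)) in *.
assert (a' ^ 2 * x <= a' ^ 2 * (Rabs s * eps)) by (apply Rmult_le_compat_l; lra).
assert (a ^ 2 * - y <= a ^ 2 * (Rabs s * eps)) by (apply Rmult_le_compat_l; lra).
rewrite <- Ek. nra.
Qed.

(** The equation [F w = 0], with [a'] in the role of [xi], stated through the two angles so that the
    inverse function does not occur. *)
Definition amplitude_root (del g eta a a' c w : R) : Prop :=
  exists th th', - del < th < del /\ - del < th' < del /\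
    hm g th = a * w /\ hm eta th' = a' * w /\ hT g th + c * w = hT eta th'.

(** The order of quantifiers matters: [del] and [w0] are independent of [wb], since [wb] will itself
    depend on them and on the required size of the cycles. The sign [s] of [eta] turns both cases
    into a concave function. *)
Lemma two_amplitudes eta a a' : eta <> 0 -> a' ^ 2 < a ^ 2 ->
  exists del w0, 0 < del <= 1 /\ 0 < w0 /\ forall wb e, 0 < wb <= w0 -> 0 < e ->
    exists g c w1 w2, Rabs (g - eta) < e /\ Rabs (c - eta * (a' - a)) < e /\
      0 < w1 < w2 /\ w2 < wb /\
      amplitude_root del g eta a a' c w1 /\ amplitude_root del g eta a a' c w2 /\
      (forall w, 0 < w <= w0 -> amplitude_root del g eta a a' c w -> w = w1 \/ w = w2) /\
      (forall x y, - del < x < del -> - del < y < del -> hm g x = hm g y -> x = y).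
Proof.
intros Heta Ha.
assert (Hs : exists s, s * s = 1 /\ Rabs s = 1 /\ 0 < s * eta).
{ destruct (Rtotal_order eta 0) as [h | [h | h]]; [| contradiction |].
  - exists (-1). rewrite Rabs_left by lra. lra.
  - exists 1. rewrite Rabs_pos_eq by lra. lra. }
destruct Hs as [s [Hss [Hs1 Hs]]].
destruct (uniform_concavity eta s a a' Hs Ha) as [del [d [Hdel [Hd HX]]]].
set (K := Rabs eta + 1).
assert (HK : forall g, Rabs (g - eta) < d -> Rabs g <= K).
{ intros g Hg. replace g with (g - eta + eta) by ring.
  eapply Rle_trans; [apply Rabs_triang |]. unfold K. lra. }
set (wbar := sin del / (2 * (1 + exp (6 * K)))).
assert (Hw : forall g, Rabs (g - eta) < d ->
  0 < wbar /\ hm g (- del) < - wbar /\ wbar < hm g del).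
{ intros g Hg. exact (hm_range K g del (HK g Hg) Hdel). }
assert (He : Rabs (eta - eta) < d) by (rewrite Rminus_diag, Rabs_R0; lra).
assert (wb0 : 0 < wbar) by apply (Hw eta He).
assert (HD : forall g th, Rabs (g - eta) < d -> Rabs th <= del -> 0 < hD g th).
{ intros g th Hg Hth. apply (HX g Hg th th Hth Hth). }
set (Z := 2 * (Rabs a + Rabs a' + 1)).
assert (a0 := Rabs_pos a). assert (a0' := Rabs_pos a').
assert (Z0 : 0 < Z) by (unfold Z; lra).
set (w0 := wbar / Z).
assert (w00 : 0 < w0) by (apply Rdiv_lt_0_compat; assumption).
assert (HZ : w0 * Z = wbar) by (unfold w0; field; lra).
assert (Bw : forall w, 0 <= w <= w0 -> Rabs (a * w) < wbar /\ Rabs (a' * w) < wbar).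
{ intros w Hw'. rewrite !Rabs_mult, (Rabs_pos_eq w) by lra. unfold Z in HZ. split; nra. }
exists del, w0. split; [exact Hdel |]. split; [exact w00 |].
intros wb e Hwb e0.
(* A zero of [F] with [c = s * l'] is a point where [A g w = l' * w], because s * s = 1. *)
set (A := fun g w => s * (rho del eta (a' * w) - rho del g (a * w))).
set (A1 := fun g w => s * (a' * rho1 del eta (a' * w) - a * rho1 del g (a * w))).
set (A2 := fun g w => s * (a' ^ 2 * rho2 del eta (a' * w) - a ^ 2 * rho2 del g (a * w))).
assert (Dlin : forall (f f1 : R -> R) k w, is_derive f (k * w) (f1 (k * w)) ->
  is_derive (fun w => f (k * w)) w (k * f1 (k * w))).
{ intros f f1 k w H. evar_last.
  - apply (is_derive_comp f (fun w => k * w)); [exact H |].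
    apply is_derive_scal. apply is_derive_Reals, derivable_pt_lim_id.
  - unfold scal; simpl; unfold mult; simpl. ring. }
assert (HA : forall g w, Rabs (g - eta) < d -> 0 <= w <= w0 ->
  is_derive (A g) w (A1 g w) /\ is_derive (A1 g) w (A2 g w) /\ A2 g w < 0).
{ intros g w Hg Hw'. destruct (Bw w Hw') as [Ba Ba'].
  split; [| split].
  - unfold A, A1. apply is_derive_scal.
    apply (is_derive_minus (V := R_NormedModule)).
    + apply (Dlin (rho del eta) (rho1 del eta)), (is_derive_rho del eta wbar Hdel); auto.
      apply (Hw eta He).
    + apply (Dlin (rho del g) (rho1 del g)), (is_derive_rho del g wbar Hdel); auto.
      apply (Hw g Hg).
  - unfold A1, A2. apply is_derive_scal.
    apply (is_derive_minus (V := R_NormedModule)).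
    + replace (a' ^ 2 * rho2 del eta (a' * w)) with (a' * (a' * rho2 del eta (a' * w))) by ring.
      apply is_derive_scal.
      apply (Dlin (rho1 del eta) (rho2 del eta)), (is_derive_rho1 del eta wbar Hdel); auto.
      apply (Hw eta He).
    + replace (a ^ 2 * rho2 del g (a * w)) with (a * (a * rho2 del g (a * w))) by ring.
      apply is_derive_scal.
      apply (Dlin (rho1 del g) (rho2 del g)), (is_derive_rho1 del g wbar Hdel); auto.
      apply (Hw g Hg).
  - unfold A2, rho2. apply HX; [exact Hg | |].
    + destruct (hmu_spec del g Hdel (fun th => HD g th Hg) (a * w)) as [I _].
      { apply Rabs_def2 in Ba. assert (X := Hw g Hg). lra. }
      apply Rabs_le. lra.
    + destruct (hmu_spec del eta Hdel (fun th => HD eta th He) (a' * w)) as [I _].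
      { apply Rabs_def2 in Ba'. assert (X := Hw eta He). lra. }
      apply Rabs_le. lra. }
assert (M0 : forall g, Rabs (g - eta) < d -> hmu del g 0 = 0).
{ intros g Hg. apply (hmu_0 del g Hdel). intros th. now apply HD. }
assert (D0 : 0 < hD eta 0) by (apply HD; [exact He | rewrite Rabs_R0; lra]).
destruct (bifurcation_of_two_zeros A A1 A2 eta (s * (eta * (a' - a))) d w0 wb e)
  as [g [l' [w1 [w2 [Hg1 [Hg2 [Hl [Hw12 [Hw2 [E1 [E2 Hu]]]]]]]]]]]; try lra.
- exact HA.
- unfold A. rewrite !Rmult_0_r. ring.
- unfold A1, rho1. rewrite !Rmult_0_r, (M0 eta He), hN_0. field. lra.
- intros w eps Hw' eps0. destruct (Bw w Hw') as [Ba Ba'].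
  destruct (rho_continuous_parameter del eta d (a * w) Hdel ltac:(lra) HD) with (eps := eps)
    as [d' [d0' Hd']].
  + intros g Hg. apply Rabs_def2 in Ba. assert (X := Hw g Hg). lra.
  + exact eps0.
  + exists d'. split; [exact d0' |]. intros g Hg. unfold A.
    replace (_ - _) with (- (s * (rho del g (a * w) - rho del eta (a * w)))) by ring.
    rewrite Rabs_Ropp, Rabs_mult, Hs1, Rmult_1_l. now apply Hd'.
- intros d' d0'. set (r := Rmin (d / 2) (d' / 2)).
  assert (r1 := Rmin_l (d / 2) (d' / 2)). assert (r2 := Rmin_r (d / 2) (d' / 2)).
  assert (r0 : 0 < r) by (apply Rmin_glb_lt; lra). fold r in r1, r2.
  assert (Hr : Rabs (eta + s * r - eta) = r).
  { replace (eta + s * r - eta) with (s * r) by ring.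
    rewrite Rabs_mult, Hs1, Rabs_pos_eq; lra. }
  (* Moving [g] in the direction of the sign of [eta] makes s (hT eta 0 - hT g 0) negative, as [hT]
     at 0 increases in [g]. *)
  exists (eta + s * r). rewrite Hr. split; [lra |].
  unfold A, rho. rewrite !Rmult_0_r, !M0 by (rewrite ?Hr; lra).
  destruct (Rle_or_lt 0 s) as [h | h].
  + assert (s = 1) by (rewrite Rabs_pos_eq in Hs1; lra). subst s.
    assert (B := hT_0_increasing eta (eta + 1 * r)). lra.
  + assert (s = -1) by (rewrite Rabs_left in Hs1; lra). subst s.
    assert (B := hT_0_increasing (eta + -1 * r) eta). lra.
- assert (Conv : forall w, 0 < w <= w0 ->
    (A g w = l' * w <-> amplitude_root del g eta a a' (s * l') w)).
  { intros w Hw'. destruct (Bw w ltac:(lra)) as [Ba Ba'].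
    apply Rabs_def2 in Ba. apply Rabs_def2 in Ba'.
    assert (X := Hw g Hg1). assert (X' := Hw eta He).
    destruct (hmu_spec del g Hdel (fun th => HD g th Hg1) (a * w)) as [I E]; [lra |].
    destruct (hmu_spec del eta Hdel (fun th => HD eta th He) (a' * w)) as [I' E']; [lra |].
    unfold A, rho. split.
    - intros Eq. exists (hmu del g (a * w)), (hmu del eta (a' * w)).
      repeat split; try lra.
      replace (s * l' * w) with (s * (l' * w)) by ring. rewrite <- Eq.
      rewrite <- Rmult_assoc, Hss. ring.
    - intros [th [th' [J [J' [F [F' Eq]]]]]].
      assert (th = hmu del g (a * w)).
      { apply (hm_injective del g Hdel (fun th => HD g th Hg1)); try assumption. now rewrite E. }
      assert (th' = hmu del eta (a' * w)).
      { apply (hm_injective del eta Hdel (fun th => HD eta th He)); try assumption. now rewrite E'. }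
      subst th th'. rewrite <- Eq.
      transitivity (s * s * (l' * w)); [ring | rewrite Hss; ring]. }
  exists g, (s * l'), w1, w2.
  split; [exact Hg2 |]. split.
  { replace (s * l' - eta * (a' - a)) with (s * (l' - s * (eta * (a' - a)))).
    - rewrite Rabs_mult, Hs1, Rmult_1_l. exact Hl.
    - transitivity (s * l' - s * s * (eta * (a' - a))); [ring | rewrite Hss; ring]. }
  split; [exact Hw12 |]. split; [exact Hw2 |].
  split; [apply Conv; [lra | exact E1] |]. split; [apply Conv; [lra | exact E2] |].
  split.
  + intros w Hw' Hr. apply Hu; [exact Hw' |]. now apply Conv.
  + exact (hm_injective del g Hdel (fun th => HD g th Hg1)).
Qed.

(** * Limit cycles *)

Definition on_lower_axis (p : point) : Prop := fst p = 0 /\ snd p < 0.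

(** Each half turn reverses the order of ordinates on x = 0, so two of them preserve it. *)
Lemma full_turn_increasing K P y y1 y2 tau tau' x x1 x2 t t' : params_bounded K P ->
  far K y y1 -> far K x x1 -> full_turn P y y1 y2 tau tau' ->
  full_turn P x x1 x2 t t' -> x < y -> x2 < y2.
Proof.
intros HP [Hy Hy1] [Hx Hx1] [F1 F2] [G1 G2] H.
assert (A := half_turn_increasing K P y x y1 x1 tau t HP Hy H F1 G1).
assert (B := half_turn_increasing K (rot P) (- y1) (- x1) (- y2) (- x2) tau' t'
  (bounded_rot K P HP) ltac:(lra) ltac:(lra) F2 G2). lra.
Qed.

(** By [half_lower] the value [p] is positive, which puts [y1] above - K * K - K and hence above
    [- reach K]; a large modulus then forces the positive sign. *)
Lemma half_turn_end_far K P y y1 tau : params_bounded K P -> y <= - reach K ->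
  half_turn P y y1 tau -> reach K <= Rabs y1 -> reach K <= y1.
Proof.
intros HP Hy Ht H. assert (T := reach_threshold K P y HP Hy).
assert (K0 := bounded_pos K P HP). assert (T0 := threshold_pos K ltac:(lra)).
assert (A := half_lower K _ _ _ _ _ (proj1 (proj2 (proj1 HP))) (proj2 (proj2 HP))
  ltac:(apply Rle_trans with (threshold K); [lra | exact T]) Ht).
assert (X := exp_pos (6 * K)).
assert (0 < (gammaR P * xR P + bpar P - y) / (2 * (exp (6 * K) + 1)))
  by (apply Rdiv_lt_0_compat; lra).
assert (B := bounded_shift K P HP). apply Rabs_le_between in B.
unfold reach in *. destruct (Rle_or_lt 0 y1) as [h | h].
- rewrite Rabs_pos_eq in H by exact h. exact H.
- rewrite Rabs_left in H by exact h. nra.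
Qed.

Lemma pdist_axis y : pdist (0, y) (0, 0) = Rabs y.
Proof.
destruct (pdist_ge (0, y)) as [_ A]. assert (B := pdist_le (0, y)).
simpl in *. rewrite Rabs_R0 in B. lra.
Qed.

(** Staying outside the disc of radius [reach K] keeps both ends of each half turn far, so the turn
    can be completed. The lower bound 4 on its duration lets an induction over turns reach any given
    time. *)
Lemma far_solution_returns K P z t y : params_bounded K P -> solution P z ->
  (forall s, reach K <= pdist (z s) (0, 0)) -> z t = (0, y) -> y < 0 ->
  exists y1 y2 tau tau', full_turn P y y1 y2 tau tau' /\ far K y y1 /\
    z (t + (tau + tau')) = (0, y2) /\ y2 < 0 /\ 4 <= tau + tau' /\
    forall s, t < s < t + (tau + tau') -> ~ on_lower_axis (z s).
Proof.
intros HP Hz Hfar E Hy.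
assert (R := reach_big K (bounded_pos K P HP)).
assert (Hy' : y <= - reach K).
{ assert (A := Hfar t). rewrite E, pdist_axis, Rabs_left in A by lra. lra. }
destruct (half_turn_exists K P y HP Hy') as [y1 [tau H1]].
assert (T1 := half_time _ _ _ _ _ H1).
assert (E1 : z (t + tau) = (0, y1)).
{ rewrite (solution_half_turn K P z t y y1 tau HP Hz E Hy' H1) by lra.
  apply half_turn_end; [apply HP | exact H1]. }
assert (Hy1 : reach K <= y1).
{ apply (half_turn_end_far K P y y1 tau HP Hy' H1).
  rewrite <- pdist_axis, <- E1. apply Hfar. }
destruct (half_turn_exists K (rot P) (- y1) (bounded_rot K P HP)) as [y2' [tau' H2]]; [lra |].
assert (T2 := half_time _ _ _ _ _ H2).
assert (F : full_turn P y y1 (- y2') tau tau').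
{ split; [exact H1 |]. rewrite Ropp_involutive. exact H2. }
destruct (solution_full_turn K P z t y y1 (- y2') tau tau' HP Hz E (conj Hy' Hy1) F)
  as [Z1 [Z2 [_ Z3]]].
destruct (full_turn_signs K P y y1 (- y2') tau tau' HP (conj Hy' Hy1) F) as [S1 S2].
exists y1, (- y2'), tau, tau'. split; [exact F |]. split; [split; assumption |].
split; [exact Z3 |]. split; [| split; [lra |]].
- assert (B : reach K <= y2'); [| lra].
  apply (half_turn_end_far K (rot P) (- y1) y2' tau' (bounded_rot K P HP) ltac:(lra) H2).
  rewrite <- (Rabs_Ropp y2'), <- pdist_axis, <- Z3. apply Hfar.
- intros s Hs [N1 N2]. destruct (Rtotal_order s (t + tau)) as [h | [h | h]].
  + replace s with (t + (s - t)) in N1 by ring. rewrite Z1 in N1 by lra.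
    assert (A := S1 (s - t)). lra.
  + subst s. rewrite E1 in N2. simpl in N2. lra.
  + replace s with (t + tau + (s - t - tau)) in N1 by ring. rewrite Z2 in N1 by lra.
    assert (A := S2 (s - t - tau)). lra.
Qed.

(* The return map to the lower axis is increasing, so an orbit whose first
   return is not its starting point moves away from it monotonically and
   cannot be periodic. *)
Lemma far_periodic_closed K P z t0 y : params_bounded K P -> solution P z ->
  periodic z -> (forall s, reach K <= pdist (z s) (0, 0)) ->
  z t0 = (0, y) -> y < 0 ->
  exists y1 tau tau', full_turn P y y1 y tau tau' /\ far K y y1.
Proof.
intros HP Hz [[T [T0 HT]] _] Hfar E Hy.
destruct (far_solution_returns K P z t0 y HP Hz Hfar E Hy)
  as [y1 [y2 [tau [tau' [F [Fr [E2 [Hy2 [T4 No]]]]]]]]].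
destruct (Req_dec y2 y) as [-> | n]; [exists y1, tau, tau'; split; assumption |].
exfalso.
(* From the first return on, every passage through the lower axis stays on the side of [y] on which
   [y2] lies, at least as far from [y]; [n] counts time in units of 4. *)
assert (Drift : forall n t yt, z t = (0, yt) -> yt < 0 ->
  (y < y2 /\ y2 <= yt \/ y2 < y /\ yt <= y2) ->
  forall s, t <= s <= t + 4 * INR n -> on_lower_axis (z s) -> snd (z s) <> y).
{ induction n0 as [| m IH]; intros t yt Et Hyt Hc s Hs Hax.
  - simpl in Hs. assert (s = t) by lra. subst s. rewrite Et. simpl. lra.
  - rewrite S_INR in Hs.
    destruct (far_solution_returns K P z t yt HP Hz Hfar Et Hyt)
      as [x1 [x2 [u [u' [G [Gr [Ex [Hx2 [U4 Nx]]]]]]]]].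
    destruct (Rtotal_order s t) as [h | [h | h]]; [lra | |].
    + subst s. rewrite Et. simpl. lra.
    + destruct (Rlt_or_le s (t + (u + u'))) as [h' | h'].
      * exfalso. exact (Nx s (conj h h') Hax).
      * apply (IH (t + (u + u')) x2 Ex Hx2); [| lra | exact Hax].
        destruct Hc as [Hc | Hc]; [left | right]; (split; [apply Hc |]); apply Rlt_le.
        -- apply (full_turn_increasing K P _ _ _ _ _ _ _ _ _ _ HP Gr Fr G F). lra.
        -- apply (full_turn_increasing K P _ _ _ _ _ _ _ _ _ _ HP Fr Gr F G). lra. }
assert (ET : z (t0 + T) = (0, y)) by (rewrite HT; exact E).
assert (AT : on_lower_axis (z (t0 + T))) by (rewrite ET; split; simpl; lra).
destruct (Rtotal_order T (tau + tau')) as [h | [h | h]].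
- apply (No (t0 + T)); [lra | exact AT].
- subst T. rewrite E2 in ET. injection ET as ET. contradiction.
- destruct (archimedean_nat 4 T) as [m Hm]; [lra |].
  apply (Drift m (t0 + (tau + tau')) y2 E2 Hy2) with (s := t0 + T); [lra | lra | exact AT |].
  now rewrite ET.
Qed.

Lemma cycle_curve_on_axis K P y y1 tau tau' c : params_bounded K P -> far K y y1 ->
  full_turn P y y1 y tau tau' -> cycle_curve P y y1 tau tau' c ->
  forall p, orbit c p -> fst p = 0 -> p = (0, y) \/ p = (0, y1).
Proof.
intros HP Hfar Hf Hc p [t <-] Hp.
assert (T1 := half_time _ _ _ _ _ (proj1 Hf)). assert (T2 := half_time _ _ _ _ _ (proj2 Hf)).
destruct (full_turn_signs K P y y1 y tau tau' HP Hfar Hf) as [S1 S2].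
destruct (cycle_curve_start P y y1 y tau tau' c Hf ltac:(apply HP) Hc) as [C0 C1].
destruct Hc as [Cp [CR CL]].
destruct (proj1 (periodic_representative (tau + tau') t ltac:(lra))) as [k [s [Hs Et]]].
assert (Ec : c t = c s) by (rewrite Et; now apply periodic_Z).
rewrite Ec in *.
destruct (Req_dec s 0) as [-> | n0]; [left; exact C0 |].
destruct (Rtotal_order s tau) as [h | [h | h]].
- exfalso. rewrite CR in Hp by lra. assert (A := S1 s). lra.
- subst s. right. exact C1.
- exfalso. replace s with (tau + (s - tau)) in Hp by ring. rewrite CL in Hp by lra.
  assert (A := S2 (s - tau)). lra.
Qed.

Lemma cycle_curve_norm K N : 0 < K -> exists r, forall P y y1 y2 tau tau' c,
  params_bounded K P -> full_turn P y y1 y2 tau tau' ->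
  cycle_curve P y y1 tau tau' c -> y <= - r -> r <= y1 ->
  forall t, N <= pdist (c t) (0, 0).
Proof.
intros K0. destruct (flow_norm_lower K N K0) as [r H].
exists r. intros P y y1 y2 tau tau' c HP Hf [Cp [CR CL]] Hy Hy1 t.
assert (T1 := half_time _ _ _ _ _ (proj1 Hf)). assert (T2 := half_time _ _ _ _ _ (proj2 Hf)).
destruct (proj1 (periodic_representative (tau + tau') t ltac:(lra))) as [k [s [Hs Et]]].
assert (Ec : c t = c s) by (rewrite Et; now apply periodic_Z).
rewrite Ec. destruct (Rle_or_lt s tau) as [h | h].
- rewrite CR by lra. apply H; [exact HP | exact Hy | lra].
- replace s with (tau + (s - tau)) by ring. rewrite CL by lra.
  unfold flowL. rewrite flip_axis.
  replace (pdist (flip (flowR (rot P) (0, - y1) (s - tau))) (0, 0))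
    with (pdist (flowR (rot P) (0, - y1) (s - tau)) (0, 0)).
  + apply H; [now apply bounded_rot | lra | lra].
  + unfold pdist, dist_euc, flip. cbn [fst snd]. f_equal. unfold Rsqr. ring.
Qed.

(** By periodicity the distance to the orbit is a minimum of a continuous function over one closed
    period, so it is attained and cannot be 0. *)
Lemma orbit_distance_pos P z T p : solution P z -> 0 < T ->
  (forall t, z (t + T) = z t) -> ~ orbit z p ->
  exists d, 0 < d /\ forall q, orbit z q -> d <= pdist p q.
Proof.
intros Hz T0 HT Hp.
assert (Cd : forall t, continuity_pt (fun t => pdist p (z t)) t).
{ intros t. destruct (solution_continuous P z t Hz) as [C1 C2].
  apply continuity_pt_filterlim in C1. apply continuity_pt_filterlim in C2.
  unfold pdist, dist_euc.
  apply (continuity_pt_comp (fun t => Rsqr (fst p - fst (z t)) + Rsqr (snd p - snd (z t))) sqrt).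
  - apply (continuity_pt_plus (fun t => Rsqr (fst p - fst (z t)))
      (fun t => Rsqr (snd p - snd (z t)))).
    + apply (continuity_pt_comp (fun t => fst p - fst (z t)) Rsqr).
      * apply (continuity_pt_minus (fun _ => fst p)); [| exact C1].
        apply continuity_pt_const. intros ? ?. reflexivity.
      * apply derivable_continuous_pt, derivable_pt_Rsqr.
    + apply (continuity_pt_comp (fun t => snd p - snd (z t)) Rsqr).
      * apply (continuity_pt_minus (fun _ => snd p)); [| exact C2].
        apply continuity_pt_const. intros ? ?. reflexivity.
      * apply derivable_continuous_pt, derivable_pt_Rsqr.
  - apply continuity_pt_sqrt.
    assert (A := Rle_0_sqr (fst p - fst (z t))). assert (B := Rle_0_sqr (snd p - snd (z t))).
    lra. }
destruct (continuity_ab_min (fun t => pdist p (z t)) 0 T) as [m [Hm Im]];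
  [lra | intros; apply Cd |].
exists (pdist p (z m)). split.
- assert (D0 : 0 <= pdist p (z m)) by apply sqrt_pos.
  destruct (Rle_lt_or_eq_dec _ _ D0) as [h | h]; [exact h |].
  exfalso. apply Hp. exists m. symmetry in h.
  unfold pdist, dist_euc in h.
  assert (A := Rle_0_sqr (fst p - fst (z m))). assert (B := Rle_0_sqr (snd p - snd (z m))).
  apply sqrt_eq_0 in h; [| lra].
  assert (Z1 : fst p - fst (z m) = 0) by (apply Rsqr_0_uniq; lra).
  assert (Z2 : snd p - snd (z m) = 0) by (apply Rsqr_0_uniq; lra).
  apply injective_projections; lra.
- intros q [t <-].
  destruct (proj1 (periodic_representative T t T0)) as [k [s [Hs Et]]].
  rewrite Et, (periodic_Z z T HT). apply Hm. lra.
Qed.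

Lemma pdist_triangle p q : pdist q (0, 0) <= pdist p q + pdist p (0, 0).
Proof.
assert (A := triangle (fst q) (snd q) 0 0 (fst p) (snd p)).
unfold pdist. simpl. rewrite (distance_symm (fst p) (snd p) (fst q) (snd q)). exact A.
Qed.

(* If the far cycles are exactly the two through [(0, y)] and [(0, x)], then a
   periodic orbit near the first one is far, hence one of the two. *)
Lemma limit_cycle_of_cycle K P y y1 tau tau' c x r N : params_bounded K P ->
  solution P c -> far K y y1 -> full_turn P y y1 y tau tau' ->
  cycle_curve P y y1 tau tau' c ->
  (forall z t, solution P z -> r < pdist (z t) (0, 0) ->
     exists s v, z s = (0, v) /\ v <= - N) ->
  0 < N -> (forall t, Rmax r (reach K) + 1 < pdist (c t) (0, 0)) ->
  x < 0 -> x <> y ->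
  (forall v v1 s s', v <= - N -> far K v v1 -> full_turn P v v1 v s s' -> v = y \/ v = x) ->
  limit_cycle P (orbit c).
Proof.
intros HP Hc Hfar Hf Hcc Hhit N0 Hnorm x0 xy Huniq.
assert (R := reach_big K (bounded_pos K P HP)).
assert (T1 := half_time _ _ _ _ _ (proj1 Hf)). assert (T2 := half_time _ _ _ _ _ (proj2 Hf)).
destruct (cycle_curve_start P y y1 y tau tau' c Hf ltac:(apply HP) Hcc) as [C0 C1].
assert (Axis := cycle_curve_on_axis K P y y1 tau tau' c HP Hfar Hf Hcc).
split; [split; [| split] |].
- exists c. split; [exact Hc |]. split; [| intros p; reflexivity].
  apply (cycle_periodic K P y y1 tau tau' c c 0 HP Hfar Hf Hcc).
  intros t. now rewrite Rminus_0_r.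
- exists (0, y). split; [exists 0; exact C0 | reflexivity].
- intros p Hp Hx.
  assert (B : Rabs (bpar P) <= K) by apply HP. apply Rabs_le_between in B.
  destruct Hfar as [Hy Hy1].
  (* At (0, v) the product of the two horizontal velocities is v ^ 2 - b ^ 2, positive beyond
     |b|. *)
  destruct (Axis p Hp Hx) as [-> | ->]; (split; [reflexivity |]);
    unfold fieldL, fieldR; simpl; nra.
- destruct (orbit_distance_pos P c (tau + tau') (0, x)) as [d [d0 Hd]];
    [exact Hc | lra | apply Hcc | |].
  { intros Ho. destruct Hfar as [Hy Hy1].
    destruct (Axis _ Ho eq_refl) as [E | E]; injection E as E; lra. }
  (* Closeness below 1 keeps a neighbouring orbit in the far region, by the margin in [Hnorm];
     closeness below [d] excludes the cycle through (0, x). *)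
  exists (Rmin d 1). split; [apply Rmin_glb_lt; lra |].
  intros H [z [Hz [Hper HH]]] Hnear.
  assert (Hfarz : forall s, Rmax r (reach K) < pdist (z s) (0, 0)).
  { intros s. destruct (Hnear (z s)) as [q [[t <-] Hq]].
    - apply HH. now exists s.
    - assert (A := pdist_triangle (z s) (c t)). assert (M := Rmin_r d 1).
      specialize (Hnorm t). lra. }
  assert (M1 := Rmax_l r (reach K)). assert (M2 := Rmax_r r (reach K)).
  destruct (Hhit z 0 Hz) as [s [v [Es Hv]]]; [specialize (Hfarz 0); lra |].
  destruct (far_periodic_closed K P z s v HP Hz Hper) as [v1 [u [u' [G Gr]]]];
    [intros k; specialize (Hfarz k); lra | exact Es | lra |].
  destruct (Huniq v v1 u u' Hv Gr G) as [-> | ->].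
  + assert (Ez := solution_cycle K P z s y y1 tau tau' c HP Hz Es Hfar Hf Hcc).
    intros p. rewrite (HH p). split; intros [t <-].
    * exists (t - s). symmetry. apply Ez.
    * exists (t + s). rewrite Ez. f_equal. ring.
  + exfalso. destruct (Hnear (z s)) as [q [Hq1 Hq2]].
    * apply HH. now exists s.
    * specialize (Hd q Hq1). rewrite Es in Hq2. assert (M := Rmin_l d 1). lra.
Qed.

(** * Passage between cycles and roots of the amplitude equation *)

Lemma exp_minus_cosh_sinh x : exp (- x) = cosh x - sinh x.
Proof. unfold cosh, sinh. field. Qed.

Lemma exp_cosh_sinh x : exp x = cosh x + sinh x.
Proof. unfold cosh, sinh. field. Qed.

(** The sum and the difference of the two equations of [half], with exponentials split into cosh and
    sinh. Since s + p = y1 - y for a half turn, the factor of [a] is the amplitude [w]. *)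
Lemma half_profile g a s p tau : a <> 0 -> 0 < s + p -> Rabs (tau - PI) <= 1 ->
  half g a s p tau ->
  hm g (tau - PI) = a * (2 / (s + p)) /\ hT g (tau - PI) = (p - s) / (s + p).
Proof.
intros a0 Hsp Hth [_ [H1 H2]].
assert (E := hE_pos g (tau - PI) Hth).
set (th := tau - PI) in *. assert (Et : tau = th + PI) by (unfold th; ring).
rewrite Et in H1, H2. rewrite neg_sin, neg_cos in H1, H2.
replace (- g * (th + PI)) with (- (g * (PI + th))) in H1 by ring.
replace (g * (th + PI)) with (g * (PI + th)) in H2 by ring.
rewrite exp_minus_cosh_sinh in H1. rewrite exp_cosh_sinh in H2.
assert (S1 : (s + p) * sin th = 2 * a * hE g th) by (unfold hE; lra).
assert (S2 : (p - s) * sin th = 2 * a * sinh (g * (PI + th))) by lra.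
unfold hm, hT. split.
- apply (Rmult_eq_reg_r ((s + p) * hE g th)); [| nra].
  transitivity ((s + p) * sin th); [field; lra |]. rewrite S1. field. lra.
- apply (Rmult_eq_reg_r ((s + p) * hE g th * a)); [| apply Rmult_integral_contrapositive; nra].
  transitivity ((s + p) * (2 * a * sinh (g * (PI + th))) / 2); [field; lra |].
  rewrite <- S2.
  transitivity ((p - s) * (2 * a * hE g th) / 2); [rewrite <- S1; field | field; lra].
Qed.

Lemma profile_half g a w th : 0 < w -> Rabs th <= 1 -> hm g th = a * w ->
  half g a ((1 - hT g th) / w) ((1 + hT g th) / w) (PI + th).
Proof.
intros w0 Hth Hm. assert (E := hE_pos g th Hth).
assert (Es : sin th = a * w * hE g th) by (rewrite <- Hm; unfold hm; field; lra).
assert (P := PI2_3_2). unfold PI2 in P. apply Rabs_le_between in Hth.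
split; [lra |].
rewrite (Rplus_comm PI th), neg_sin, neg_cos, (Rplus_comm th PI), Es.
replace (- g * (PI + th)) with (- (g * (PI + th))) by ring.
rewrite exp_minus_cosh_sinh, exp_cosh_sinh.
unfold hT. split.
- transitivity (- a * (hE g th - sinh (g * (PI + th)))); [field; lra | unfold hE; ring].
- transitivity (- a * (hE g th + sinh (g * (PI + th)))); [field; lra | unfold hE; ring].
Qed.

(** Each of the two numbers is cos th plus an exponential, over [hE], hence at least (1 / 2) / [hE].
    So [s] and [p] are at least a constant over [w], uniformly, and small amplitudes give large
    cycles. *)
Lemma hT_bounds K g th : Rabs g <= K -> Rabs th <= 1 ->
  / (2 * (1 + exp (6 * K))) <= 1 - hT g th /\ / (2 * (1 + exp (6 * K))) <= 1 + hT g th.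
Proof.
intros Hg Hth. assert (E := hE_pos g th Hth). assert (U := hE_upper K g th Hg Hth).
assert (P := PI2_3_2). unfold PI2 in P.
assert (C : 1 / 2 <= cos th) by (apply cos_ge_half; lra).
assert (X := exp_pos (6 * K)).
assert (I : / (2 * (1 + exp (6 * K))) <= 1 / 2 * / hE g th).
{ rewrite Rinv_mult. unfold Rdiv. rewrite Rmult_1_l. apply Rmult_le_compat_l; [lra |].
  apply Rinv_le_contravar; lra. }
assert (J := Rinv_0_lt_compat _ E).
assert (X1 := exp_pos (g * (PI + th))). assert (X2 := exp_pos (- (g * (PI + th)))).
rewrite exp_cosh_sinh in X1. rewrite exp_minus_cosh_sinh in X2.
unfold hT. split.
- replace (1 - sinh (g * (PI + th)) / hE g th)
    with ((cos th + (cosh (g * (PI + th)) - sinh (g * (PI + th)))) * / hE g th)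
    by (unfold hE in *; field; lra). nra.
- replace (1 + sinh (g * (PI + th)) / hE g th)
    with ((cos th + (cosh (g * (PI + th)) + sinh (g * (PI + th)))) * / hE g th)
    by (unfold hE in *; field; lra). nra.
Qed.

Lemma half_angle_small K g a s p tau del : Rabs g <= K -> Rabs a <= K -> a <> 0 ->
  0 < del <= 1 -> K * (exp (6 * K) + 1) / sin del < s -> 0 < s ->
  half g a s p tau -> - del < tau - PI < del.
Proof.
intros Hg Ha a0 Hdel Hs s0 H.
assert (B := half_sin_small K g a s p tau Hg Ha a0 s0 H).
assert (P := PI2_3_2). unfold PI2 in P.
assert (Sd : 0 < sin del) by (apply sin_gt_0; lra).
assert (L : K * (exp (6 * K) + 1) / s < sin del).
{ apply (Rmult_lt_reg_r (s / sin del)). { apply Rdiv_lt_0_compat; lra. }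
  replace (K * (exp (6 * K) + 1) / s * (s / sin del))
    with (K * (exp (6 * K) + 1) / sin del) by (field; lra).
  replace (sin del * (s / sin del)) with s by (field; lra). exact Hs. }
destruct H as [I _].
assert (E : sin tau = - sin (tau - PI)).
{ rewrite sin_minus, cos_PI, sin_PI. ring. }
rewrite E, Rabs_Ropp in B. apply Rabs_le_between in B.
split; apply Rnot_le_lt; intros N.
- assert (sin (tau - PI) <= sin (- del)) by (apply sin_incr_1; lra).
  rewrite sin_neg in *. lra.
- assert (sin del <= sin (tau - PI)) by (apply sin_incr_1; lra). lra.
Qed.

(* With [2 b = c - g a + eta xi] the gluing conditions on the line x = 0 become
   [p + c = s'] and [p' + c = s]. *)
Definition perturbed (eta xi g a c : R) : params :=
  {| gammaL := - eta; gammaR := g; bpar := (c - g * a + eta * xi) / 2;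
     xL := - xi; xR := a |}.

Lemma amplitude_root_cycle del eta xi g a c w : 0 < w -> del <= 1 ->
  amplitude_root del g eta a xi c w ->
  exists th th', Rabs th <= 1 /\
    let b := (c - g * a + eta * xi) / 2 in
    let y := g * a + b - (1 - hT g th) / w in
    let y1 := (1 + hT g th) / w + g * a + b in
    full_turn (perturbed eta xi g a c) y y1 y (PI + th) (PI + th').
Proof.
intros w0 Hdel [th [th' [I [I' [E [E' Eq]]]]]].
exists th, th'. split; [apply Rabs_le; lra |]. intros b y y1.
split.
- unfold half_turn, perturbed; simpl. fold b.
  replace (g * a + b - y) with ((1 - hT g th) / w) by (unfold y; ring).
  replace (y1 - g * a - b) with ((1 + hT g th) / w) by (unfold y1; ring).
  apply profile_half; [exact w0 | apply Rabs_le; lra | exact E].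
- unfold half_turn, perturbed; simpl. fold b. rewrite Ropp_involutive.
  replace (- eta * xi + b - - y1) with ((1 + hT eta th') / w)
    by (rewrite <- Eq; unfold y1, b; field; lra).
  replace (- y - - eta * xi - b) with ((1 - hT eta th') / w)
    by (rewrite <- Eq; unfold y, b; field; lra).
  (* The left half-plane has parameter [- eta]; its half turn is one for [eta] read backwards, with
     [s] and [p] exchanged. *)
  rewrite <- (Ropp_involutive eta) at 1. apply half_rev. rewrite Ropp_involutive.
  apply profile_half; [exact w0 | apply Rabs_le; lra | exact E'].
Qed.

(** Far starts make both half-turn angles smaller than [del], so [half_profile] applies on both
    sides. The last equality recovers [y] from the amplitude and the angle, so that distinct cycles
    have distinct amplitudes. *)
Lemma cycle_amplitude_root K del eta xi g a c y y1 tau tau' :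
  params_bounded K (perturbed eta xi g a c) -> 0 < del <= 1 ->
  K * (exp (6 * K) + 1) / sin del + K * K + K < - y -> 0 < y1 ->
  full_turn (perturbed eta xi g a c) y y1 y tau tau' ->
  amplitude_root del g eta a xi c (2 / (y1 - y)) /\
  - del < tau - PI < del /\ hm g (tau - PI) = a * (2 / (y1 - y)) /\
  y = g * a + (c - g * a + eta * xi) / 2 - (1 - hT g (tau - PI)) * (y1 - y) / 2.
Proof.
intros HP Hdel Hy Hy1 [H1 H2].
assert (B1 := bounded_shift K _ HP). assert (B2 := bounded_shift K _ (bounded_rot K _ HP)).
assert (K0 := bounded_pos K _ HP).
unfold half_turn, perturbed in H1, H2, B1, B2. simpl in H1, H2, B1, B2.
set (b := (c - g * a + eta * xi) / 2) in *.
rewrite Ropp_involutive in H2, B2. apply half_rev in H2. rewrite Ropp_involutive in H2.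
apply Rabs_le_between in B1. apply Rabs_le_between in B2.
destruct HP as [[Hg1 [Hg2 [_ [Ha1 Ha2]]]] [xi0 a0]]. simpl in Hg1, Hg2, Ha1, Ha2, xi0, a0.
rewrite Rabs_Ropp in Hg1, Ha1.
assert (xi0' : xi <> 0) by (intros Z; apply xi0; rewrite Z; ring).
set (W := K * (exp (6 * K) + 1) / sin del) in *.
assert (P := PI2_3_2). unfold PI2 in P.
assert (Sd : 0 < sin del) by (apply sin_gt_0; lra).
assert (W0 : 0 < W).
{ assert (X := exp_pos (6 * K)). apply Rdiv_lt_0_compat; nra. }
assert (S1 : W < g * a + b - y) by nra.
assert (S2 : W < - y - - eta * xi - b) by nra.
assert (I1 := half_angle_small K g a (g * a + b - y) _ tau del Hg2 Ha2 a0 Hdel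
  S1 ltac:(lra) H1).
assert (I2 := half_angle_small K eta xi (- y - - eta * xi - b) _ tau' del Hg1 Ha1 xi0' Hdel
  S2 ltac:(lra) H2).
apply half_profile in H1; [| exact a0 | lra | apply Rabs_le; lra].
apply half_profile in H2; [| exact xi0' | lra | apply Rabs_le; lra].
replace (g * a + b - y + (y1 - g * a - b)) with (y1 - y) in H1 by ring.
replace (- y - - eta * xi - b + (- eta * xi + b - - y1)) with (y1 - y) in H2 by ring.
destruct H1 as [M1 E1], H2 as [M2 E2].
split; [| split; [exact I1 | split; [exact M1 |]]].
- exists (tau - PI), (tau' - PI). repeat split; try lra; try assumption.
  rewrite E1, E2. unfold b. field. lra.
- rewrite E1. field. lra.
Qed.

(** Existence comes from the two roots, isolation from there being no others up to [w0]. The bound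
    [wb] is fixed before [g] and [c], which is possible because all estimates are uniform in [K]. *)
Lemma perturbed_has_two_limit_cycles eta xi a K del w0 M :
  params_bounded K (symmetric_params eta xi) -> 0 < del <= 1 -> 0 < w0 ->
  exists wb, 0 < wb <= w0 /\ forall g c w1 w2,
    params_bounded K (perturbed eta xi g a c) -> 0 < w1 < w2 -> w2 < wb ->
    amplitude_root del g eta a xi c w1 -> amplitude_root del g eta a xi c w2 ->
    (forall w, 0 < w <= w0 -> amplitude_root del g eta a xi c w -> w = w1 \/ w = w2) ->
    (forall x y, - del < x < del -> - del < y < del -> hm g x = hm g y -> x = y) ->
    has_big_limit_cycles (perturbed eta xi g a c) M 2.
Proof.
intros HP0 Hdel w00. assert (K0 := bounded_pos K _ HP0).
assert (RB := reach_big K K0).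
set (W := K * (exp (6 * K) + 1) / sin del).
(* Beyond [N] a cycle has amplitude at most [w0], its lower point is far, and the hypothesis of
   [cycle_amplitude_root] holds. *)
set (N := Rmax (Rmax (2 / w0) (reach K)) (W + K * K + K + 1)).
assert (N1 := Rmax_l (Rmax (2 / w0) (reach K)) (W + K * K + K + 1)).
assert (N2 := Rmax_r (Rmax (2 / w0) (reach K)) (W + K * K + K + 1)). fold N in N1, N2.
assert (N3 := Rmax_l (2 / w0) (reach K)). assert (N4 := Rmax_r (2 / w0) (reach K)).
destruct (far_solution_hits K N K0) as [r Hr].
destruct (cycle_curve_norm K (Rmax r (reach K) + 2) K0) as [r2 Hr2].
set (R := Rmax (Rmax r2 (M + 1)) (Rmax N (reach K))).
assert (R1 := Rmax_l (Rmax r2 (M + 1)) (Rmax N (reach K))).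
assert (R2 := Rmax_r (Rmax r2 (M + 1)) (Rmax N (reach K))). fold R in R1, R2.
assert (R3 := Rmax_l r2 (M + 1)). assert (R4 := Rmax_r r2 (M + 1)).
assert (R5 := Rmax_l N (reach K)). assert (R6 := Rmax_r N (reach K)).
set (k := / (2 * (1 + exp (6 * K)))).
assert (k0 : 0 < k) by (apply Rinv_0_lt_compat; assert (X := exp_pos (6 * K)); lra).
set (Z := R + K * K + K). assert (Z0 : 0 < Z) by (unfold Z; nra).
(* For w < k / Z both [s] and [p] are at least Z = R + K * K + K, which leaves at least [R] after
   the shift between [s], [p] and the ordinates. *)
set (wb := Rmin w0 (k / Z)).
assert (wb1 := Rmin_l w0 (k / Z)). assert (wb2 := Rmin_r w0 (k / Z)). fold wb in wb1, wb2.
assert (kZ : 0 < k / Z) by (apply Rdiv_lt_0_compat; assumption).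
assert (wb0 : 0 < wb) by (apply Rmin_glb_lt; assumption).
exists wb. split; [lra |].
intros g c w1 w2 HP Hw12 Hw2 A1 A2 Hu Hinj.
set (P := perturbed eta xi g a c) in *.
set (b := (c - g * a + eta * xi) / 2).
assert (Hshift := bounded_shift K P HP). unfold P, perturbed in Hshift; simpl in Hshift.
fold b in Hshift. apply Rabs_le_between in Hshift.
assert (Hg : Rabs g <= K) by apply HP.
assert (Cyc : forall w, 0 < w < wb -> amplitude_root del g eta a xi c w ->
  exists y y1 tau tau' cv, y <= - R /\ R <= y1 /\ y1 - y = 2 / w /\ far K y y1 /\
    full_turn P y y1 y tau tau' /\ solution P cv /\ cycle_curve P y y1 tau tau' cv).
{ intros w Hw HA.
  destruct (amplitude_root_cycle del eta xi g a c w ltac:(lra) ltac:(lra) HA)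
    as [th [th' [Hth Hf]]]. cbv zeta in Hf. fold b P in Hf.
  destruct (hT_bounds K g th Hg Hth) as [T1 T2]. fold k in T1, T2.
  set (y := g * a + b - (1 - hT g th) / w) in *.
  set (y1 := (1 + hT g th) / w + g * a + b) in *.
  assert (Hk : forall u, k <= u -> Z <= u / w).
  { intros u Hu'. apply (Rmult_le_reg_r w); [lra |].
    replace (u / w * w) with u by (field; lra).
    assert (Z * w <= k); [| lra].
    replace k with (Z * (k / Z)) by (field; lra). apply Rmult_le_compat_l; lra. }
  assert (Y1 := Hk _ T1). assert (Y2 := Hk _ T2).
  assert (Hy : y <= - R) by (unfold y, Z in *; lra).
  assert (Hy1 : R <= y1) by (unfold y1, Z in *; lra).
  assert (Hfar : far K y y1) by (split; lra).
  destruct (cycle_curve_exists K P y y1 _ _ HP Hfar Hf) as [cv [C1 C2]].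
  exists y, y1, (PI + th), (PI + th'), cv. split; [exact Hy |]. split; [exact Hy1 |].
  split; [unfold y, y1; field; lra | auto]. }
destruct (Cyc w1 ltac:(lra) A1) as [y [y1 [tau [tau' [cv [Hy [Hy1 [Ew [Hfar [Hf [Hc1 Hc2]]]]]]]]]]].
destruct (Cyc w2 ltac:(lra) A2) as [x [x1 [sig [sig' [cx [Hx [Hx1 [Ex [Xfar [Xf [Xc1 Xc2]]]]]]]]]]].
assert (Hw : 2 / w1 <> 2 / w2).
{ intros E. assert (2 / w2 < 2 / w1); [| lra].
  unfold Rdiv. apply Rmult_lt_compat_l; [lra |]. apply Rinv_lt_contravar; nra. }
assert (Hxy : x <> y).
{ intros ->. destruct (half_turn_unique K P y y1 x1 tau sig HP ltac:(lra) (proj1 Hf) (proj1 Xf))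
    as [_ E]. apply Hw. rewrite <- Ew, <- Ex, E. reflexivity. }
(* Equal amplitudes give equal values of [hm], hence equal angles by injectivity, hence equal lower
   points. *)
assert (Same : forall v v1 u u' v' v1' s s', v <= - N -> far K v v1 -> full_turn P v v1 v u u' ->
  v' <= - N -> far K v' v1' -> full_turn P v' v1' v' s s' -> v1 - v = v1' - v' -> v = v').
{ intros v v1 u u' v' v1' s s' Hv [_ Fv] Gv Hv' [_ Fv'] Gv' E.
  destruct (cycle_amplitude_root K del eta xi g a c v v1 u u' HP Hdel ltac:(fold W; lra)
    ltac:(lra) Gv) as [_ [J [Em Ey]]].
  destruct (cycle_amplitude_root K del eta xi g a c v' v1' s s' HP Hdel ltac:(fold W; lra)
    ltac:(lra) Gv') as [_ [J' [Em' Ey']]].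
  assert (u - PI = s - PI) by (apply Hinj; try assumption; rewrite Em, Em', E; reflexivity).
  rewrite Ey, Ey', H, E. reflexivity. }
assert (Uniq : forall v v1 s s', v <= - N -> far K v v1 -> full_turn P v v1 v s s' ->
  v = y \/ v = x).
{ intros v v1 s s' Hv Fv Gv.
  destruct (cycle_amplitude_root K del eta xi g a c v v1 s s' HP Hdel ltac:(fold W; lra)
    ltac:(destruct Fv; lra) Gv) as [Ar _].
  assert (D : 2 / w0 <= v1 - v) by (destruct Fv; lra).
  assert (w0' : 0 < 2 / w0) by (apply Rdiv_lt_0_compat; lra).
  destruct (Hu (2 / (v1 - v))) as [E | E]; [| exact Ar | |].
  - split; [apply Rdiv_lt_0_compat; lra |].
    apply (Rmult_le_reg_r ((v1 - v) / w0)); [apply Rdiv_lt_0_compat; lra |].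
    replace (2 / (v1 - v) * ((v1 - v) / w0)) with (2 / w0) by (field; lra).
    replace (w0 * ((v1 - v) / w0)) with (v1 - v) by (field; lra). exact D.
  - left. apply (Same v v1 s s' y y1 tau tau'); try assumption; [lra |].
    rewrite Ew, <- E. field. lra.
  - right. apply (Same v v1 s s' x x1 sig sig'); try assumption; [lra |].
    rewrite Ex, <- E. field. lra. }
assert (Hhit : forall z t, solution P z -> r < pdist (z t) (0, 0) ->
  exists s v, z s = (0, v) /\ v <= - N) by (intros z t Hz; exact (Hr P z t HP Hz)).
assert (L1 : limit_cycle P (orbit cv)).
{ apply (limit_cycle_of_cycle K P y y1 tau tau' cv x r N); try assumption; try lra.
  intros t. assert (A := Hr2 P y y1 y tau tau' cv HP Hf Hc2 ltac:(lra) ltac:(lra) t). lra. }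
assert (L2 : limit_cycle P (orbit cx)).
{ apply (limit_cycle_of_cycle K P x x1 sig sig' cx y r N); try assumption; try lra.
  - intros t. assert (A := Hr2 P x x1 x sig sig' cx HP Xf Xc2 ltac:(lra) ltac:(lra) t). lra.
  - intros v v1 s s' H1 H2 H3. destruct (Uniq v v1 s s' H1 H2 H3); auto. }
destruct (cycle_curve_start P y y1 y tau tau' cv Hf ltac:(apply HP) Hc2) as [S0 S1].
destruct (cycle_curve_start P x x1 x sig sig' cx Xf ltac:(apply HP) Xc2) as [_ S2].
exists (fun i => match i with O => orbit cv | _ => orbit cx end). split.
- intros [| i] _; (split; [assumption |]).
  + exists y1. split; [lra |]. now exists tau.
  + exists x1. split; [lra |]. now exists sig.
- intros i j Hij. assert (i = 0%nat) by lia. assert (j = 1%nat) by lia. subst i j.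
  intros Hs. destruct (proj1 (Hs (0, y))) as [t Et]; [now exists 0 |].
  destruct (cycle_curve_on_axis K P x x1 sig sig' cx HP Xfar Xf Xc2 (0, y)) as [E | E].
  + now exists t.
  + reflexivity.
  + injection E as E. now apply Hxy.
  + injection E as E. lra.
Qed.

(** * Choice of the perturbation *)

Lemma two_limit_cycles_bifurcate eta xi : eta <> 0 -> xi <> 0 ->
  big_limit_cycles_bifurcate (symmetric_params eta xi) 2.
Proof.
intros heta hxi e M e0 _.
set (e' := Rmin e 1). assert (m1 := Rmin_l e 1). assert (m2 := Rmin_r e 1).
assert (e0' : 0 < e') by (apply Rmin_glb_lt; lra). fold e' in m1, m2.
assert (Eta0 := Rabs_pos_lt eta heta). assert (Xi0 := Rabs_pos_lt xi hxi).
set (k := e' / (4 * (Rabs eta + 1) * (Rabs xi + 1))).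
assert (D0 : 0 < 4 * (Rabs eta + 1) * (Rabs xi + 1)) by (apply Rmult_lt_0_compat; lra).
assert (k0 : 0 < k) by (apply Rdiv_lt_0_compat; assumption).
assert (Hk : k * (4 * (Rabs eta + 1) * (Rabs xi + 1)) = e') by (unfold k; field; lra).
(* This ensures a ^ 2 > xi ^ 2, the condition for concavity, while [k] keeps |a - xi| (|eta| + 1)
   within e' / 4. *)
set (a := xi * (1 + k)).
assert (Hax : Rabs (a - xi) = k * Rabs xi).
{ unfold a. replace (xi * (1 + k) - xi) with (k * xi) by ring.
  rewrite Rabs_mult, (Rabs_pos_eq k); lra. }
assert (B1 : k * Rabs xi * (Rabs eta + 1) <= e' / 4) by nra.
assert (B2 : k * Rabs xi <= e' / 4) by nra.
assert (B3 : Rabs a <= Rabs xi + 1).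
{ replace a with (a - xi + xi) by ring. eapply Rle_trans; [apply Rabs_triang |]. lra. }
assert (xi2 : 0 < xi ^ 2) by nra.
assert (Ha2 : xi ^ 2 < a ^ 2) by (unfold a; nra).
assert (a0 : a <> 0) by (intros Z; rewrite Z in Ha2; nra).
destruct (two_amplitudes eta a xi heta Ha2) as [del [w0 [Hdel [w00 Hamp]]]].
set (K := Rabs eta + Rabs xi + 2).
assert (HP0 : params_bounded K (symmetric_params eta xi)).
{ destruct (symmetric_bounded eta xi hxi) as [[H1 [H2 [H3 [H4 H5]]]] H6].
  split; [| exact H6]. unfold K. repeat split; lra. }
destruct (perturbed_has_two_limit_cycles eta xi a K del w0 M HP0 Hdel w00) as [wb [Hwb Hcyc]].
set (e1 := e' / (2 * (Rabs xi + 3))).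
assert (e10 : 0 < e1) by (apply Rdiv_lt_0_compat; lra).
assert (He1 : e1 * (2 * (Rabs xi + 3)) = e') by (unfold e1; field; lra).
destruct (Hamp wb e1 Hwb e10) as [g [c [w1 [w2 [Hg [Hc [Hw12 [Hw2 [A1 [A2 [Hu Hinj]]]]]]]]]]].
assert (Hb : Rabs ((c - g * a + eta * xi) / 2) < e').
(* The parameter b splits into three small errors: of [c] from its critical value, of [a] from [xi],
   and of [g] from [eta]. The last is multiplied by [a], hence the factor |xi| + 3 in [e1]. *)
{ replace ((c - g * a + eta * xi) / 2)
    with (((c - eta * (xi - a)) + (2 * - eta * (a - xi) + - (g - eta) * a)) / 2) by field.
  unfold Rdiv. rewrite Rabs_mult, (Rabs_pos_eq (/ 2)) by lra.
  assert (Rabs (c - eta * (xi - a) + (2 * - eta * (a - xi) + - (g - eta) * a))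
    <= e1 + (2 * (Rabs eta * (k * Rabs xi)) + e1 * (Rabs xi + 1))); [| nra].
  eapply Rle_trans; [apply Rabs_triang |]. apply Rplus_le_compat; [lra |].
  eapply Rle_trans; [apply Rabs_triang |]. apply Rplus_le_compat.
  - rewrite !Rabs_mult, Rabs_Ropp, Hax, (Rabs_pos_eq 2) by lra. lra.
  - rewrite Rabs_mult, Rabs_Ropp. apply Rmult_le_compat; try apply Rabs_pos; lra. }
assert (Hge : Rabs (g - eta) < e') by nra.
exists (perturbed eta xi g a c). split.
- unfold params_close, perturbed, symmetric_params; simpl.
  rewrite !Rminus_diag, Rabs_R0, Rminus_0_r, Hax. repeat split; lra.
- apply (Hcyc g c w1 w2); try assumption.
  unfold params_bounded, perturbed; simpl. rewrite !Rabs_Ropp.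
  assert (Rabs g <= Rabs eta + 1).
  { replace g with (g - eta + eta) by ring. eapply Rle_trans; [apply Rabs_triang |]. lra. }
  unfold K. repeat split; lra.
Qed.

Theorem proposition10 (eta xi : R) (heta : eta <> 0) (hxi : xi <> 0) :
  let P0 := {| gammaL := - eta; gammaR := eta; bpar := 0;
               xL := - xi; xR := xi |} in
  center_at_infinity P0 /\
  Rbar_le (Finite 2) (local_cyclicity_at_infinity P0).
Proof.
intros P0. split; [exact (symmetric_center eta xi hxi) |].
destruct (Lub_Rbar_correct (fun r => exists k : nat,
  r = INR k /\ big_limit_cycles_bifurcate P0 k)) as [H _].
apply (H 2). exists 2%nat. split; [reflexivity |].
exact (two_limit_cycles_bifurcate eta xi heta hxi).
Qed.
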